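(* There is a constant $c>0$ such that, for $n$ a sufficiently large even integer, a uniformly random ordered matching $M$ on $n$ vertices with $\chi_{<}(M)=2$ asymptotically almost surely satisfies $$r_{<}(K_3,M)\ \ge\ c\,\frac{n^{4/3}}{(\log n)^{1/3}}.$$ That is, if $M$ is chosen uniformly at random from the set of all ordered matchings on vertex set $[n]$ without isolated vertices and with interval chromatic number $2$, then the probability that the displayed inequality holds tends to $1$ as $n\to\infty$ through even integers.
   Context: An ordered graph is a (finite, simple) graph together with a linear order on its vertex set; the vertex set of an ordered graph on $n$ vertices is identified with $[n]=\{1,\dots,n\}$ with its natural order. An ordered graph $G$ on $[N]$ contains an ordered copy of an ordered graph $H$ on $[m]$ if there is a map $\phi:[m]\to[N]$ with $\phi(i)<\phi(j)$ whenever $1\le i<j\le m$, and $\phi(i)\phi(j)\in E(G)$ whenever $ij\in E(H)$. For ordered graphs $H_1,H_2$, the ordered Ramsey number $r_{<}(H_1,H_2)$ is the least integer $N$ such that every coloring of the edges of the naturally ordered complete graph on $[N]$ with colors $1,2$ contains an ordered copy of $H_i$ in color $i$ for some $i\in\{1,2\}$. $K_3$ denotes the (ordered) triangle. The interval chromatic number $\chi_{<}(G)$ of an ordered graph $G$ is the minimum number of consecutive intervals that partition its vertex set such that no interval contains an edge of $G$. All matchings are assumed to have no isolated vertices, so an ordered matching on $n$ vertices is a perfect matching on $[n]$. Writing $n=2m$, the ordered matchings on $[2m]$ with interval chromatic number $2$ are exactly the matchings $M_\pi=\{\{i,m+\pi(i)\}:1\le i\le m\}$ for permutations $\pi$ of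 $[m]$, and $\pi\mapsto M_\pi$ is a bijection; thus the uniform distribution corresponds to a uniformly random $\pi$. Logarithms are to base $2$. *)

(* Defs.v *)
From HB Require Import structures.
From mathcomp Require Import all_boot all_order all_algebra.

Set Implicit Arguments.
Unset Strict Implicit.
Unset Printing Implicit Defensive.

Import Order.TTheory GRing.Theory Num.Theory.

(* An ordered graph on n vertices: a finite simple graph on 'I_n = {0,..,n-1} *)
(* with its natural order, given by its set of two-element edges.             *)
Definition is_edge_set n (E : {set {set 'I_n}}) : bool :=
  [forall e in E, #|e| == 2].

Record ograph (n : nat) := OGraph {
  edges : {set {set 'I_n}};
  edgesP : is_edge_set edges }.

HB.instance Definition _ n := [isSub for @edges n].
HB.instance Definition _ n := [Finite of ograph n by <:].

Definition contains N m (G : ograph N) (H : ograph m) : bool :=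
  [exists phi : {ffun 'I_m -> 'I_N},
     [forall i : 'I_m, forall j : 'I_m, (i < j) ==> (phi i < phi j)] &&
     [forall i : 'I_m, forall j : 'I_m,
        ([set i; j] \in edges H) ==> ([set phi i; phi j] \in edges G)]].

Lemma complete_subproof n : is_edge_set [set e : {set 'I_n} | #|e| == 2].
Proof. by apply/forall_inP => e; rewrite inE. Qed.

Definition complete_graph n : ograph n := OGraph (complete_subproof n).

(* An edge colouring of the complete graph is given by a function on all      *)
(* subsets of the vertex set, of which only the values on pairs are used.     *)
(* Colour 1 is [true] and colour 2 is [false].                                *)
Definition coloring N := {ffun {set 'I_N} -> bool}.

Lemma color_class_subproof N (c : coloring N) (a : bool) :
  is_edge_set [set e in edges (complete_graph N) | c e == a].
Proof. by apply/forall_inP => e; rewrite !inE => /andP[]. Qed.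

Definition color_class N (c : coloring N) (a : bool) : ograph N :=
  OGraph (color_class_subproof c a).

Definition arrows N m1 m2 (H1 : ograph m1) (H2 : ograph m2) : bool :=
  [forall c : coloring N,
     contains (color_class c true) H1 || contains (color_class c false) H2].

Definition monochromatic N (c : coloring N) (a : bool) (B : {set 'I_N}) :=
  forall x y, x \in B -> y \in B -> x != y -> c [set x; y] = a.

Lemma ramsey_sets s t : exists n, forall N (c : coloring N) (A : {set 'I_N}),
  n <= #|A| ->
  (exists B : {set 'I_N}, [/\ B \subset A, #|B| = s & monochromatic c true B]) \/
  (exists B : {set 'I_N}, [/\ B \subset A, #|B| = t & monochromatic c false B]).
Proof.
have [k] := ubnP (s + t); elim: k s t => // k IH [|s] [|t] lt_k.
- by exists 0 => N c A _; left; exists set0; split;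
    rewrite ?sub0set ?cards0 // => x y; rewrite inE.
- by exists 0 => N c A _; left; exists set0; split;
    rewrite ?sub0set ?cards0 // => x y; rewrite inE.
- by exists 0 => N c A _; right; exists set0; split;
    rewrite ?sub0set ?cards0 // => x y; rewrite inE.
have [|n1 H1] := IH s t.+1.
  by move: lt_k; rewrite addSn ltnS.
have [|n2 H2] := IH s.+1 t.
  by move: lt_k; rewrite addnS ltnS.
exists (n1 + n2).+1 => N c A leA.
have /card_gt0P[v vA] : 0 < #|A| by apply: leq_trans leA.
pose D a := [set x in A :\ v | c [set v; x] == a].
have DA a : D a \subset A.
  by apply/subsetP => x; rewrite !inE => /andP[/andP[_ ->]].
have vD a : v \notin D a by rewrite !inE eqxx.
have cardD : #|D true| + #|D false| >= n1 + n2.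
  have <- : #|A :\ v| = #|D true| + #|D false|.
    rewrite -(cardsID [set x | c [set v; x]] (A :\ v)); congr (_ + _).
      by apply: eq_card => x; rewrite !inE; case: (c _); rewrite ?andbT ?andbF.
    by apply: eq_card => x; rewrite !inE; case: (c _); rewrite ?andbT ?andbF.
  by move: leA; rewrite (cardsD1 v A) vA add1n ltnS.
have ext a (B : {set 'I_N}) : B \subset D a -> monochromatic c a B ->
    [/\ v |: B \subset A, #|v |: B| = #|B|.+1 & monochromatic c a (v |: B)].
  move=> sB mB; have vB : v \notin B.
    by apply: contra (vD a) => /(subsetP sB).
  have cv x : x \in B -> c [set v; x] = a.
    by move=> /(subsetP sB); rewrite inE => /andP[_ /eqP].
  split; first by rewrite subUset sub1set vA (subset_trans sB).
    by rewrite cardsU1 vB.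
  move=> x y; rewrite !inE => /orP[/eqP->|xB] /orP[/eqP->|yB].
  - by rewrite eqxx.
  - by move=> _; apply: cv.
  - by move=> _; rewrite setUC; apply: cv.
  - exact: mB.
have [le1|lt1] := leqP n1 #|D true|.
  have [[B [sB cB mB]]|[B [sB cB mB]]] := H1 N c _ le1.
    by left; exists (v |: B); have [? -> ?] := ext _ _ sB mB; rewrite cB.
  by right; exists B; split; rewrite ?(subset_trans sB).
have le2 : n2 <= #|D false|.
  rewrite leqNgt; apply/negP => lt2.
  by move: cardD; rewrite leqNgt -addSn leq_add // ltnW.
have [[B [sB cB mB]]|[B [sB cB mB]]] := H2 N c _ le2.
  by left; exists B; split; rewrite ?(subset_trans sB).
by right; exists (v |: B); have [? -> ?] := ext _ _ sB mB; rewrite cB.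
Qed.

Lemma monochromatic_contains N (c : coloring N) a (B : {set 'I_N}) m
    (H : ograph m) :
  #|B| = m -> monochromatic c a B -> contains (color_class c a) H.
Proof.
move=> cB mB.
pose phi := [ffun i : 'I_m => enum_val (cast_ord (esym cB) i)].
have phi_in i : phi i \in B by rewrite ffunE enum_valP.
have phi_inj i j : phi i = phi j -> i = j.
  by rewrite !ffunE => /enum_val_inj /cast_ord_inj.
apply/existsP; exists phi; apply/andP; split.
  apply/forallP => i; apply/forallP => j; apply/implyP => ij.
  have srt : sorted ltn (map val (enum B)).
    have sub : subseq (map val (enum B)) (iota 0 N).
      rewrite -val_enum_ord; apply: map_subseq.
      by rewrite {1}/enum_mem -enumT filter_subseq.
    exact: (subseq_sorted ltn_trans sub (iota_ltn_sorted _ _)).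
  have sz : size (enum B) = m by rewrite -cardE.
  rewrite !ffunE !(enum_val_nth (phi i)) /=.
  rewrite -!(nth_map (phi i) 0 val) ?sz //.
  by apply: (sorted_ltn_nth ltn_trans) => //; rewrite inE size_map sz.
apply/forallP => i; apply/forallP => j; apply/implyP => ijH.
have nij : i != j.
  have := forall_inP (edgesP H) _ ijH.
  by rewrite cards2; case: (i != j).
have nphi : phi i != phi j by apply: contra nij => /eqP/phi_inj->.
by rewrite !inE cards2 nphi /= mB.
Qed.

Lemma ordered_ramsey_exists m1 m2 (H1 : ograph m1) (H2 : ograph m2) :
  exists N, arrows N H1 H2.
Proof.
have [n Hn] := ramsey_sets m1 m2.
exists n; apply/forallP => c; apply/orP.
have [|[B [_ cB mB]]|[B [_ cB mB]]] := Hn n c [set: 'I_n].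
- by rewrite cardsT card_ord.
- by left; apply: monochromatic_contains mB.
- by right; apply: monochromatic_contains mB.
Qed.

Definition ordered_ramsey m1 m2 (H1 : ograph m1) (H2 : ograph m2) : nat :=
  ex_minn (ordered_ramsey_exists H1 H2).

Definition ord_interval n (A : {set 'I_n}) : bool :=
  [forall i in A, forall j in A, forall k : 'I_n, (i <= k <= j) ==> (k \in A)].

Definition interval_partition n (G : ograph n) (P : {set {set 'I_n}}) : bool :=
  [&& partition P [set: 'I_n],
      [forall A in P, ord_interval A] &
      [forall A in P, forall e in edges G, ~~ (e \subset A)]].

Lemma interval_partition_exists n (G : ograph n) :
  exists k, [exists P, interval_partition G P && (#|P| == k)].
Proof.
pose P := [set [set i] | i : 'I_n].
exists #|P|; apply/existsP; exists P; rewrite eqxx andbT; apply/and3P; split.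
- apply/and3P; split.
  + rewrite /cover; apply/eqP/setP => i; rewrite inE; apply/bigcupP.
    by exists [set i]; rewrite ?inE //; apply/imsetP; exists i.
  + apply/trivIsetP => _ _ /imsetP[i _ ->] /imsetP[j _ ->] nij.
    by rewrite disjoints1 inE; apply: contraNneq nij => ->.
  + by apply/imsetP => -[i _ /setP/(_ i)]; rewrite !inE eqxx.
- apply/forall_inP => _ /imsetP[i _ ->].
  apply/forall_inP => x /set1P->; apply/forall_inP => y /set1P->.
  apply/forallP => k; apply/implyP => ik.
  by rewrite inE -val_eqE eqn_leq /= andbC.
- apply/forall_inP => _ /imsetP[i _ ->]; apply/forall_inP => e eG.
  apply/negP => /subset_leq_card.
  by rewrite cards1 (eqP (forall_inP (edgesP G) _ eG)).
Qed.

Definition interval_chromatic_number n (G : ograph n) : nat :=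
  ex_minn (interval_partition_exists G).

Definition is_matching n (G : ograph n) : bool := trivIset (edges G).

Definition no_isolated_vertex n (G : ograph n) : bool :=
  cover (edges G) == [set: 'I_n].

Definition matchings_chi2 n : {set ograph n} :=
  [set M | [&& is_matching M, no_isolated_vertex M &
               interval_chromatic_number M == 2]].

From mathcomp Require Import all_classical all_reals all_analysis.

Local Open Scope ring_scope.

Definition finite_uniform_pr (R : realType) (T : finType) (A : {set T})
    (p : pred T) : R :=
  #|[set x in A | p x]|%:R / #|A|%:R.

Arguments finite_uniform_pr R {T} A p.

Definition log2 (R : realType) (x : R) : R := ln x / ln 2.

(* Main.v *)
Require Import Defs.
From mathcomp Require Import all_boot all_order all_algebra all_fingroup.
From mathcomp Require Import all_classical all_reals all_analysis.
From mathcomp Require Import fintype finset bigop.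
From mathcomp Require Import zify ring lra.

(** Cut the N vertices into k consecutive blocks of equal size, and colour a
    pair of vertices 1 when its two blocks are adjacent in a triangle-free graph
    E on the blocks; pairs inside a block get colour 2.  Write b for a quantity
    of order log n.

    The graph E has about b 4^b vertices and density about 2^-b, and any two
    vertex sets of size about b 2^b span a constant proportion of the expected
    number of edges.  It comes from two random graphs G and H on r = 4^b labels.
    Every vertex of E carries two labels f and g; two vertices are joined when
    their f-labels are adjacent in G or their g-labels are adjacent in H, except
    that an edge is dropped if it would close a triangle with two edges of a
    single colour.  Since vertices with the same label are twins, only a small
    proportion of the pairs is lost.  A vertex set concentrated on few f-labels
    is spread over many g-labels, and the entropy of such a set is paid for by
    the number of independent bits that it sees in G.

    For a random matching M_pi the graph E stays fixed and only pi is random.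
    A copy of M_pi in colour 2 gives monotone maps of the two halves of M_pi to
    the blocks.  Sampling these maps at 2k points leaves 2^O(k) types, and each
    type forbids a proportion of order 2^-b of the m^2 pairs (x, pi x),
    because the edge count of E passes from sets to weights bounded by the block
    size.  A random permutation avoids X forbidden entries with probability at
    most 2 exp(-X/(2m)), so the union bound works as soon as m is of order
    b 8^b.  The number of vertices is then of order 2^b m. *)

Set Implicit Arguments.
Unset Strict Implicit.
Unset Printing Implicit Defensive.
Import Order.TTheory GRing.Theory Num.Theory.
Import numFieldNormedType.Exports.
Local Open Scope ring_scope.

(** * Products of finite probability spaces *)

(** Expectation for independent coordinates with the common law [mu]; the probability of an event is
    the expectation of its 0-1 function. That [mu] is a probability is assumed lemma by lemma. *)
Definition Ex (R : realType) (I T : finType) (mu : T -> R)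
    (F : {ffun I -> T} -> R) : R :=
  \sum_(w : {ffun I -> T}) (\prod_i mu (w i)) * F w.

Lemma Ex_prod (R : realType) (I T : finType) (mu : T -> R) (F : I -> T -> R) :
  Ex mu (fun w => \prod_i F i (w i)) = \prod_i \sum_t mu t * F i t.
Proof.
rewrite bigA_distr_bigA; apply: eq_bigr => w _.
by rewrite -big_split.
Qed.

Lemma Ex_le (R : realType) (I T : finType) (mu : T -> R) F G :
  (forall t, 0 <= mu t) -> (forall w : {ffun I -> T}, F w <= G w) ->
  Ex mu F <= Ex mu G.
Proof.
move=> mu0 FG; apply: ler_sum => w _; apply: ler_wpM2l => //.
by apply: prodr_ge0 => i _.
Qed.

Lemma ExZ (R : realType) (I T : finType) (mu : T -> R) c
    (F : {ffun I -> T} -> R) :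
  Ex mu (fun w => c * F w) = c * Ex mu F.
Proof. by rewrite /Ex big_distrr; apply: eq_bigr => w _; rewrite mulrCA. Qed.

Lemma Ex_sum (R : realType) (I T J : finType) (mu : T -> R) (P : pred J)
    (F : J -> {ffun I -> T} -> R) :
  Ex mu (fun w => \sum_(j | P j) F j w) = \sum_(j | P j) Ex mu (F j).
Proof.
by rewrite /Ex exchange_big; apply: eq_bigr => w _; rewrite big_distrr.
Qed.

Lemma ExD (R : realType) (I T : finType) (mu : T -> R)
    (F G : {ffun I -> T} -> R) :
  Ex mu (fun w => F w + G w) = Ex mu F + Ex mu G.
Proof. by rewrite /Ex -big_split; apply: eq_bigr => w _; rewrite mulrDr. Qed.

Lemma Ex1 (R : realType) (I T : finType) (mu : T -> R) :
  \sum_t mu t = 1 -> Ex mu (fun _ : {ffun I -> T} => 1) = 1.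
Proof.
move=> mu1; under [LHS]eq_bigr do rewrite mulr1.
by rewrite -(bigA_distr_bigA (fun=> mu)) big1.
Qed.

Definition upd (I T : finType) (w : {ffun I -> T}) (i : I) (t : T) :
  {ffun I -> T} := [ffun k => if k == i then t else w k].

(** Exchanging the [i]-th value of [w] with the fresh sample [t] is an involution on pairs [(w, t)]
    that preserves weights. One coordinate can thus be redrawn and averaged first. *)
Lemma Ex_resample (R : realType) (I T : finType) (mu : T -> R)
    (F : {ffun I -> T} -> R) (i : I) :
  \sum_t mu t = 1 ->
  Ex mu F = Ex mu (fun w => \sum_t mu t * F (upd w i t)).
Proof.
move=> mu1; rewrite /Ex.
under [RHS]eq_bigr => w _ do rewrite big_distrr /=.
rewrite pair_big /=.
pose h (x : {ffun I -> T} * T) := (upd x.1 i x.2, x.1 i).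
have hK : involutive h.
  case=> w t; rewrite /h /=; congr pair; last by rewrite ffunE eqxx.
  by apply/ffunP => k; rewrite !ffunE; case: eqP => [->|].
rewrite (reindex_inj (inv_inj hK)) /=.
transitivity (\sum_(w : {ffun I -> T}) \sum_t
    ((\prod_k mu (w k)) * F w) * mu t).
  by apply: eq_bigr => w _; rewrite -big_distrr /= mu1 mulr1.
rewrite pair_big /=; apply: eq_bigr => -[w t] _ /=.
have -> : upd (upd w i t) i (w i) = w by have [] := hK (w, t).
rewrite mulrAC [RHS]mulrA; congr (_ * _).
rewrite (bigD1 i) //= [in RHS](bigD1 i) //= ffunE eqxx.
have -> : \prod_(k | k != i) mu (upd w i t k) = \prod_(k | k != i) mu (w k).
  by apply: eq_bigr => k /negPf ki; rewrite ffunE ki.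
by rewrite mulrC mulrA mulrAC.
Qed.

(** By independence the exponential moment is a product, and each factor is at most 1 + (beta - 1)
    q. *)
Lemma Ex_expn_count (R : realType) (I T : finType) (mu : T -> R)
    (W : I -> pred T) (S : {set I}) (q beta : R) :
  (forall t, 0 <= mu t) -> \sum_t mu t = 1 ->
  (forall i, i \in S -> \sum_(t | W i t) mu t <= q) -> 1 <= beta ->
  Ex mu (fun w => beta ^+ #|[set i in S | W i (w i)]|)
    <= expR ((beta - 1) * q * #|S|%:R).
Proof.
move=> mu0 mu1 Wq b1; have b0 : 0 < beta by exact: lt_le_trans b1.
pose F i t := if (i \in S) && W i t then beta else 1.
apply: le_trans (_ : Ex mu (fun w => \prod_i F i (w i)) <= _).
  apply: Ex_le => // w; rewrite le_eqVlt; apply/orP; left; apply/eqP.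
  rewrite /F -big_mkcond /= -prodr_const; apply: eq_bigl => i.
  by rewrite inE.
rewrite Ex_prod expRM_natr -prodr_const [leRHS]big_mkcond /=.
apply: ler_prod => i _; apply/andP; split.
  apply: sumr_ge0 => t _; apply: mulr_ge0 => //.
  by rewrite /F; case: ifP => // _; apply: ltW.
rewrite /F; case: ifP => /= iS; last by under eq_bigr do rewrite mulr1; rewrite mu1.
apply: le_trans (expR_ge1Dx _).
have -> : \sum_t mu t * (if W i t then beta else 1) =
    \sum_t mu t + (beta - 1) * \sum_(t | W i t) mu t.
  rewrite [in RHS](big_mkcond (W i)) mulr_sumr -big_split /=.
  by apply: eq_bigr => t _; case: (W i t); ring.
by rewrite mu1 lerD2l ler_wpM2l ?Wq // subr_ge0.
Qed.

(** Markov's inequality for [beta] raised to the count; the factor beta - 1 in the exponent is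
    relaxed to beta. *)
Lemma upper_tail (R : realType) (I T : finType) (mu : T -> R)
    (W : I -> pred T) (S : {set I}) (q beta : R) (n : nat) :
  (forall t, 0 <= mu t) -> \sum_t mu t = 1 -> 0 <= q ->
  (forall i, i \in S -> \sum_(t | W i t) mu t <= q) -> 1 <= beta ->
  Ex mu (fun w => (n <= #|[set i in S | W i (w i)]|)%N%:R)
    <= beta ^- n * expR (beta * q * #|S|%:R).
Proof.
move=> mu0 mu1 q0 Wq b1; have b0 : 0 < beta by exact: lt_le_trans b1.
apply: (@le_trans _ _ (beta ^- n * expR ((beta - 1) * q * #|S|%:R))); last first.
  rewrite ler_wpM2l ?invr_ge0 ?exprn_ge0 ?(ltW b0) // ler_expR.
  by rewrite ler_wpM2r // ler_wpM2r // gerBl.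
apply: le_trans; last first.
  apply: ler_wpM2l (Ex_expn_count mu0 mu1 Wq b1).
  by rewrite invr_ge0 exprn_ge0 // ltW.
rewrite -ExZ; apply: Ex_le => // w.
case: leqP => [le_n|_]; last by rewrite mulr_ge0 ?invr_ge0 ?exprn_ge0 // ltW.
by rewrite ler_pdivlMl ?exprn_gt0 // mulr1 ler_weXn2l.
Qed.

(* [o q w] tells whether coordinate q is counted; it may only depend on the
   coordinates of smaller rank, so it is known before [w q] is drawn. *)
Lemma predictable_Ex_le1 (R : realType) (I T : finType) (mu : T -> R)
    (rk : I -> nat) (o : I -> {ffun I -> T} -> bool) (h : T -> R) :
  (forall t, 0 <= mu t) -> \sum_t mu t = 1 ->
  injective rk ->
  (forall q w i t, (rk q <= rk i)%N -> o q (upd w i t) = o q w) ->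
  (forall t, 0 <= h t) -> \sum_t mu t * h t <= 1 ->
  Ex mu (fun w => \prod_(q | o q w) h (w q)) <= 1.
Proof.
move=> mu0 mu1 rkI oP h0 h1.
(* The partial products over coordinates of rank below [n] have non-increasing expectation:
   redrawing the coordinate of rank [n] multiplies the product by a factor of mean at most 1. *)
pose G n w := \prod_(q | (rk q < n)%N && o q w) h (w q).
suff Gn n : Ex mu (G n) <= 1.
  apply: le_trans (Gn (\max_q rk q).+1); apply: Ex_le => // w.
  rewrite le_eqVlt; apply/orP; left; apply/eqP; apply: eq_bigl => q.
  by rewrite ltnS leq_bigmax.
elim: n => [|n IHn].
  rewrite -[leRHS](@Ex1 _ I T mu) //; apply: Ex_le => // w.
  by rewrite /G big1 // => q /andP[].
apply: le_trans IHn; have [i /eqP rki|noi] := pickP (fun i => rk i == n); last first.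
  apply: Ex_le => // w; rewrite /G le_eqVlt; apply/orP; left; apply/eqP; apply: eq_bigl => q.
  by rewrite ltnS leq_eqVlt noi.
rewrite (Ex_resample _ i) //; apply: Ex_le => // w.
have Gi t : G n.+1 (upd w i t) = G n w * (if o i w then h t else 1).
  rewrite /G; case: ifP => oi; last first.
    rewrite mulr1; apply: eq_big => q.
      rewrite ltnS leq_eqVlt -rki.
      case: (eqVneq (rk q) (rk i)) => [/rkI->|ne] /=.
        by rewrite oP // oi ltnn.
      by case: ltnP => //= lt; rewrite oP // ltnW.
    move=> /andP[_ oq]; rewrite ffunE; case: eqP => // qi.
    by move: oq; rewrite qi oP // oi.
  rewrite (bigD1 i) /=; last by rewrite rki ltnSn oP.
  rewrite ffunE eqxx mulrC; congr (_ * _); apply: eq_big => q.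
    rewrite ltnS leq_eqVlt -rki.
    case: (eqVneq q i) => [->|ne] /=; first by rewrite andbF ltnn.
    rewrite (inj_eq rkI) (negPf ne) andbT /=.
    by case: ltnP => //= lt; rewrite oP // ltnW.
  by move=> /andP[_ ne]; rewrite ffunE (negPf ne).
under eq_bigr do rewrite Gi mulrCA.
rewrite -mulr_sumr ler_piMr //; first by apply: prodr_ge0.
by case: (o i w) => //; under eq_bigr do rewrite mulr1; rewrite mu1.
Qed.

(** * Tail bounds for Bernoulli bits *)

Definition bern (R : realType) (p : R) (b : bool) : R := if b then p else 1 - p.

Lemma bern_sum (R : realType) (p : R) : \sum_b bern p b = 1.
Proof. by rewrite big_bool /= addrC subrK. Qed.

Lemma bern_ge0 (R : realType) (p : R) b : 0 <= p <= 1 -> 0 <= bern p b.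
Proof. by case: b => /andP[p0 p1] /=; rewrite ?subr_ge0. Qed.

Lemma expRN1_le (R : realType) : expR (-1 : R) <= 1 / 2.
Proof.
rewrite expRN div1r lef_pV2 ?posrE ?expR_gt0 //.
by apply: le_trans (expR_ge1Dx _); lra.
Qed.

(** The mean of exp(-bit) is at most 1 - p/2, because exp(-1) <= 1/2; hence the weight exp(p/2 -
    bit) has mean at most 1. On the event the product of the weights of the counted coordinates is
    at least exp(p N/2 - s), and Markov's inequality concludes. *)
Lemma predictable_lower_tail (R : realType) (I : finType) (p : R)
    (rk : I -> nat) (o : I -> {ffun I -> bool} -> bool) (N s : R) :
  0 <= p <= 1 -> injective rk ->
  (forall q w i t, (rk q <= rk i)%N -> o q (upd w i t) = o q w) ->
  Ex (bern p) (fun w => ((N <= #|[set q | o q w]|%:R) &&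
                         (#|[set q | o q w && w q]|%:R <= s))%:R)
   <= expR (s - p / 2 * N).
Proof.
move=> p01 rkI oP; have /andP[p0 p1] := p01.
pose h b : R := expR (p / 2) * expR (- b%:R).
have h0 b : 0 <= h b by rewrite mulr_ge0 ?expR_ge0.
have h1 : \sum_b bern p b * h b <= 1.
  rewrite big_bool /= /h oppr0 expR0 mulr1.
  apply: (@le_trans _ _ (expR (p / 2) * (1 + - (p / 2)))); last first.
    rewrite -[leRHS](expRxMexpNx_1 (p / 2)) ler_pM2l ?expR_gt0 //.
    exact: expR_ge1Dx.
  have e1 := expRN1_le R; have e0 := expR_gt0 (p / 2).
  have : 0 <= (expR (p / 2) * p) * (1 / 2 - expR (- 1)).
    by rewrite mulr_ge0 ?subr_ge0 // mulr_ge0 // ltW.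
  by rewrite -subr_ge0 => H; rewrite -subr_ge0; apply: le_trans H _; lra.
have := @predictable_Ex_le1 R I bool (bern p) rk o h
   (fun b => bern_ge0 b p01) (bern_sum p) rkI oP h0 h1.
move=> H; apply: (@le_trans _ _ (expR (s - p / 2 * N) * 1)); last by rewrite mulr1.
apply: le_trans; last by apply: ler_wpM2l H; apply: expR_ge0.
rewrite -ExZ; apply: Ex_le => [b|w]; first exact: bern_ge0.
have -> : \prod_(q | o q w) h (w q) =
   expR (p / 2 * #|[set q | o q w]|%:R - #|[set q | o q w && w q]|%:R).
  rewrite /h big_split /= expRD expRM_natr -prodr_const; congr (_ * _).
    by apply: eq_bigl => q; rewrite inE.
  rewrite -expR_sum; congr expR; rewrite sumrN; congr (- _).
  rewrite -sum1_card natr_sum big_mkcond [RHS]big_mkcond /=.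
  by apply: eq_bigr => q _; rewrite !inE; case: (o q w); case: (w q).
rewrite -expRD; case: andP => [[le1 le2]|_]; last exact: expR_ge0.
rewrite -[leLHS]expR0 ler_expR; nra.
Qed.

(** The rows of a random matrix are independent. *)
Lemma Ex_curry (R : realType) (A B T : finType) (mu : T -> R)
    (F : A -> {ffun B -> T} -> R) :
  Ex mu (fun w : {ffun A * B -> T} => \prod_a F a [ffun x => w (a, x)])
    = \prod_a Ex mu (F a).
Proof.
rewrite [RHS](bigA_distr_bigA) /Ex /=.
pose h (w : {ffun A * B -> T}) : {ffun A -> {ffun B -> T}} :=
  [ffun a => [ffun x => w (a, x)]].
pose h' (w : {ffun A -> {ffun B -> T}}) : {ffun A * B -> T} :=
  [ffun q => w q.1 q.2].
rewrite [RHS](reindex h) /=; last first.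
  exists h' => w _; rewrite /h /h'.
    by apply/ffunP => -[a x]; rewrite !ffunE.
  by apply/ffunP => a; apply/ffunP => x; rewrite !ffunE.
apply: eq_bigr => w _; rewrite [RHS]big_split /=; congr (_ * _).
  rewrite pair_big /=; apply: eq_bigr => -[a x] _ /=.
  by rewrite !ffunE.
by apply: eq_bigr => a _; rewrite !ffunE.
Qed.

(** Transposition preserves the law of a random matrix, so columns inherit the bounds proved for
    rows. *)
Lemma Ex_swap (R : realType) (A T : finType) (mu : T -> R)
    (F : {ffun A * A -> T} -> R) :
  Ex mu F = Ex mu (fun w => F [ffun q => w (q.2, q.1)]).
Proof.
pose h (w : {ffun A * A -> T}) : {ffun A * A -> T} := [ffun q => w (q.2, q.1)].
have hK : involutive h by move=> w; apply/ffunP => -[x y]; rewrite !ffunE.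
rewrite /Ex (reindex_inj (inv_inj hK)); apply: eq_bigr => w _; congr (_ * _).
rewrite (reindex_inj (inv_inj (_ : involutive (fun q : A * A => (q.2, q.1))))).
  by apply: eq_bigr => -[x y] _; rewrite ffunE.
by case.
Qed.

(** The binomial expansion up to degree two suffices. The bound trades the square of a count for an
    exponential moment. *)
Lemma expn_ge_quadratic (R : realType) (e : R) (n : nat) :
  0 <= e <= 1 -> e ^+ 2 * n%:R ^+ 2 <= 2 * (1 + e) ^+ n.
Proof.
move=> /andP[e0 e1].
suff H : 1 + n%:R * e + (n%:R ^+ 2 - n%:R) / 2 * e ^+ 2 <= (1 + e) ^+ n.
  have : 0 <= (n%:R * e) * (2 - e).
    by rewrite !mulr_ge0 ?ler0n // subr_ge0 (le_trans e1) // ler1n.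
  by move: H; set X := (1 + e) ^+ n; nra.
elim: n => [|n IHn]; first by rewrite expr0; lra.
rewrite [leRHS]exprS -natr1; have n0 := ler0n R n.
have n2 : 0 <= (n%:R ^+ 2 - n%:R : R).
  rewrite expr2 -natrM -natrB ?ler0n //; nia.
apply: le_trans (_ : (1 + e) * (1 + n%:R * e + (n%:R ^+ 2 - n%:R) / 2 * e ^+ 2) <= _).
  have : 0 <= (n%:R ^+ 2 - n%:R) / 2 * e ^+ 2 * e.
    by rewrite mulr_ge0 // mulr_ge0 ?exprn_ge0 // mulr_ge0.
  rewrite -subr_ge0 => H; rewrite -subr_ge0; apply: le_trans H _.
  rewrite le_eqVlt; apply/orP; left; apply/eqP; by field.
by rewrite ler_wpM2l // addr_ge0.
Qed.

Lemma expR_le_half (R : realType) (t : R) : 0 <= t <= 1 / 2 ->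
  expR t <= 1 + 2 * t.
Proof.
move=> /andP[t0 t1].
have : expR t * (1 - t) <= 1.
  rewrite -[leRHS](expRxMexpNx_1 t) ler_pM2l ?expR_gt0 //.
  exact: expR_ge1Dx.
have := expR_gt0 t; nra.
Qed.

Lemma expR1_le4 (R : realType) : expR (1 : R) <= 4.
Proof.
have -> : 1 = 1 / 2 + 1 / 2 :> R by lra.
have h := @expR_le_half R (1 / 2) ltac:(lra).
by rewrite expRD; have := expR_gt0 (1 / 2 : R); nra.
Qed.

Definition row_count (A B : finType) (w : {ffun A * B -> bool}) (Y : {set B}) a :=
  #|[set x in Y | w (a, x)]|.

(** Truncation at [tau] keeps the exponent min^2 / (2 tau^2) of a row at most 1/2, where exp is at
    most 1 + 2t. The square is then bounded by 2 lam^2 (1 + 1/lam)^n, whose mean is at most 2 lam^2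
    exp(1). Independence of the rows and Markov's inequality finish. *)
Lemma truncated_square_tail (R : realType) (A B : finType) (p : R)
    (Y : {set B}) (tau : nat) (s : R) :
  0 <= p <= 1 -> 1 <= p * #|Y|%:R -> (0 < tau)%N ->
  Ex (bern p) (fun w : {ffun A * B -> bool} =>
      (s <= (\sum_a (minn (row_count w Y a) tau) ^ 2)%N%:R)%R%:R)
   <= expR (8 * (p * #|Y|%:R) ^+ 2 * #|A|%:R / tau%:R ^+ 2
             - s / (2 * tau%:R ^+ 2)).
Proof.
set lam := p * _; move=> p01 lam1 tau0.
have lam0 : 0 < lam by apply: lt_le_trans lam1.
have t0 : 0 < tau%:R :> R by rewrite ltr0n.
have t20 : 0 < tau%:R ^+ 2 :> R by rewrite exprn_gt0.
pose psi (t : {ffun B -> bool}) : R :=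
  expR ((minn #|[set x in Y | t x]| tau)%:R ^+ 2 / (2 * tau%:R ^+ 2)).
have Epsi : Ex (bern p) psi <= expR (8 * lam ^+ 2 / tau%:R ^+ 2).
  apply: le_trans (_ : Ex (bern p) (fun t : {ffun B -> bool} =>
     1 + (2 * lam ^+ 2 / tau%:R ^+ 2)
        * (1 + lam^-1) ^+ #|[set x in Y | t x]|) <= _).
    apply: Ex_le => [t|t]; first exact: bern_ge0.
    set n := #|_|.
    apply: le_trans (expR_le_half _) _.
      apply/andP; split; first by rewrite divr_ge0 ?exprn_ge0 // mulr_ge0 // ltW.
      rewrite ler_pdivrMr ?mulr_gt0 // mulrA mul1r mulVf ?pnatr_eq0 // mul1r.
      by rewrite -!natrX ler_nat leq_exp2r // geq_minr.
    rewrite lerD2l.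
    have -> : 2 * ((minn n tau)%:R ^+ 2 / (2 * tau%:R ^+ 2)) =
       (minn n tau)%:R ^+ 2 / tau%:R ^+ 2 :> R.
      by field; rewrite gt_eqF.
    rewrite [leRHS]mulrAC ler_pM2r ?invr_gt0 //.
    apply: le_trans (_ : n%:R ^+ 2 <= _).
      by rewrite -!natrX ler_nat leq_exp2r // geq_minl.
    have il : 0 <= lam^-1 <= 1 by rewrite invr_ge0 ltW //= invf_le1.
    have := expn_ge_quadratic n il.
    rewrite -ler_pdivlMl ?exprn_gt0 ?invr_gt0 // exprVn invrK.
    by rewrite mulrA [lam ^+ 2 * 2]mulrC.
  rewrite ExD ExZ Ex1 ?bern_sum //.
  apply: le_trans (expR_ge1Dx _); rewrite lerD2l.
  have : Ex (bern p) (fun t : {ffun B -> bool} =>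
      (1 + lam^-1) ^+ #|[set x in Y | t x]|) <= 4.
    have h1 := fun b => bern_ge0 b p01.
    have := @Ex_expn_count R B bool (bern p) (fun _ b => b) Y p (1 + lam^-1) h1
        (bern_sum p).
    move=> H; apply: le_trans (H _ _) _.
    - by move=> i _; rewrite big_mkcond big_bool /= addr0.
    - by rewrite lerDl invr_ge0 ltW.
    - rewrite addrAC subrr add0r -mulrA mulVf ?gt_eqF //.
      exact: expR1_le4.
  move=> le4; apply: le_trans (ler_wpM2l _ le4) _.
    by rewrite divr_ge0 ?sqr_ge0 // mulr_ge0 ?sqr_ge0.
  by rewrite le_eqVlt; apply/orP; left; apply/eqP; ring.
apply: le_trans (_ : Ex (bern p) (fun w : {ffun A * B -> bool} =>
   expR (- (s / (2 * tau%:R ^+ 2))) * \prod_a psi [ffun x => w (a, x)]) <= _).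
  apply: Ex_le => [t|w]; first exact: bern_ge0.
  have -> : \prod_a psi [ffun x => w (a, x)] =
     expR ((\sum_a (minn (row_count w Y a) tau) ^ 2)%N%:R / (2 * tau%:R ^+ 2)).
    rewrite /psi -expR_sum; congr expR; rewrite natr_sum mulr_suml.
    apply: eq_bigr => a _; rewrite natrX; congr (_%:R ^+ 2 / _).
    congr minn; apply: eq_card => x; rewrite !inE.
    by rewrite ffunE.
  rewrite -expRD; case: (boolP (s <= _)) => [le_s|_]; last exact: expR_ge0.
  rewrite -[leLHS]expR0 ler_expR addrC subr_ge0 ler_pM2r //.
  by rewrite invr_gt0 mulr_gt0.
rewrite ExZ (Ex_curry (bern p) (fun _ : A => psi)) addrC expRD ler_pM2l ?expR_gt0 //.
rewrite mulrAC expRM_natr -prodr_const; apply: ler_prod => a _.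
rewrite Epsi andbT; apply: sumr_ge0 => t _; rewrite mulr_ge0 ?expR_ge0 //.
by apply: prodr_ge0 => i _; exact: bern_ge0.
Qed.

(** * Square sums of the row counts of a random bit matrix *)

Lemma set_between (T : finType) (A C : {set T}) n :
  A \subset C -> (#|A| <= n <= #|C|)%N ->
  exists B : {set T}, [/\ A \subset B, B \subset C & #|B| = n].
Proof.
move=> AC /andP[leA leC]; elim: n leA leC => [|n IHn] leA leC.
  by exists A; split=> //; apply/eqP; rewrite -leqn0.
case: (ltngtP #|A| n.+1) leA => // [ltA _|eqA _]; last by exists A.
have [B [AB BC cB]] := IHn ltA (ltnW leC).
have /set0Pn[x] : C :\: B != set0.
  rewrite -card_gt0 cardsD (setIidPr BC) cB; lia.
rewrite inE => /andP[xB xC]; exists (x |: B); split.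
- by apply: subset_trans AB _; rewrite subsetUr.
- by rewrite subUset sub1set xC.
- by rewrite cardsU1 xB cB.
Qed.

Lemma bin_le_expn n m : ('C(n, m) <= n ^ m)%N.
Proof.
apply: (@leq_trans (n ^_ m)); first by rewrite -bin_ffact leq_pmulr ?fact_gt0.
elim: m n => [|m IHm] n; first by rewrite ffactn0.
rewrite ffactnS expnS leq_mul2l; apply/orP; right.
by apply: leq_trans (IHm _) _; case: m {IHm} => // m; rewrite leq_exp2r ?leq_pred.
Qed.

Lemma card_sets_le (T : finType) m :
  (#|[set Y : {set T} | #|Y| == m]| <= #|T| ^ m)%N.
Proof. by rewrite card_draws bin_le_expn. Qed.

Lemma card_pairs_in (A B : finType) (w : pred (A * B)) (X : {set A}) (Y : {set B}) :
  #|[set q in finset.setX X Y | w q]| = (\sum_(a in X) #|[set x in Y | w (a, x)]|)%N.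
Proof.
rewrite -sum1_card.
under [RHS]eq_bigr => a _ do rewrite -sum1_card.
rewrite pair_big_dep /=; apply: eq_bigl => -[a x] /=.
by rewrite !inE /= andbA.
Qed.

(* The three terms bound the following events: some row has Delta ones; some n0
   rows have 32 y ones in some Y; the squares truncated at tau sum to s1. *)
Lemma rows_tail (R : realType) (p : R) (r y tau n0 Delta s1 : nat) :
  0 <= p <= 1 -> 1 <= p * y%:R -> (0 < tau)%N -> (n0 <= r)%N ->
  (32 * y <= n0 * tau)%N ->
  Ex (bern p) (fun w : {ffun 'I_r * 'I_r -> bool} =>
     [exists Y : {set 'I_r}, (#|Y| == y) &&
        (s1 + Delta * (32 * y) <= \sum_a row_count w Y a ^ 2)%N]%:R)
  <= r%:R * (8 ^- Delta * expR (8 * p * r%:R))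
     + r%:R ^+ y * r%:R ^+ n0
         * (tau%:R ^- (32 * y) * expR (tau%:R * p * (n0 * y)%:R))
     + r%:R ^+ y * expR (8 * (p * y%:R) ^+ 2 * r%:R / tau%:R ^+ 2
             - s1%:R / (2 * tau%:R ^+ 2)).
Proof.
move=> p01 py1 tau0 n0r yn0; have /andP[p0 p1] := p01.
have b0 := fun b => bern_ge0 b p01.
pose E1 a (w : {ffun 'I_r * 'I_r -> bool}) : R :=
  (Delta <= #|[set q in finset.setX [set a] [set: 'I_r] | w q]|)%N%:R.
pose E2 (Y A : {set 'I_r}) (w : {ffun 'I_r * 'I_r -> bool}) : R :=
  (32 * y <= #|[set q in finset.setX A Y | w q]|)%N%:R.
pose E3 (Y : {set 'I_r}) (w : {ffun 'I_r * 'I_r -> bool}) : R :=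
  (s1%:R <= (\sum_a (minn (row_count w Y a) tau) ^ 2)%N%:R :> R)%R%:R.
apply: le_trans (_ : Ex (bern p) (fun w => \sum_a E1 a w
   + \sum_(Y : {set 'I_r} | #|Y| == y) \sum_(A : {set 'I_r} | #|A| == n0) E2 Y A w
   + \sum_(Y : {set 'I_r} | #|Y| == y) E3 Y w) <= _).
  apply: Ex_le => // w.
  have E1ge0 a : 0 <= E1 a w by exact: ler0n.
  have E2ge0 Y A : 0 <= E2 Y A w by exact: ler0n.
  have E3ge0 Y : 0 <= E3 Y w by exact: ler0n.
  have S1 : 0 <= \sum_a E1 a w by apply: sumr_ge0.
  have S2 : 0 <= \sum_(Y : {set 'I_r} | #|Y| == y)
                  \sum_(A : {set 'I_r} | #|A| == n0) E2 Y A w.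
    by apply: sumr_ge0 => Y _; apply: sumr_ge0.
  have S3 : 0 <= \sum_(Y : {set 'I_r} | #|Y| == y) E3 Y w by apply: sumr_ge0.
  case: existsP => [[Y /andP[cY le_sum]]|_]; last by rewrite !addr_ge0.
  have [/existsP[a ha]|no1] := boolP [exists a, Delta <=
         #|[set q in finset.setX [set a] [set: 'I_r] | w q]|]%N.
    apply: (@le_trans _ _ (E1 a w)); first by rewrite /E1 ha.
    rewrite (bigD1 a) //= -!addrA lerDl !addr_ge0 //.
    by apply: sumr_ge0.
  have [h3|no3] := boolP (s1 <= (\sum_a (minn (row_count w Y a) tau) ^ 2)%N)%N.
    apply: (@le_trans _ _ (E3 Y w)).
      by have -> : E3 Y w = 1 by rewrite /E3 ler_nat h3.
    rewrite [leRHS]addrC (bigD1 Y) //= -!addrA lerDl !addr_ge0 //.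
    by apply: sumr_ge0.
  pose Hv := [set a | (tau < row_count w Y a)%N].
  have rD a : (row_count w Y a <= Delta)%N.
    move: no1; rewrite negb_exists => /forallP/(_ a); rewrite -ltnNge => /ltnW.
    apply: leq_trans; rewrite card_pairs_in big_set1 /row_count.
    by apply: subset_leq_card; apply/fintype.subsetP => x; rewrite !inE => /andP[].
  (* Otherwise the rows above the truncation contribute at most Delta * 32 y to the sum of squares
     and the truncated squares less than [s1], against the assumed total. *)
  have big_heavy : (32 * y <= \sum_(a in Hv) row_count w Y a)%N.
    rewrite leqNgt; apply/negP => lt32.
    suff : (\sum_a row_count w Y a ^ 2 < s1 + Delta * (32 * y))%N by lia.
    apply: leq_ltn_trans (_ : (_ <= \sum_a (minn (row_count w Y a) tau) ^ 2
                    + \sum_(a in Hv) Delta * row_count w Y a)%N) _.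
      rewrite [X in (_ <= _ + X)%N]big_mkcond /= -big_split /=.
      apply: leq_sum => a _; rewrite inE; case: ltnP => [lt|le].
        by rewrite expnS expn1; apply: leq_trans (leq_addl _ _); rewrite leq_mul2r rD orbT.
      by rewrite addn0.
    rewrite -big_distrr /=; rewrite -ltnNge in no3.
    apply: leq_trans (_ : (_ < s1 + Delta * (\sum_(a in Hv) row_count w Y a))%N) _.
      by rewrite ltn_add2r.
    by rewrite leq_add2l leq_mul2l ltnW // orbT.
  (* If at least [n0] rows are heavy, any [n0] of them already have n0 tau >= 32 y ones; otherwise
     the heavy rows are padded to [n0] rows. *)
  have [A [cA hA]] : exists A : {set 'I_r}, #|A| = n0 /\
      (32 * y <= \sum_(a in A) row_count w Y a)%N.
    have [le|lt] := leqP n0 #|Hv|.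
      have [] := @set_between _ finset.set0 Hv n0; rewrite ?finset.sub0set ?cards0 //=.
      move=> A [_ AH cA]; exists A; split=> //; apply: leq_trans yn0 _.
      rewrite -cA -sum_nat_const; apply: leq_sum => a /(fintype.subsetP AH).
      by rewrite inE => /ltnW.
    have [] := @set_between _ Hv [set: 'I_r] n0; rewrite ?finset.subsetT ?cardsT ?card_ord //=.
      by rewrite ltnW.
    move=> A [HA _ cA]; exists A; split=> //; apply: leq_trans big_heavy _.
    rewrite [X in (_ <= X)%N](big_setID Hv) /= (setIidPr HA).
    exact: leq_addr.
  apply: (@le_trans _ _ (E2 Y A w)).
    by rewrite /E2 card_pairs_in hA.
  rewrite (bigD1 Y) //= (bigD1 A) /=; last exact/eqP.
  rewrite -!addrA addrCA lerDl !addr_ge0 //; apply: sumr_ge0 => // Y' _.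
  by apply: sumr_ge0.
rewrite !ExD !Ex_sum; apply: lerD; first apply: lerD.
- rewrite mulr_natl -[in leRHS](card_ord r) -sumr_const; apply: ler_sum => a _.
  have := @upper_tail R _ _ (bern p) (fun _ b => b)
    (finset.setX [set a] [set: 'I_r]) p 8 Delta b0 (bern_sum p) p0.
  rewrite cardsX cards1 mul1n cardsT card_ord; apply.
  + by move=> i _; rewrite big_mkcond big_bool /= addr0.
  + by rewrite ler1n.
- apply: le_trans (_ : \sum_(Y : {set 'I_r} | #|Y| == y)
      \sum_(A : {set 'I_r} | #|A| == n0)
       (tau%:R ^- (32 * y) * expR (tau%:R * p * (n0 * y)%:R)) <= _).
    apply: ler_sum => Y /eqP cY; rewrite Ex_sum; apply: ler_sum => A /eqP cA.
    have := @upper_tail R _ _ (bern p) (fun _ b => b)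
      (finset.setX A Y) p tau%:R (32 * y) b0 (bern_sum p) p0.
    rewrite cardsX cA cY; apply.
    + by move=> i _; rewrite big_mkcond big_bool /= addr0.
    + by rewrite ler1n.
  set c := tau%:R ^- _ * _; have c0 : 0 <= c by rewrite mulr_ge0 ?expR_ge0 ?invr_ge0 ?exprn_ge0.
  have cnt m : (#|[pred Y : {set 'I_r} | #|Y| == m]|%:R : R) <= r%:R ^+ m.
    rewrite -natrX ler_nat -[in leqRHS](card_ord r); apply: leq_trans (card_sets_le _ _).
    by rewrite cardsE.
  rewrite !sumr_const -[leLHS]mulr_natl -[c *+ _]mulr_natl [leLHS]mulrA.
  by apply: ler_wpM2r => //; apply: ler_pM; rewrite ?ler0n //; apply: cnt.
- set c := expR _; have c0 : 0 <= c by exact: expR_ge0.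
  apply: le_trans (_ : \sum_(Y : {set 'I_r} | #|Y| == y) c <= _).
    apply: ler_sum => Y /eqP cY.
    have := @truncated_square_tail R 'I_r 'I_r p Y tau s1%:R p01.
    by rewrite cY card_ord; apply.
  rewrite sumr_const -[_ *+ _]mulr_natl ler_wpM2r //.
  rewrite -natrX ler_nat -[in leqRHS](card_ord r); apply: leq_trans (card_sets_le _ _).
  by rewrite cardsE.
Qed.

(** * Edges of a random graph at the clusters of a labelling *)

Lemma card_set_in (T : finType) (U : {set T}) (P : pred T) :
  #|[set u in U | P u]| = (\sum_(u in U) P u)%N.
Proof.
rewrite -sum1_card big_mkcond [RHS]big_mkcond /=; apply: eq_bigr => u _.
by rewrite inE; case: (u \in U); case: (P u).
Qed.

(** Only the entries above the diagonal are read, so each pair of labels depends on a single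
    independent bit. *)
Definition edge r (w : {ffun 'I_r * 'I_r -> bool}) (x z : 'I_r) : bool :=
  ((x < z)%N && w (x, z)) || ((z < x)%N && w (z, x)).

(* Only the rows above both x and z are inspected, so that dropping the edges
   marked by [closed_below] is a predictable rule. *)
Definition closed_below r (w : {ffun 'I_r * 'I_r -> bool}) (x z : 'I_r) : bool :=
  [exists a : 'I_r, [&& (a < x)%N, (a < z)%N, w (a, x) & w (a, z)]].

Lemma edgeC r w (x z : 'I_r) : edge w x z = edge w z x.
Proof. by rewrite /edge orbC. Qed.

Lemma closed_belowC r w (x z : 'I_r) : closed_below w x z = closed_below w z x.
Proof. by apply: eq_existsb => a; apply/and4P/and4P => -[]. Qed.

(** The first condition concerns the random graph under study; [HC] is an arbitrary relation, later
    given by the other graph, and stays fixed while [w] is drawn. *)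
Definition open_pair r (V : finType) (f : V -> 'I_r) (HC : rel V) w u v :=
  ~~ closed_below w (f u) (f v) && ~~ HC u v.

(* U is split along the labels of W: at every label at least half of the pairs
   are open, and yet far fewer than expected of them are edges. *)
Definition sparse_fibers (R : realType) r (V : finType) (p : R) (f : V -> 'I_r)
    (HC : rel V) (U W : {set V}) (w : {ffun 'I_r * 'I_r -> bool}) :=
  [forall z in f @: W, let T := [set v in W | f v == z] in
    (#|U| * #|T| <= 2 * #|[set q in setX U T | open_pair f HC w q.1 q.2]|)%N &&
    ((256 * #|[set q in setX U T | open_pair f HC w q.1 q.2 &&
               edge w (f q.1) (f q.2)]|)%:R <= p * (#|U| * #|T|)%:R :> R)].

(** At a label [z], an edge depends only on the pair of labels (f u, z), so the bits are tested once
    for each such pair. At least |U| |Z| / 16 unordered label pairs are not closed from below and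
    have many open vertex pairs, yet at most p |U| |Z| / 64 of them are edges. Closure is known
    before the bit is drawn, so the predictable lower tail applies with exponent p/64 - p/32. *)
Lemma sparse_fibers_prob (R : realType) r (V : finType) (p : R) (f : V -> 'I_r)
    (HC : rel V) (U W : {set V}) :
  0 <= p <= 1 -> {in U &, injective f} -> (8 <= #|U|)%N ->
  Ex (bern p) (fun w => (sparse_fibers p f HC U W w)%:R)
    <= expR (- (p * (#|U| * #|f @: W|)%:R / 64)).
Proof.
move=> p01 fI U8; have /andP[p0 p1] := p01.
pose Z := f @: W; pose T z := [set v in W | f v == z].
pose m u z := #|[set v in T z | ~~ HC u v]|.
pose c u z := (f u != z) && (#|T z| <= 4 * m u z)%N.
(* The smaller label comes first, to address the bit above the diagonal. *)
pose phi (q : 'I_r * V) := if (f q.2 < q.1)%N then (f q.2, q.1) else (q.1, f q.2).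
pose Q := phi @: [set q in setX Z U | c q.2 q.1].
pose o (q : 'I_r * 'I_r) w := (q \in Q) && ~~ closed_below w q.1 q.2.
(* In row-major order, the rows above both labels of a pair are drawn before its bit. *)
pose rk (q : 'I_r * 'I_r) := (q.1 * r + q.2)%N.
have rkI : injective rk.
  move=> [x z] [x' z']; rewrite /rk /= => eq_rk.
  have r0 : (0 < r)%N by apply: leq_trans (ltn_ord x).
  congr pair; apply: ord_inj.
    by move: (congr1 (divn^~ r) eq_rk); rewrite !divnMDl // !divn_small // !addn0.
  by move: (congr1 (modn^~ r) eq_rk); rewrite !modnMDl !modn_small.
have oP q w i t : (rk q <= rk i)%N -> o q (upd w i t) = o q w.
  move=> le_q; rewrite /o; congr (_ && ~~ _); apply: eq_existsb => a.
  case: (ltnP a q.1) => //= ltq.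
  have ne x : ((a, x) == i) = false.
    apply/negP => /eqP ai; move: le_q; rewrite leqNgt -ai /rk /= => /negP; apply.
    have := ltn_ord x; have : (a.+1 * r <= q.1 * r)%N by rewrite leq_mul2r ltq orbT.
    by rewrite mulSn; lia.
  by rewrite !ffunE !ne.
have H := @predictable_lower_tail R _ p rk o
   ((#|U| * #|Z|)%:R / 16) (p * (#|U| * #|Z|)%:R / 64) p01 rkI oP.
apply: le_trans (le_trans _ H) _; last by rewrite ler_expR; lra.
apply: Ex_le => [b|w]; first exact: bern_ge0.
case: (boolP (sparse_fibers _ _ _ _ _ _)) => [/forall_inP sp|_]; last exact: ler0n.
have mE u z : u \in U -> ~~ closed_below w (f u) z ->
    #|[set v in T z | open_pair f HC w u v]| = m u z.
  move=> uU nown; apply: eq_card => v; rewrite !inE -andbA -andbA.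
  by case: eqP => [fv|_]; rewrite ?andbF //= /open_pair fv nown.
pose P0 := [set q in setX Z U | c q.2 q.1 && ~~ closed_below w (f q.2) q.1].
pose n z := #|[set u in U | c u z && ~~ closed_below w (f u) z]|.
pose e z := #|[set u in U | [&& c u z, ~~ closed_below w (f u) z & edge w (f u) z]]|.
(* Labels with fewer than |T z| / 4 pairs outside [HC] account for at most half of the open pairs,
   whence |U| <= 4 n'. Since n' <= n z + 1 and |U| >= 8, this gives |U| <= 8 n z. *)
have nP z : z \in Z -> (#|U| <= 8 * n z)%N.
  move=> zZ; have /andP[+ _] := sp z zZ; rewrite -/(T z).
  have T0 : (0 < #|T z|)%N.
    case/imsetP: zZ => v vW ->; apply/card_gt0P; exists v.
    by rewrite inE vW eqxx.
  rewrite card_pairs_in /= => le1.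
  pose n' := #|[set u in U | (#|T z| <= 4 * m u z)%N && ~~ closed_below w (f u) z]|.
  have le2 : (4 * (\sum_(u in U) #|[set v in T z | open_pair f HC w u v]|)
       <= #|U| * #|T z| + 4 * #|T z| * n')%N.
    rewrite -sum_nat_const /n' card_set_in !big_distrr /= -big_split /=.
    apply: leq_sum => u uU.
    have [isown|nown] := boolP (closed_below w (f u) z); last first.
      rewrite mE // andbT; case: (leqP #|T z| (4 * m u z)) => [_|/ltnW lt4] /=; last by rewrite muln0 addn0.
      rewrite muln1; apply: leq_trans (leq_addl _ _); rewrite leq_mul2l /=.
      by apply: subset_leq_card; apply/subsetP => v; rewrite inE => /andP[].
    rewrite (_ : #|_| = 0) ?muln0 //; apply: eq_card0 => v.
    rewrite !inE /open_pair; apply/negP => /andP[/andP[_ /eqP ->]].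
    by rewrite isown.
  (* The loss of 1 is the only vertex of [U] that can carry the label [z] itself. *)
  have le3 : (n' <= n z + 1)%N.
    rewrite /n' /n.
    apply: (@leq_trans #|[set u in U | c u z && ~~ closed_below w (f u) z] :|:
                [set u in U | f u == z]|).
      apply: subset_leq_card; apply/subsetP => u; rewrite !inE /c.
      by move=> /and3P[-> -> ->]; case: eqP.
    rewrite cardsU; apply: leq_trans (leq_subr _ _) _; rewrite leq_add2l.
    apply/card_le1P => u; rewrite inE => /andP[uU /eqP fu] v.
    rewrite !inE; apply/andP/eqP => [[vU /eqP fv]|->]; last by rewrite uU fu eqxx.
    by apply: fI => //; rewrite fu fv.
  have : (#|U| * #|T z| <= (4 * n') * #|T z|)%N by lia.
  by rewrite leq_mul2r eqn0Ngt T0 /=; lia.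
(* Each label pair counted by [e z] yields at least |T z| / 4 edges, so the constant 256 drops to
   64. *)
have eP z : z \in Z -> (64 * e z)%:R <= p * #|U|%:R :> R.
  move=> zZ; have /andP[_ +] := sp z zZ; rewrite -/(T z).
  have T0 : (0 < #|T z|)%N.
    case/imsetP: zZ => v vW ->; apply/card_gt0P; exists v.
    by rewrite inE vW eqxx.
  rewrite card_pairs_in /= natrM [(#|U| * _)%:R]natrM mulrA => le1.
  rewrite -(@ler_pM2r _ #|T z|%:R) ?ltr0n //; apply: le_trans le1.
  rewrite -!natrM ler_nat -mulnA (_ : 256%N = (64 * 4)%N) // -mulnA leq_mul2l /=.
  rewrite /e card_set_in big_distrl big_distrr /=.
  apply: leq_sum => u uU; case: and3P => // -[/andP[_ cu] no ed].
  rewrite mul1n; apply: leq_trans cu _; rewrite leq_mul2l /=.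
  rewrite -(mE u z) //; apply: subset_leq_card; apply/subsetP => v; rewrite !inE.
  by move=> /andP[/andP[-> /eqP fv] ->]; rewrite fv eqxx ed.
have cP0 : #|P0| = (\sum_(z in Z) n z)%N.
  by rewrite (card_pairs_in (fun q => c q.2 q.1 && ~~ closed_below w (f q.2) q.1)).
have ownphi q : closed_below w (phi q).1 (phi q).2 = closed_below w (f q.2) q.1.
  by rewrite /phi; case: ifP => //= _; rewrite closed_belowC.
rewrite (_ : _ && _ = true) //; apply/andP; split.
  rewrite ler_pdivrMr // -natrM ler_nat.
  have : (#|P0| <= 2 * #|[set q | o q w]|)%N.
    (* The extra bit records which label came first: [phi] is at most two-to-one. *)
    pose psi q := (phi q, (f q.2 < q.1)%N).
    have psiI : {in P0 &, injective psi}.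
      move=> [z u] [z' u']; rewrite !inE /psi /phi /=.
      move=> /and3P[/andP[_ uU] _ _] /and3P[/andP[_ uU'] _ _].
      move=> eq_psi; suff [-> fu] : z = z' /\ f u = f u' by congr pair; apply: fI.
      by move: eq_psi; case: ltnP => _; case: ltnP => _ [] // => ->.
    rewrite -(card_in_imset psiI).
    have -> : (2 * #|[set q | o q w]| = #|setX [set q | o q w] [set: bool]|)%N.
      by rewrite cardsX cardsT card_bool mulnC.
    apply: subset_leq_card; apply/subsetP => _ /imsetP[q qP ->].
    move: qP; rewrite inE => /and3P[qZU cq nown].
    rewrite !inE andbT /= /o ownphi nown andbT.
    by apply/imsetP; exists q => //; rewrite inE qZU cq.
  rewrite cP0 => le1; have : (#|Z| * #|U| <= 8 * \sum_(z in Z) n z)%N.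
    by rewrite -sum_nat_const big_distrr /=; apply: leq_sum => z; exact: nP.
  by lia.
have : (#|[set q | o q w && w q]| <= \sum_(z in Z) e z)%N.
  rewrite -(card_pairs_in
     (fun q => [&& c q.2 q.1, ~~ closed_below w (f q.2) q.1 & edge w (f q.2) q.1])).
  apply: leq_trans (leq_imset_card phi _).
  apply: subset_leq_card; apply/subsetP => q; rewrite inE /o.
  move=> /andP[/andP[/imsetP[q' + ->]]]; rewrite ownphi inE => /andP[qZU cq] no wq.
  apply/imsetP; exists q' => //; rewrite inE qZU cq no /=.
  have ne : f q'.2 != q'.1 by case/andP: cq.
  move: wq; rewrite /phi /edge; case: ltngtP => [lt|lt|eq] wq /=.
  - by rewrite wq.
  - by rewrite wq.
  - by case/eqP: ne; apply: ord_inj.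
move=> le1; apply: le_trans (_ : (\sum_(z in Z) e z)%N%:R <= _); first by rewrite ler_nat.
rewrite natr_sum natrM mulrA ler_pdivlMr // mulr_suml.
apply: le_trans (_ : \sum_(z in Z) p * #|U|%:R <= _).
  by apply: ler_sum => z zZ; rewrite -natrM mulnC eP.
by rewrite sumr_const -[leLHS]mulr_natr.
Qed.

Lemma card_bigcup_le (I T : finType) (P : pred I) (F : I -> {set T}) :
  (#|\bigcup_(i | P i) F i| <= \sum_(i | P i) #|F i|)%N.
Proof.
elim/big_rec2: _ => [|i n A _ IH]; first by rewrite cards0.
by apply: leq_trans (leq_card_setU _ _) _; rewrite leq_add2l.
Qed.

Lemma card_preimset_le (V T : finType) (f : V -> T) (C : {set T}) B :
  (forall z, #|[set v | f v == z]| <= B)%N -> (#|f @^-1: C| <= B * #|C|)%N.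
Proof.
move=> fB; rewrite mulnC -sum_nat_const -sum1_card.
rewrite (partition_big f (mem C)) /= => [|v]; last by rewrite inE.
apply: leq_sum => z zC; rewrite sum1dep_card; apply: leq_trans (fB z).
by apply: subset_leq_card; apply/subsetP => v; rewrite !inE => /andP[].
Qed.

(** Such a set lies in the preimage of [D] labels, which has at most B D vertices; there are at most
    r^D choices of labels and 2^(B D) subsets. *)
Lemma card_few_labels r (V : finType) (f : V -> 'I_r) B D :
  (forall z, #|[set v | f v == z]| <= B)%N -> (D <= r)%N ->
  (#|[set U : {set V} | #|f @: U| <= D]| <= (r * 2 ^ B) ^ D)%N.
Proof.
move=> fB Dr.
apply: (@leq_trans #|\bigcup_(C in [set C : {set 'I_r} | #|C| == D])
                      powerset (f @^-1: C)|).
  apply: subset_leq_card; apply/subsetP => U; rewrite inE => leD.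
  have [|C [fUC _ /eqP cC]] := @set_between _ (f @: U) [set: 'I_r] D (subsetT _).
    by rewrite leD cardsT card_ord.
  apply/bigcupP; exists C; first by rewrite inE.
  by rewrite inE -sub_imset_pre.
apply: (@leq_trans (\sum_(C in [set C : {set 'I_r} | #|C| == D]) (2 ^ B) ^ D)).
  apply: leq_trans (card_bigcup_le _ _) _; apply: leq_sum => C.
  rewrite inE => /eqP cC; rewrite card_powerset -expnM leq_exp2l // -cC.
  exact: card_preimset_le.
rewrite sum_nat_const expnMn leq_mul2r -[X in (_ <= X ^ _)%N](card_ord r).
by rewrite card_sets_le orbT.
Qed.

(** The conditions balance a union bound: [U] is enumerated through its [g]-labels and [W] through
    its [f]-labels. If [W] has D labels, both enumerations cost a factor exponential in D, and the
    failure probability is exponentially small in D |U|. *)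
Definition sparse_exists (R : realType) r (V : finType) (p : R) (u0 : nat)
    (f g : V -> 'I_r) (HC : rel V) w :=
  [exists U : {set V}, exists W : {set V},
    [&& dinjectiveb f U, u0 <= #|U|, 0 < #|f @: W|, #|g @: U| <= #|f @: W| &
        sparse_fibers p f HC U W w]%N].

(** For D labels of [W] there are at most (r 2^B)^(2 D) pairs of sets, so the term is at most x^D <=
    x; at most [r] values of D occur. *)
Lemma sparse_exists_prob (R : realType) r (V : finType) (p : R) (u0 B : nat)
    (f g : V -> 'I_r) (HC : rel V) :
  0 <= p <= 1 -> (8 <= u0)%N ->
  (forall z, #|[set v | f v == z]| <= B)%N ->
  (forall z, #|[set v | g v == z]| <= B)%N ->
  (r%:R * 2 ^+ B) ^+ 2 * expR (- (p * u0%:R / 64)) <= 1 ->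
  Ex (bern p) (fun w => (sparse_exists p u0 f g HC w)%:R)
    <= r%:R * ((r%:R * 2 ^+ B) ^+ 2 * expR (- (p * u0%:R / 64))).
Proof.
set x := _ * expR _; move=> p01 u8 fB gB x1; have /andP[p0 p1] := p01.
(* The index [D] stands for D + 1 labels, since [W] is nonempty. *)
pose S1 (D : 'I_r) := [pred U : {set V} |
  [&& dinjectiveb f U, u0 <= #|U| & #|g @: U| <= D.+1]%N].
pose S2 (D : 'I_r) := [pred W : {set V} | #|f @: W| == D.+1].
apply: le_trans (_ : Ex (bern p) (fun w => \sum_(D < r) \sum_(U in S1 D)
    \sum_(W in S2 D) (sparse_fibers p f HC U W w)%:R) <= _).
  apply: Ex_le => [b|w]; first exact: bern_ge0.
  have ge0 U W : 0 <= (sparse_fibers p f HC U W w)%:R :> R by exact: ler0n.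
  have ge1 D U : 0 <= \sum_(W in S2 D) (sparse_fibers p f HC U W w)%:R :> R.
    exact: sumr_ge0.
  case: (boolP (sparse_exists _ _ _ _ _ _)) => [|_]; last first.
    by apply: sumr_ge0 => D _; apply: sumr_ge0.
  case/existsP => U /existsP[W /and5P[fU uU W0 gU sp]].
  have ltD : (#|f @: W|.-1 < r)%N.
    by rewrite prednK // -[leqRHS](card_ord r) max_card.
  rewrite (bigD1 (Ordinal ltD)) //= (bigD1 U) /=; last first.
    by rewrite inE /= fU uU prednK.
  rewrite (bigD1 W) /=; last by rewrite inE /= prednK.
  rewrite sp -!addrA lerDl !addr_ge0 ?sumr_ge0 // => D _.
  exact: sumr_ge0.
rewrite Ex_sum mulr_natl -[in leRHS](card_ord r) -sumr_const; apply: ler_sum => D _.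
apply: le_trans (_ : \sum_(U in S1 D) \sum_(W in S2 D)
    expR (- (p * u0%:R / 64)) ^+ D.+1 <= _).
  rewrite Ex_sum; apply: ler_sum => U /and3P[/dinjectiveP fU uU gU].
  rewrite Ex_sum; apply: ler_sum => W /eqP cW.
  apply: le_trans (sparse_fibers_prob HC W p01 fU (leq_trans u8 uU)) _.
  rewrite -expRM_natr ler_expR cW mulNr lerN2 natrM.
  have h1 : 0 <= p * D.+1%:R by rewrite mulr_ge0.
  have h2 : 0 <= #|U|%:R - u0%:R :> R by rewrite subr_ge0 ler_nat.
  have := mulr_ge0 h1 h2; lra.
set c := expR _ ^+ _; rewrite !sumr_const -[leLHS]mulr_natl -[c *+ _]mulr_natl mulrA.
apply: le_trans (_ : x ^+ D.+1 <= _); last first.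
  rewrite exprS ler_piMr //; first by rewrite mulr_ge0 ?expR_ge0 ?exprn_ge0 ?mulr_ge0 ?exprn_ge0.
  by rewrite exprn_ile1 // mulr_ge0 ?expR_ge0 ?exprn_ge0 ?mulr_ge0 ?exprn_ge0.
rewrite /x exprMn ler_wpM2r ?exprn_ge0 ?expR_ge0 // -exprM mulnC exprM expr2.
have leN : (#|[set U : {set V} | (#|f @: U| <= D.+1)%N]|%:R : R)
         <= (r%:R * 2 ^+ B) ^+ D.+1.
  by rewrite -natrX -natrM -natrX ler_nat card_few_labels.
have leN' : (#|[set U : {set V} | (#|g @: U| <= D.+1)%N]|%:R : R)
         <= (r%:R * 2 ^+ B) ^+ D.+1.
  by rewrite -natrX -natrM -natrX ler_nat card_few_labels.
apply: ler_pM; rewrite ?ler0n //.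
  apply: le_trans leN'; rewrite ler_nat.
  by apply: subset_leq_card; apply/subsetP => U; rewrite !inE => /and3P[].
apply: le_trans leN; rewrite ler_nat.
by apply: subset_leq_card; apply/subsetP => U; rewrite !inE => /eqP->.
Qed.

(** * First moment method and the second labelling *)

Lemma Ex_lt1_exists (R : realType) (I T : finType) (mu : T -> R)
    (F : {ffun I -> T} -> R) :
  (forall t, 0 <= mu t) -> \sum_t mu t = 1 -> Ex mu F < 1 ->
  exists w, F w < 1.
Proof.
move=> mu0 mu1 F1; have [/existsP[w ?]|none] := boolP [exists w, F w < 1].
  by exists w.
move: F1; rewrite ltNge -[leLHS](@Ex1 R I T mu mu1) => /negP[]; apply: Ex_le => // w.
by move: none; rewrite negb_exists => /forallP/(_ w); rewrite -leNgt.
Qed.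

Lemma Ex_exchange (R : realType) (I T I' T' : finType) (mu : T -> R)
    (mu' : T' -> R) (F : {ffun I -> T} -> {ffun I' -> T'} -> R) :
  Ex mu (fun w => Ex mu' (F w)) = Ex mu' (fun w' => Ex mu (F^~ w')).
Proof.
rewrite /Ex; under eq_bigr do rewrite mulr_sumr.
rewrite exchange_big /=; apply: eq_bigr => w' _; rewrite mulr_sumr.
by apply: eq_bigr => w _; rewrite mulrCA.
Qed.

(** The sets of size a contribute at most (r x)^a <= r x, and there are [r] sizes. *)
Lemma sum_expr_card_le (R : realType) r (x : R) : 0 <= x -> r%:R * x <= 1 ->
  \sum_(A : {set 'I_r} | A != set0) x ^+ #|A| <= r%:R ^+ 2 * x.
Proof.
move=> x0 rx1.
apply: le_trans (_ : \sum_(a < r) \sum_(A : {set 'I_r} | #|A| == a.+1) x ^+ #|A| <= _).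
  rewrite (exchange_big_dep (fun=> true)) //= big_mkcond /=; apply: ler_sum => A _.
  case: ifP => A0; last by rewrite sumr_ge0 // => i _; rewrite exprn_ge0.
  have cA : (0 < #|A|)%N by rewrite card_gt0.
  have ltA : (#|A|.-1 < r)%N.
    by rewrite prednK // -[leqRHS](card_ord r) max_card.
  rewrite (bigD1 (Ordinal ltA)) /=; last by rewrite prednK.
  by rewrite lerDl sumr_ge0 // => i _; rewrite exprn_ge0.
rewrite expr2 -mulrA mulr_natl -[in leRHS](card_ord r) -sumr_const; apply: ler_sum => a _.
apply: le_trans (_ : (r%:R * x) ^+ a.+1 <= _); last first.
  by rewrite card_ord exprS ler_piMr ?exprn_ile1 // mulr_ge0.
apply: le_trans (_ : \sum_(A : {set 'I_r} | #|A| == a.+1) x ^+ a.+1 <= _).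
  by apply: ler_sum => A /eqP->.
rewrite sumr_const -[leLHS]mulr_natl exprMn ler_wpM2r ?exprn_ge0 // -natrX ler_nat.
have := card_sets_le 'I_r a.+1; rewrite card_ord; apply: leq_trans.
by rewrite cardsE.
Qed.

(** The first label is the first coordinate, the second one is uniformly random. The expected number
    of failures is below 1: labels with more than [B] vertices, and pairs (A, C) of label sets that
    catch 8 (|A| + |C|) vertices. The latter have probability at most (4 / beta^8)^(|A| + |C|),
    which is summed over [A] and [C] separately. *)
Lemma good_labelling (R : realType) (r b B nmax : nat) (beta : R) :
  (0 < r)%N -> 1 <= beta -> beta * (b * nmax)%:R <= r%:R ->
  r%:R * (4 ^- B.+1 * expR (4 * b%:R)) < 1 / 2 :> R ->
  (r%:R ^+ 2 * (4 / beta ^+ 8)) ^+ 2 < 1 / 2 ->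
  r%:R * (4 / beta ^+ 8) <= 1 ->
  exists g : {ffun 'I_r * 'I_b -> 'I_r},
    (forall z, #|[set v | g v == z]| <= B)%N /\
    (forall U : {set 'I_r * 'I_b}, U != set0 ->
       (#|fst @: U| + #|g @: U| <= nmax ->
        #|U| <= 8 * (#|fst @: U| + #|g @: U|))%N).
Proof.
move=> r0 b1 bn e1 e2 e3.
pose mu (_ : 'I_r) : R := r%:R^-1.
have r0R : 0 < r%:R :> R by rewrite ltr0n.
have mu0 t : 0 <= mu t by rewrite invr_ge0 ltW.
have mu1 : \sum_t mu t = 1.
  by rewrite /mu sumr_const card_ord -[LHS]mulr_natl divff // gt_eqF.
have be0 : 0 < beta by exact: lt_le_trans b1.
set x := 4 / beta ^+ 8 in e2 e3.
have x0 : 0 <= x by rewrite divr_ge0 // exprn_ge0 // ltW.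
pose E1 z (g : {ffun 'I_r * 'I_b -> 'I_r}) : R :=
  (B.+1 <= #|[set v in [set: 'I_r * 'I_b] | g v == z]|)%N%:R.
pose E2 (A C : {set 'I_r}) (g : {ffun 'I_r * 'I_b -> 'I_r}) : R :=
  ((#|A| + #|C| <= nmax)%N &&
  (8 * (#|A| + #|C|) <= #|[set v in fst @^-1: A | g v \in C]|)%N)%:R.
pose F g := \sum_z E1 z g +
    \sum_(A : {set 'I_r} | A != set0) \sum_(C : {set 'I_r} | C != set0) E2 A C g.
have E10 z g : 0 <= E1 z g by exact: ler0n.
have E20 A C g : 0 <= E2 A C g by exact: ler0n.
have ExF : Ex mu F < 1.
  rewrite ExD !Ex_sum; apply: le_lt_trans (_ : _ <=
     r%:R * (4 ^- B.+1 * expR (4 * b%:R)) + (r%:R ^+ 2 * x) ^+ 2) _; last by lra.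
  apply: lerD.
    rewrite mulr_natl -[in leRHS](card_ord r) -sumr_const; apply: ler_sum => z _.
    have ir : 0 <= r%:R^-1 :> R by rewrite invr_ge0 ltW.
    have := @upper_tail R _ _ mu (fun _ t => t == z) [set: 'I_r * 'I_b] r%:R^-1 4
       B.+1 mu0 mu1 ir.
    rewrite cardsT card_prod !card_ord natrM.
    have -> : 4 * r%:R^-1 * (r%:R * b%:R) = 4 * b%:R :> R.
      by field; rewrite gt_eqF.
    by apply; [move=> i _; rewrite big_pred1_eq | rewrite ler1n].
  apply: le_trans (_ : \sum_(A : {set 'I_r} | A != set0)
      \sum_(C : {set 'I_r} | C != set0) x ^+ #|A| * x ^+ #|C| <= _); last first.
    under eq_bigr do rewrite -mulr_sumr.
    rewrite -mulr_suml expr2; have h := sum_expr_card_le x0 e3.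
    by rewrite ler_pM // sumr_ge0 // => A _; rewrite exprn_ge0.
  apply: ler_sum => A A0; rewrite Ex_sum; apply: ler_sum => C C0.
  rewrite -exprD; set n := (#|A| + #|C|)%N.
  have [nn|nn] := leqP n nmax; last first.
    rewrite (_ : Ex _ _ = 0) ?exprn_ge0 // /Ex big1 // => g _.
    by rewrite /E2 leqNgt nn mulr0.
  have q0 : 0 <= #|C|%:R / r%:R :> R by rewrite divr_ge0.
  have := @upper_tail R _ _ mu (fun _ t => t \in C) (@fst 'I_r 'I_b @^-1: A) (#|C|%:R / r%:R)
     beta (8 * n) mu0 mu1 q0.
  move=> H.
  apply: le_trans (_ : _ <= Ex mu (fun g =>
     (8 * n <= #|[set v in fst @^-1: A | g v \in C]|)%N%:R)) _.
    by apply: Ex_le => // g; rewrite /E2 nn.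
  apply: le_trans (H _ b1) _.
    by move=> i _; rewrite sumr_const -[leLHS]mulr_natl.
  rewrite /x exprMn mulrC exprVn -exprM ler_wpM2r ?invr_ge0 ?exprn_ge0 ?(ltW be0) //.
  apply: le_trans (_ : expR (1 : R) ^+ n <= _); last first.
    by rewrite lerXn2r ?nnegrE ?expR_ge0 ?expR1_le4.
  rewrite -expRM_natr mul1r ler_expR.
  (* At most b |A| vertices have first label in [A] and each falls in [C] with probability |C| / r,
     so the assumption on [beta] bounds the exponent by |C| <= n. *)
  have cA : (#|@fst 'I_r 'I_b @^-1: A| <= b * #|A|)%N.
    apply: card_preimset_le => z.
    have -> : [set v : 'I_r * 'I_b | v.1 == z] = setX [set z] [set: 'I_b].
      by apply/setP => v; rewrite !inE andbT.
    by rewrite cardsX cards1 mul1n cardsT card_ord.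
  rewrite mulrA mulrAC ler_pdivrMr //.
  apply: le_trans (_ : beta * #|C|%:R * (b * nmax)%:R <= _).
    rewrite ler_wpM2l ?mulr_ge0 ?ler0n ?(ltW be0) // ler_nat.
    apply: leq_trans cA _; rewrite leq_mul2l; apply/orP; right.
    by apply: leq_trans nn; exact: leq_addr.
  rewrite mulrAC; apply: le_trans (_ : r%:R * #|C|%:R <= _).
    by rewrite ler_wpM2r.
  by rewrite mulrC ler_wpM2r ?ler0n // ler_nat leq_addl.
have [g Fg] := Ex_lt1_exists mu0 mu1 ExF.
exists g; split=> [z|U U0 leN].
  rewrite leqNgt; apply/negP => gtB; move: Fg; rewrite ltNge => /negP[].
  rewrite /F (bigD1 z) //= /E1 (_ : [set v in _ | _] = [set v | g v == z]).
    by rewrite gtB -addrA lerDl addr_ge0 ?sumr_ge0 // => A _; rewrite sumr_ge0.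
  by apply/setP => v; rewrite !inE.
rewrite leqNgt; apply/negP => gtU; move: Fg; rewrite ltNge => /negP[].
have nz (f : 'I_r * 'I_b -> 'I_r) : f @: U != set0 by rewrite imset_eq0.
rewrite /F (bigD1 (fst @: U)) //= (bigD1 (g @: U)) //= /E2 leN.
rewrite (_ : (_ <= _)%N) /=.
  rewrite -!addrA [leRHS]addrCA lerDl addr_ge0 ?sumr_ge0 // addr_ge0 ?sumr_ge0 // => A _.
  by rewrite sumr_ge0.
apply: leq_trans (ltnW gtU) _; apply: subset_leq_card; apply/subsetP => v vU.
by rewrite !inE !imset_f.
Qed.

(** * Counting edges deterministically *)

(** Here every common neighbour counts, not only the smaller ones; this version is used for the
    graph that is held fixed. *)
Definition closed r (w : {ffun 'I_r * 'I_r -> bool}) (x z : 'I_r) : bool :=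
  [exists a, edge w a x && edge w a z].

Lemma closed_below_closed r w (x z : 'I_r) : closed_below w x z -> closed w x z.
Proof.
case/existsP => a /and4P[ax az wx wz]; apply/existsP; exists a.
by rewrite /edge ax az wx wz.
Qed.

(** The neighbours of a label [a] are split between row [a] of the matrix and row [a] of its
    transpose. *)
Definition swap r (w : {ffun 'I_r * 'I_r -> bool}) : {ffun 'I_r * 'I_r -> bool} :=
  [ffun q => w (q.2, q.1)].

Definition rows_heavy r (y S : nat) (w : {ffun 'I_r * 'I_r -> bool}) :=
  [exists Y : {set 'I_r}, (#|Y| == y) && (S <= \sum_a row_count w Y a ^ 2)%N].

(** Counting by the common neighbour turns the sum into the inner product of two degree sequences,
    which is at most half the sum of their squares. Each degree is at most a row count plus a column
    count. *)
Lemma codegree_sum r (w : {ffun 'I_r * 'I_r -> bool}) y S (Y Y' : {set 'I_r}) :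
  ~~ rows_heavy y S w -> ~~ rows_heavy y S (swap w) -> #|Y| = y -> #|Y'| = y ->
  (\sum_(x in Y) \sum_(z in Y') #|[set a | edge w a x && edge w a z]| <= 4 * S)%N.
Proof.
move=> h h' cY cY'; pose N (Z : {set 'I_r}) a := #|[set x in Z | edge w a x]|.
have sq (Z : {set 'I_r}) : #|Z| = y -> (\sum_a N Z a ^ 2 <= 4 * S)%N.
  move=> cZ.
  have h1 : (\sum_a row_count w Z a ^ 2 <= S)%N.
    move: h; rewrite negb_exists => /forallP/(_ Z).
    by rewrite cZ eqxx -ltnNge => /ltnW.
  have h2 : (\sum_a row_count (swap w) Z a ^ 2 <= S)%N.
    move: h'; rewrite negb_exists => /forallP/(_ Z).
    by rewrite cZ eqxx -ltnNge => /ltnW.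
  apply: leq_trans (_ : (\sum_a 2 * (row_count w Z a ^ 2 + row_count (swap w) Z a ^ 2) <= _)%N).
    apply: leq_sum => a _.
    have : (N Z a <= row_count w Z a + row_count (swap w) Z a)%N.
      apply: leq_trans (leq_card_setU _ _); apply: subset_leq_card.
      apply/subsetP => x; rewrite !inE !ffunE /= /edge => /andP[-> /=].
      by move=> /orP[/andP[_ ->]|/andP[_ ->]]; rewrite ?orbT.
    rewrite -leq_sqr => /leq_trans; apply; rewrite sqrnD mulnDr.
    by have [] := nat_Cauchy (row_count w Z a) (row_count (swap w) Z a); lia.
  rewrite -big_distrr big_split /= -[4%N]/(2 * 2)%N -mulnA leq_mul2l /= mul2n -addnn.
  exact: leq_add.
have -> : (\sum_(x in Y) \sum_(z in Y') #|[set a | edge w a x && edge w a z]|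
           = \sum_a N Y a * N Y' a)%N.
  under eq_bigr => x _ do
    (under eq_bigr => z _ do rewrite -sum1dep_card big_mkcond /=).
  under eq_bigr => x _ do rewrite exchange_big /=.
  rewrite exchange_big /=; apply: eq_bigr => a _.
  rewrite /N !card_set_in big_distrlr /=; apply: eq_bigr => x _.
  by apply: eq_bigr => z _; case: (edge w a x); case: (edge w a z).
have := sq Y cY; have := sq Y' cY'.
have : (2 * \sum_a N Y a * N Y' a <= \sum_a N Y a ^ 2 + \sum_a N Y' a ^ 2)%N.
  by rewrite big_distrr -big_split /=; apply: leq_sum => a _; have [] := nat_Cauchy (N Y a) (N Y' a).
lia.
Qed.

(** [J] collects [j] smallest values of [c], adding a minimiser of the complement each time. *)
Lemma threshold_set (T : finType) (c : T -> nat) j : (j <= #|T|)%N ->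
  exists J : {set T}, exists t, [/\ #|J| = j,
    (forall x, x \in J -> c x <= t)%N & (forall x, x \notin J -> t <= c x)%N].
Proof.
elim: j => [|j IHj] lej.
  by exists set0, 0%N; split; rewrite ?cards0 // => x; rewrite inE.
have [J [t [cJ le ge]]] := IHj (ltnW lej).
have [x0 x0J] : exists x, x \in ~: J.
  by apply/set0Pn; rewrite -card_gt0 cardsCs setCK cJ subn_gt0.
case: (@arg_minnP _ x0 (fun x => x \notin J) c) => [|x xJ xmin].
  by move: x0J; rewrite inE.
exists (x |: J), (c x); split.
- by rewrite cardsU1 xJ cJ.
- by move=> z /setU1P[->//|/le]; move/leq_trans; apply; exact: ge.
- by move=> z; rewrite !inE negb_or => /andP[_ zJ]; apply: xmin.
Qed.

(** Bathtub principle: under w <= s and total at least j s, the linear form is least when the [j]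
    cheapest points carry the full weight [s]. *)
Lemma box_min (T : finType) (w c : T -> nat) s j :
  (j <= #|T|)%N -> (forall x, w x <= s)%N -> (j * s <= \sum_x w x)%N ->
  exists J : {set T}, #|J| = j /\ (s * \sum_(x in J) c x <= \sum_x w x * c x)%N.
Proof.
move=> lej ws sumw; have [J [t [cJ le ge]]] := threshold_set c lej.
exists J; split=> //; rewrite (bigID (mem J)) /= in sumw.
rewrite [X in (_ <= X)%N](bigID (mem J)) /=.
set A := (\sum_(i in J) w i)%N in sumw; set A' := (\sum_(i | i \notin J) w i)%N in sumw.
have h1 : (t * A' <= \sum_(i | i \notin J) w i * c i)%N.
  by rewrite big_distrr; apply: leq_sum => i /ge h; rewrite /= mulnC leq_mul2l h orbT.
have h2 : (s * (\sum_(x in J) c x) + t * A <= (\sum_(i in J) w i * c i) + t * (j * s))%N.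
  rewrite -cJ -sum_nat_const !big_distrr -!big_split /=; apply: leq_sum => i /le h.
  have := ws i; move: h; set x := c i; set v := w i => h h'; nia.
have h3 : (t * (j * s) <= t * A + t * A')%N by rewrite -mulnDr leq_mul2l sumw orbT.
lia.
Qed.

(** The dual of the previous bound; the largest values of [c] are the smallest values of M - c. *)
Lemma box_max (T : finType) (w c : T -> nat) s j :
  (j <= #|T|)%N -> (forall x, w x <= s)%N -> (\sum_x w x <= j * s)%N ->
  exists J : {set T}, #|J| = j /\ (\sum_x w x * c x <= s * \sum_(x in J) c x)%N.
Proof.
move=> lej ws sumw; pose M := \max_x c x.
have cM x : (c x <= M)%N by exact: leq_bigmax.
have [J [t' [cJ le' ge']]] := threshold_set (fun x => M - c x)%N lej.
pose t := (M - t')%N.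
have ge x : x \in J -> (t <= c x)%N by move=> /le'; have := cM x; rewrite /t; lia.
have le x : x \notin J -> (c x <= t)%N by move=> /ge'; have := cM x; rewrite /t; lia.
exists J; split=> //; rewrite (bigID (mem J)) /= in sumw.
rewrite [X in (X <= _)%N](bigID (mem J)) /=.
set A := (\sum_(i in J) w i)%N in sumw; set A' := (\sum_(i | i \notin J) w i)%N in sumw.
have h1 : (\sum_(i | i \notin J) w i * c i <= t * A')%N.
  by rewrite big_distrr; apply: leq_sum => i /le h; rewrite /= mulnC leq_mul2r h orbT.
have h2 : ((\sum_(i in J) w i * c i) + t * (j * s) <= s * (\sum_(x in J) c x) + t * A)%N.
  rewrite -cJ -sum_nat_const !big_distrr -!big_split /=; apply: leq_sum => i /ge h.
  have := ws i; move: h; set x := c i; set v := w i => h h'; nia.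
have h3 : (t * A + t * A' <= t * (j * s))%N by rewrite -mulnDr leq_mul2l sumw orbT.
lia.
Qed.

Lemma sum_by_label (V T : finType) (f : V -> T) (U : {set V}) (F : T -> nat) :
  (\sum_(u in U) F (f u) = \sum_x #|[set u in U | f u == x]| * F x)%N.
Proof.
rewrite (partition_big f xpredT) //=; apply: eq_bigr => x _.
rewrite -sum_nat_const; apply: eq_big => u; first by rewrite !inE.
by move=> /andP[_ /eqP->].
Qed.

(** Passing to labels gives weights at most [B] with total at most y B. The bathtub principle,
    applied to each argument in turn, replaces them by two sets of [y] labels of weight [B], for
    which codegrees are bounded. *)
Lemma closed_pairs r (V : finType) (f : V -> 'I_r) (w : {ffun 'I_r * 'I_r -> bool})
    y S B (U J : {set V}) :
  ~~ rows_heavy y S w -> ~~ rows_heavy y S (swap w) -> (y <= r)%N ->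
  (forall z, #|[set v | f v == z]| <= B)%N ->
  (#|U| <= y * B)%N -> (#|J| <= y * B)%N ->
  (#|[set q in setX U J | closed w (f q.1) (f q.2)]| <= 4 * S * B ^ 2)%N.
Proof.
move=> h h' yr fB leU leJ.
pose cd x z := #|[set a | edge w a x && edge w a z]|.
have fB' (W : {set V}) z : (#|[set u in W | f u == z]| <= B)%N.
  apply: leq_trans (fB z); apply: subset_leq_card; apply/subsetP => u.
  by rewrite !inE => /andP[].
have sumW (W : {set V}) : (\sum_x #|[set u in W | f u == x]| = #|W|)%N.
  rewrite -sum1_card (sum_by_label f W (fun=> 1%N)).
  by apply: eq_bigr => x _; rewrite muln1.
have cyr : (y <= #|'I_r|)%N by rewrite card_ord.
apply: leq_trans (_ : (\sum_(u in U) \sum_(v in J) cd (f u) (f v) <= _)%N).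
  rewrite (card_pairs_in (fun q => closed w (f q.1) (f q.2))); apply: leq_sum => u _.
  rewrite card_set_in; apply: leq_sum => v _ /=.
  case: (boolP (closed _ _ _)) => // /existsP[a ha].
  by apply/card_gt0P; exists a; rewrite inE.
rewrite (sum_by_label f U (fun x => \sum_(v in J) cd x (f v))%N).
have [||Y [cY leY]] := @box_max _ (fun x => #|[set u in U | f u == x]|)
    (fun x => \sum_(v in J) cd x (f v))%N B y cyr; rewrite ?sumW //.
apply: leq_trans leY _; rewrite exchange_big /=.
rewrite (sum_by_label f J (fun z => \sum_(x in Y) cd x z)%N).
have [||Y' [cY' leY']] := @box_max _ (fun x => #|[set u in J | f u == x]|)
    (fun z => \sum_(x in Y) cd x z)%N B y cyr; rewrite ?sumW //.
apply: (@leq_trans (B * (B * (4 * S)))); last by rewrite -mulnn; nia.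
rewrite leq_mul2l; apply/orP; right; apply: leq_trans leY' _.
rewrite leq_mul2l exchange_big /=; apply/orP; right.
exact: codegree_sum cY cY'.
Qed.

(** [J] is split by its [f]-labels. Labels where under half of the pairs with [U] are open carry at
    most a quarter of [J], by the bound on non-open pairs. Labels with enough open pairs but few
    edges number less than [D], else [sparse_exists] would hold, so they carry less than half of
    [J]. The remaining quarter supplies the edges, whence 1024 = 4 * 256. *)
Lemma many_open_edges (R : realType) r (V : finType) (p : R) (u0 D X : nat)
    (f g : V -> 'I_r) (HC : rel V) (w : {ffun 'I_r * 'I_r -> bool}) (U J : {set V}) :
  0 <= p -> (0 < u0)%N -> ~~ sparse_exists p u0 f g HC w ->
  {in U &, injective f} -> (u0 <= #|U|)%N -> (#|g @: U| <= D)%N ->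
  (forall C : {set 'I_r}, #|C| < D -> 2 * #|J :&: f @^-1: C| < #|J|)%N ->
  (#|[set q in setX U J | ~~ open_pair f HC w q.1 q.2]| <= X)%N ->
  (8 * X <= #|U| * #|J|)%N ->
  p * (#|U| * #|J|)%:R <= (1024 * #|[set q in setX U J |
      open_pair f HC w q.1 q.2 && edge w (f q.1) (f q.2)]|)%:R.
Proof.
move=> p0 u00 nsp fI uU gU cov leX X8.
have U0 : (0 < #|U|)%N by exact: leq_trans uU.
have D0 : (0 < D)%N.
  apply: leq_trans gU; rewrite card_gt0 imset_eq0 -card_gt0 //.
pose T z := [set v in J | f v == z].
pose op z := #|[set q in setX U (T z) | open_pair f HC w q.1 q.2]|.
pose nop z := #|[set q in setX U (T z) | ~~ open_pair f HC w q.1 q.2]|.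
pose ed z := #|[set q in setX U (T z) | open_pair f HC w q.1 q.2 &&
                  edge w (f q.1) (f q.2)]|.
pose Z1 := [set z | 2 * op z < #|U| * #|T z|]%N.
pose Z2 := [set z in f @: J | (z \notin Z1) && ((256 * ed z)%:R < p * (#|U| * #|T z|)%:R)].
pose mass (Z : {set 'I_r}) := #|J :&: f @^-1: Z|.
have massE Z : mass Z = (\sum_(z in Z) #|T z|)%N.
  rewrite /mass -sum1_card (partition_big f (mem Z)) /= => [|v]; last by rewrite !inE => /andP[].
  apply: eq_bigr => z zZ; rewrite sum1dep_card; apply: eq_card => v.
  rewrite !inE; case: (eqVneq (f v) z) => [->|]; rewrite ?andbF ?andbT //.
  by rewrite zZ andbT.
have sumT (P : pred (V * V)) : #|[set q in setX U J | P q]| =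
    (\sum_z #|[set q in setX U (T z) | P q]|)%N.
  rewrite -sum1_card (partition_big (fun q => f q.2) xpredT) //=.
  apply: eq_bigr => z _; rewrite sum1dep_card; apply: eq_card => -[u v].
  by rewrite !inE /=; case: (u \in U); case: (v \in J); case: (P _); case: eqP.
have mass1 : (4 * mass Z1 <= #|J|)%N.
  rewrite -(leq_pmul2l U0); apply: leq_trans (_ : (8 * X <= _)%N) => //.
  apply: leq_trans (_ : (8 * \sum_z nop z <= _)%N).
    rewrite massE mulnCA [X in (_ * X <= _)%N]big_distrr /=.
    rewrite (_ : 8 = 4 * 2)%N // -mulnA leq_mul2l /= big_distrr /=.
    rewrite [X in (_ <= X)%N](bigID (mem Z1)) /=; apply: leq_trans (leq_addr _ _).
    apply: leq_sum => z; rewrite inE => lt.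
    have : (#|U| * #|T z| = op z + nop z)%N.
      rewrite -cardsX -(cardsID [set q | open_pair f HC w q.1 q.2]).
      by congr (_ + _)%N; apply: eq_card => q; rewrite !inE;
        case: (open_pair f HC w q.1 q.2); rewrite ?andbT ?andbF.
    by lia.
  by rewrite leq_mul2l /= -sumT.
have mass2 : (2 * mass Z2 < #|J|)%N.
  apply: cov; rewrite ltnNge; apply/negP => leD; case/negP: nsp.
  apply/existsP; exists U; apply/existsP; exists (J :&: f @^-1: Z2).
  have fW : f @: (J :&: f @^-1: Z2) = Z2.
    apply/setP => z; apply/imsetP/idP => [[v + ->]|zZ].
      by rewrite !inE => /andP[].
    have := zZ; rewrite inE => /andP[/imsetP[v vJ zv] _].
    by exists v => //; rewrite in_setI vJ inE -zv.
  apply/and5P; split=> //; first exact/dinjectiveP.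
  - by rewrite fW (leq_trans D0).
  - by rewrite fW (leq_trans gU).
  apply/forall_inP => z; rewrite fW => zZ.
  have -> : [set v in J :&: f @^-1: Z2 | f v == z] = T z.
    apply/setP => v; rewrite inE [in RHS]inE in_setI [v \in f @^-1: Z2]inE.
    by case: (eqVneq (f v) z) => [->|]; rewrite ?andbF // !andbT zZ andbT.
  have := zZ; rewrite inE => /and3P[_ n1 /ltW lt2].
  by apply/andP; split; [move: n1; rewrite inE -leqNgt | exact: lt2].
pose Z3 := ~: (Z1 :|: Z2).
have mass3 : (#|J| <= mass Z1 + mass Z2 + mass Z3)%N.
  rewrite -addnA; apply: leq_trans (leq_add (leqnn _) (leq_card_setU _ _)).
  apply: leq_trans (leq_card_setU _ _); apply: subset_leq_card; apply/subsetP => v vJ.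
  have vE (Z : {set 'I_r}) : (v \in J :&: f @^-1: Z) = (f v \in Z).
    by rewrite in_setI vJ inE.
  rewrite !in_setU !vE in_setC in_setU.
  by case: (f v \in Z1); case: (f v \in Z2).
have J3 : (#|J| <= 4 * mass Z3)%N by lia.
apply: (@le_trans _ _ (4 * (256 * \sum_(z in Z3) ed z)%:R)).
  apply: le_trans (_ : 4 * \sum_(z in Z3) p * (#|U| * #|T z|)%:R <= _).
    rewrite -mulr_sumr -natr_sum -big_distrr /= -massE mulrCA ler_wpM2l //.
    by rewrite -natrM ler_nat mulnCA leq_mul2l J3 orbT.
  rewrite ler_wpM2l // big_distrr natr_sum; apply: ler_sum => z zZ3.
  have [zJ|zJ] := boolP (z \in f @: J); last first.
    rewrite (_ : #|T z| = 0%N) ?muln0 ?mulr0 ?ler0n //; apply: eq_card0 => v.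
    rewrite inE; apply/negP => /andP[vJ /eqP fv]; case/negP: zJ.
    by rewrite -fv imset_f.
  rewrite leNgt; apply/negP => lt; move: zZ3; rewrite in_setC in_setU negb_or.
  by case/andP => n1; rewrite inE zJ n1 lt.
rewrite -natrM ler_nat mulnA leq_mul2l /= sumT [X in (_ <= X)%N](bigID (mem Z3)) /=.
exact: leq_addr.
Qed.

(** * The triangle-free graph *)

Lemma half_cover_exists r (V : finType) (f : V -> 'I_r) (J : {set V}) :
  exists n, [exists C : {set 'I_r}, (#|C| == n) && (#|J| <= 2 * #|J :&: f @^-1: C|)%N].
Proof.
exists #|[set: 'I_r]|; apply/existsP; exists [set: 'I_r]; rewrite eqxx preimsetT setIT.
by rewrite leq_pmull.
Qed.

(* The side (J, f), (J, g), (J', f) or (J', g) with the least [half_cover] is the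
   one whose sets are enumerated in the union bound. *)
Definition half_cover r (V : finType) (f : V -> 'I_r) (J : {set V}) : nat :=
  ex_minn (half_cover_exists f J).

Lemma half_coverP r (V : finType) (f : V -> 'I_r) (J : {set V}) :
  exists2 C : {set 'I_r}, #|C| = half_cover f J & (#|J| <= 2 * #|J :&: f @^-1: C|)%N.
Proof.
rewrite /half_cover; case: ex_minnP => n /existsP[C /andP[/eqP cC hC]] _.
by exists C.
Qed.

Lemma half_cover_min r (V : finType) (f : V -> 'I_r) (J : {set V}) (C : {set 'I_r}) :
  (#|J| <= 2 * #|J :&: f @^-1: C|)%N -> (half_cover f J <= #|C|)%N.
Proof.
move=> hC; rewrite /half_cover; case: ex_minnP => n _; apply.
by apply/existsP; exists C; rewrite eqxx.
Qed.

Lemma transversal_exists (V T : finType) (f : V -> T) (U : {set V}) :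
  exists U' : {set V}, [/\ U' \subset U, {in U' &, injective f} & f @: U' = f @: U].
Proof.
pose pk z := [pick u in U | f u == z].
exists [set u in U | pk (f u) == Some u]; split.
- by apply/subsetP => u; rewrite inE => /andP[].
- move=> u v; rewrite !inE => /andP[_ /eqP pu] /andP[_ /eqP pv] fuv.
  by move: pu; rewrite fuv pv => -[].
- apply/setP => z; apply/imsetP/imsetP => -[u uU ->].
    by exists u => //; move: uU; rewrite inE => /andP[].
  have := erefl (pk (f u)); rewrite {1}/pk.
  case: pickP => [v' /andP[v'U /eqP fv'] e|/(_ u)]; last by rewrite /= uU eqxx.
  by exists v' => //; rewrite inE v'U fv' -e eqxx.
Qed.

(** Let D = [half_cover g J]. The part [U0] of [J] over D optimal [g]-labels has half of [J], and by
    minimality it has at least D [f]-labels. Being seen on few [g]-labels it is spread over many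
    [f]-labels, so a transversal [U] for [f] has at least [u0] elements. Minimality against [J']
    says that fewer than D [f]-labels miss half of [J']. *)
Lemma half_edges (R : realType) r (V : finType) (p : R) (y S B u0 nmax : nat)
    (f g : V -> 'I_r) (G H : {ffun 'I_r * 'I_r -> bool}) (J J' : {set V}) :
  let HC := fun u v => closed H (g u) (g v) in
  0 <= p -> (0 < u0)%N -> (y <= r)%N ->
  ~~ rows_heavy y S G -> ~~ rows_heavy y S (swap G) ->
  ~~ rows_heavy y S H -> ~~ rows_heavy y S (swap H) ->
  ~~ sparse_exists p u0 f g HC G ->
  (forall z, #|[set v | f v == z]| <= B)%N ->
  (forall z, #|[set v | g v == z]| <= B)%N ->
  (forall U : {set V}, U != set0 -> (#|f @: U| + #|g @: U| <= nmax)%N ->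
        (#|U| <= 8 * (#|f @: U| + #|g @: U|))%N) ->
  (#|J| = y * B)%N -> (#|J'| = y * B)%N -> (y * B = 8 * nmax)%N ->
  (y * B = 32 * u0)%N -> (2 ^ 11 * S <= y ^ 2)%N ->
  (half_cover g J <= half_cover f J)%N -> (half_cover g J <= half_cover f J')%N ->
  p * (u0 * (y * B))%:R <= (1024 * #|[set q in setX J J' |
      open_pair f HC G q.1 q.2 && edge G (f q.1) (f q.2)]|)%:R.
Proof.
move=> HC p0 u00 yr hG hG' hH hH' nsp fB gB sp cJ cJ' yn yu0 SY lef lef'.
have [C cC hC] := half_coverP g J.
set D := half_cover g J in lef lef' cC; pose U0 := J :&: g @^-1: C.
have yB0 : (0 < y * B)%N by rewrite yu0 muln_gt0 u00.
have U00 : U0 != set0 by rewrite -card_gt0; move: hC; rewrite -/U0; lia.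
have gU0 : (#|g @: U0| <= D)%N.
  rewrite -cC; apply: subset_leq_card; apply/subsetP => _ /imsetP[u + ->].
  by rewrite !inE => /andP[].
have fU0 : (D <= #|f @: U0|)%N.
  apply: leq_trans lef (half_cover_min _); apply: leq_trans hC _.
  rewrite leq_mul2l /=; apply: subset_leq_card; apply/subsetP => u uU.
  by rewrite in_setI inE imset_f // andbT; move: uU; rewrite inE => /andP[].
(* If the label counts exceed [nmax], then |f(U0)| is more than nmax / 2 = |J| / 16; otherwise the
   sparsity of the labelling gives the factor 8 * 2. *)
have leU0 : (#|U0| <= 16 * #|f @: U0|)%N.
  have [le|lt] := leqP (#|f @: U0| + #|g @: U0|) nmax.
    by apply: leq_trans (sp _ U00 le) _; lia.
  have : (#|U0| <= #|J|)%N by apply: subset_leq_card; rewrite subsetIl.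
  by lia.
have [U [UU0 fI fU]] := transversal_exists f U0.
have UJ : U \subset J by apply: subset_trans UU0 _; rewrite subsetIl.
have cU : #|U| = #|f @: U0| by rewrite -fU card_in_imset.
have u0U : (u0 <= #|U|)%N.
  by move: hC; rewrite -/U0; clear -cU leU0 cJ yu0; lia.
have gU : (#|g @: U| <= D)%N.
  by apply: leq_trans gU0; apply: subset_leq_card; apply: imsetS.
have cov (E : {set 'I_r}) : (#|E| < D)%N -> (2 * #|J' :&: f @^-1: E| < #|J'|)%N.
  by move=> ltE; rewrite ltnNge; apply/negP => /half_cover_min; clear -ltE lef'; lia.
have leU : (#|U| <= y * B)%N by rewrite -cJ subset_leq_card.
have leJ' : (#|J'| <= y * B)%N by rewrite cJ'.
have cl1 : (#|[set q in setX U J' | ~~ open_pair f HC G q.1 q.2]| <= 8 * S * B ^ 2)%N.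
  have c1 := closed_pairs hG hG' yr fB leU leJ'.
  have c2 := closed_pairs hH hH' yr gB leU leJ'.
  apply: (@leq_trans (#|[set q in setX U J' | closed G (f q.1) (f q.2)]|
                   + #|[set q in setX U J' | closed H (g q.1) (g q.2)]|)%N).
    apply: leq_trans (leq_card_setU _ _); apply: subset_leq_card; apply/subsetP => q.
    rewrite !inE /open_pair negb_and !negbK => /andP[-> /= /orP[/closed_below_closed->|]] //.
    by rewrite /HC => ->; rewrite orbT.
  by clear -c1 c2; move: (B ^ 2)%N c1 c2 => b2; lia.
(* The constant 2^11 is 64 * 32, as u0 = y B / 32. *)
have X8 : (8 * (8 * S * B ^ 2) <= #|U| * #|J'|)%N.
  rewrite cJ'; apply: leq_trans (_ : u0 * (y * B) <= _)%N; last by rewrite leq_mul2r u0U orbT.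
  rewrite -(@leq_pmul2l 32) // [X in (_ <= X)%N]mulnA -yu0.
  have : (2 ^ 11 * S * B ^ 2 <= y ^ 2 * B ^ 2)%N by rewrite leq_mul2r SY orbT.
  rewrite -expnMn -mulnn; move: (y * B)%N (B ^ 2)%N => yB b2.
  by clear; rewrite (_ : 2 ^ 11 = 2048)%N //; lia.
have := many_open_edges p0 u00 nsp fI u0U gU cov cl1 X8.
move=> le1; apply: le_trans (le_trans _ le1) _.
  by rewrite ler_wpM2l // ler_nat cJ' leq_mul2r u0U orbT.
rewrite ler_nat leq_mul2l; apply: subset_leq_card; apply/subsetP => q.
rewrite !inE => /andP[/andP[/(subsetP UJ) -> ->] ->].
by [].
Qed.

(** An edge of one graph is dropped if its ends have a common neighbour in the other graph, or a
    smaller common neighbour in its own. *)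
Definition two_bites r (V : finType) (f g : V -> 'I_r)
    (G H : {ffun 'I_r * 'I_r -> bool}) : rel V := fun u v =>
  open_pair f (fun u v => closed H (g u) (g v)) G u v && edge G (f u) (f v)
  || open_pair g (fun u v => closed G (f u) (f v)) H u v && edge H (g u) (g v).

Lemma closedC r (w : {ffun 'I_r * 'I_r -> bool}) (x z : 'I_r) :
  closed w x z = closed w z x.
Proof. by apply: eq_existsb => a; rewrite andbC. Qed.

Lemma two_bitesC r (V : finType) (f g : V -> 'I_r) G H u v :
  two_bites f g G H u v = two_bites f g G H v u.
Proof.
by rewrite /two_bites /open_pair (closed_belowC G (f u)) (closed_belowC H (g u)) (edgeC G (f u))
  (edgeC H (g u)) (closedC H (g u)) (closedC G (f u)).
Qed.

(** The smallest of the three labels closes the pair of the other two. *)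
Lemma edge_closed_below_triangle r (w : {ffun 'I_r * 'I_r -> bool}) (x y z : 'I_r) :
  edge w x y -> edge w x z -> edge w y z ->
  ~~ closed_below w x y -> ~~ closed_below w x z -> ~~ closed_below w y z -> False.
Proof.
have main (a b c : 'I_r) : (a < b)%N -> (a < c)%N -> edge w a b -> edge w a c ->
    closed_below w b c.
  move=> ab ac; rewrite /edge ab ac !ltnNge (ltnW ab) (ltnW ac) /= !orbF => wb wc.
  by apply/existsP; exists a; rewrite ab ac wb wc.
have ne (a b : 'I_r) : edge w a b -> (a < b)%N || (b < a)%N.
  by move=> /orP[/andP[-> _]|/andP[-> _]]; rewrite ?orbT.
move=> exy exz eyz nxy nxz nyz.
have [xy|yx] := orP (ne _ _ exy).
  have [xz|zx] := orP (ne _ _ exz).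
    by case/negP: nyz; exact: (main x).
  case/negP: nxy; apply: (main z) => //; first exact: ltn_trans zx xy.
    by rewrite edgeC.
  by rewrite edgeC.
have [yz|zy] := orP (ne _ _ eyz).
  by case/negP: nxz; apply: (main y) => //; rewrite edgeC.
case/negP: nxy; apply: (main z) => //; last by rewrite edgeC.
  exact: ltn_trans zy yx.
by rewrite edgeC.
Qed.

(** Of three edges either all come from one graph, where the smallest label closes a pair, or
    exactly two do, and these close the third edge. *)
Lemma two_bites_triangle_free r (V : finType) (f g : V -> 'I_r) G H u v w :
  two_bites f g G H u v -> two_bites f g G H u w -> two_bites f g G H v w -> False.
Proof.
have cl (W : {ffun 'I_r * 'I_r -> bool}) (a x z : 'I_r) :
    edge W a x -> edge W a z -> closed W x z.
  by move=> h1 h2; apply/existsP; exists a; rewrite h1 h2.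
have cl' (W : {ffun 'I_r * 'I_r -> bool}) (a x z : 'I_r) :
    edge W x a -> edge W a z -> closed W x z.
  by rewrite edgeC; exact: cl.
have cl'' (W : {ffun 'I_r * 'I_r -> bool}) (a x z : 'I_r) :
    edge W x a -> edge W z a -> closed W x z.
  by rewrite [edge _ z a]edgeC; exact: cl'.
rewrite /two_bites /open_pair.
case/orP => /andP[/andP[n1 c1] e1]; case/orP => /andP[/andP[n2 c2] e2];
  case/orP => /andP[/andP[n3 c3] e3].
- exact: edge_closed_below_triangle e1 e2 e3 n1 n2 n3.
- by case/negP: c3; exact: cl e1 e2.
- by case/negP: c2; exact: cl' e1 e3.
- by case/negP: c1; exact: cl'' e2 e3.
- by case/negP: c1; exact: cl'' e2 e3.
- by case/negP: c2; exact: cl' e1 e3.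
- by case/negP: c3; exact: cl e1 e2.
- exact: edge_closed_below_triangle e1 e2 e3 n1 n2 n3.
Qed.

(** The least of the four half covers decides which graph supplies the edges and which of [J], [J']
    plays the role of the enumerated side. *)
Lemma two_bites_edges (R : realType) r (V : finType) (p : R) (y S B u0 nmax : nat)
    (f g : V -> 'I_r) (G H : {ffun 'I_r * 'I_r -> bool}) (J J' : {set V}) :
  0 <= p -> (0 < u0)%N -> (y <= r)%N ->
  ~~ rows_heavy y S G -> ~~ rows_heavy y S (swap G) ->
  ~~ rows_heavy y S H -> ~~ rows_heavy y S (swap H) ->
  ~~ sparse_exists p u0 f g (fun u v => closed H (g u) (g v)) G ->
  ~~ sparse_exists p u0 g f (fun u v => closed G (f u) (f v)) H ->
  (forall z, #|[set v | f v == z]| <= B)%N ->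
  (forall z, #|[set v | g v == z]| <= B)%N ->
  (forall U : {set V}, U != set0 -> (#|f @: U| + #|g @: U| <= nmax)%N ->
        (#|U| <= 8 * (#|f @: U| + #|g @: U|))%N) ->
  (#|J| = y * B)%N -> (#|J'| = y * B)%N -> (y * B = 8 * nmax)%N ->
  (y * B = 32 * u0)%N -> (2 ^ 11 * S <= y ^ 2)%N ->
  p * (u0 * (y * B))%:R <=
    (1024 * #|[set q in setX J J' | two_bites f g G H q.1 q.2]|)%:R.
Proof.
move=> p0 u00 yr hG hG' hH hH' s1 s2 fB gB sp cJ cJ' yn yu0 SY.
have sp' (U : {set V}) : U != set0 -> (#|g @: U| + #|f @: U| <= nmax)%N ->
        (#|U| <= 8 * (#|g @: U| + #|f @: U|))%N.
  by rewrite addnC; exact: sp.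
have swapE : #|[set q in setX J J' | two_bites f g G H q.1 q.2]|
           = #|[set q in setX J' J | two_bites f g G H q.1 q.2]|.
  rewrite -(card_imset _ (inv_inj (_ : involutive (fun q : V * V => (q.2, q.1)))));
    last by case.
  apply: eq_card => -[u v]; rewrite !inE /=; apply/imsetP/idP.
    case=> -[u' v'] /=; rewrite !inE /= => /andP[/andP[h1 h2] h3] [-> ->].
    by rewrite h1 h2 two_bitesC h3.
  move=> /andP[/andP[h1 h2] h3]; exists (v, u) => //.
  by rewrite !inE /= h1 h2 two_bitesC h3.
have fin (A A' : {set V}) (P : rel V) : (forall u v, P u v -> two_bites f g G H u v) ->
  (1024 * #|[set q in setX A A' | P q.1 q.2]| <=
  1024 * #|[set q in setX A A' | two_bites f g G H q.1 q.2]|)%N.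
  move=> PT; rewrite leq_mul2l; apply: subset_leq_card; apply/subsetP => q.
  by rewrite !inE => /andP[-> /PT].
have fin1 A A' := fin A A'
   (fun u v => open_pair f (fun u v => closed H (g u) (g v)) G u v && edge G (f u) (f v))
   (fun u v h => introT orP (or_introl h)).
have fin2 A A' := fin A A'
   (fun u v => open_pair g (fun u v => closed G (f u) (f v)) H u v && edge H (g u) (g v))
   (fun u v h => introT orP (or_intror h)).
have e1 := half_edges p0 u00 yr hG hG' hH hH' s1 fB gB sp cJ cJ' yn yu0 SY.
have e2 := half_edges p0 u00 yr hH hH' hG hG' s2 gB fB sp' cJ cJ' yn yu0 SY.
have e3 := half_edges p0 u00 yr hG hG' hH hH' s1 fB gB sp cJ' cJ yn yu0 SY.
have e4 := half_edges p0 u00 yr hH hH' hG hG' s2 gB fB sp' cJ' cJ yn yu0 SY.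
set a := half_cover f J in e1 e2 e3 e4; set b := half_cover g J in e1 e2 e3 e4.
set c := half_cover f J' in e1 e2 e3 e4; set d := half_cover g J' in e1 e2 e3 e4.
have [[h h']|[[h h']|[[h h']|[h h']]]] :
  ((b <= a)%N /\ (b <= c)%N) \/ ((a <= b)%N /\ (a <= d)%N) \/
  ((d <= c)%N /\ (d <= a)%N) \/ ((c <= d)%N /\ (c <= b)%N).
  by clear; case: (leqP b a) => ba; case: (leqP d c) => dc;
    case: (leqP b c) => bc; case: (leqP a d) => ad; case: (leqP b d) => bd;
    case: (leqP a c) => ac; lia.
- by apply: le_trans (e1 h h') _; rewrite ler_nat fin1.
- by apply: le_trans (e2 h h') _; rewrite ler_nat fin2.
- by rewrite swapE; apply: le_trans (e3 h h') _; rewrite ler_nat fin1.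
- by rewrite swapE; apply: le_trans (e4 h h') _; rewrite ler_nat fin2.
Qed.

(** The expected number of failures is below 1. The bounds uniform in [HC] are used with the other
    matrix fixed, after exchanging the two expectations where necessary. *)
Lemma good_matrices (R : realType) r (V : finType) (p er es : R) (y S u0 : nat)
    (f g : V -> 'I_r) :
  0 <= p <= 1 ->
  Ex (bern p) (fun w : {ffun 'I_r * 'I_r -> bool} => (rows_heavy y S w)%:R) <= er ->
  (forall HC, Ex (bern p) (fun w => (sparse_exists p u0 f g HC w)%:R) <= es) ->
  (forall HC, Ex (bern p) (fun w => (sparse_exists p u0 g f HC w)%:R) <= es) ->
  4 * er + 2 * es < 1 ->
  exists G H : {ffun 'I_r * 'I_r -> bool},
  [/\ ~~ rows_heavy y S G /\ ~~ rows_heavy y S (swap G),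
   ~~ rows_heavy y S H /\ ~~ rows_heavy y S (swap H),
   ~~ sparse_exists p u0 f g (fun u v => closed H (g u) (g v)) G &
   ~~ sparse_exists p u0 g f (fun u v => closed G (f u) (f v)) H].
Proof.
move=> p01 hr h1 h2 lt1; have b0 := fun b => bern_ge0 b p01.
pose i1 (w : {ffun 'I_r * 'I_r -> bool}) : R :=
  (rows_heavy y S w)%:R + (rows_heavy y S (swap w))%:R.
pose i2 G H : R := (sparse_exists p u0 f g (fun u v => closed H (g u) (g v)) G)%:R.
pose i3 G H : R := (sparse_exists p u0 g f (fun u v => closed G (f u) (f v)) H)%:R.
have Ei1 : Ex (bern p) i1 <= 2 * er.
  by rewrite ExD -(Ex_swap (bern p) (fun w => (rows_heavy y S w)%:R)); lra.
have ge1 : 0 <= 1 :> R by exact: ler01.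
have : Ex (bern p) (fun G => Ex (bern p) (fun H => i1 G * 1 + (i1 H + (i2 G H + i3 G H)))) < 1.
  apply: le_lt_trans lt1.
  have -> : 4 * er + 2 * es = 2 * er + (2 * er + (es + es)) by ring.
  have EC (c : R) : Ex (bern p) (fun _ : {ffun 'I_r * 'I_r -> bool} => c) = c.
    by have := ExZ (bern p) c (fun _ : {ffun 'I_r * 'I_r -> bool} => 1);
      rewrite Ex1 ?bern_sum // !mulr1.
  apply: le_trans (_ : Ex (bern p) (fun G => i1 G + (Ex (bern p) i1 +
     (Ex (bern p) (i2 G) + Ex (bern p) (i3 G)))) <= _).
    apply: Ex_le => // G.
    rewrite (ExD (bern p) (fun=> i1 G * 1) (fun H => i1 H + (i2 G H + i3 G H))).
    rewrite (ExD (bern p) i1 (fun H => i2 G H + i3 G H)).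
    by rewrite (ExD (bern p) (i2 G) (i3 G)) EC mulr1.
  rewrite (ExD (bern p) i1) (ExD (bern p) (fun=> Ex (bern p) i1)) EC.
  rewrite (ExD (bern p) (fun G => Ex (bern p) (i2 G))).
  apply: lerD => //; apply: lerD => //; apply: lerD.
    rewrite (Ex_exchange (bern p) (bern p) i2) -[leRHS]EC.
    by apply: Ex_le => // H; exact: h1.
  rewrite -[leRHS]EC; apply: Ex_le => // G; exact: h2.
move=> /(Ex_lt1_exists b0 (bern_sum p))[G] /(Ex_lt1_exists b0 (bern_sum p))[H].
rewrite /i1 /i2 /i3 mulr1 -!natrD (ltr_nat _ _ 1) ltnS leqn0 !addn_eq0 !eqb0.
case/andP => /andP[h3 h4] /and3P[/andP[h5 h6] h7 h8].
by exists G, H.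
Qed.

(** * Numerical choice of the parameters *)

Lemma expR_nat_le (R : realType) n : expR (n%:R : R) <= 2 ^+ (2 * n).
Proof.
rewrite -[n%:R]mul1r expRM_natr exprM lerXn2r ?nnegrE ?expR_ge0 ?exprn_ge0 //.
by apply: le_trans (expR1_le4 R) _; lra.
Qed.

Lemma expRN_nat_le (R : realType) n : expR (- n%:R : R) <= 2 ^- n.
Proof.
rewrite -mulN1r expRM_natr -exprVn lerXn2r ?nnegrE ?expR_ge0 ?invr_ge0 //.
by apply: le_trans (expRN1_le R) _; lra.
Qed.

Lemma pow2_ratio (R : realType) a b c : (a + c <= b)%N ->
  2 ^+ a / 2 ^+ b <= 2 ^- c :> R.
Proof.
move=> le; rewrite ler_pdivrMr ?exprn_gt0 // ler_pdivlMl ?exprn_gt0 //.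
by rewrite -exprD addnC ler_weXn2l // ler1n.
Qed.

Lemma pow2_cancel (R : realType) a b c : (a = b + c)%N ->
  2 ^- b * 2 ^+ a = 2 ^+ c :> R.
Proof. by move=> ->; rewrite exprD mulKf // expf_neq0 // pnatr_eq0. Qed.

Lemma sqr_le_exp2 n : (4 <= n)%N -> (n ^ 2 <= 2 ^ n)%N.
Proof.
elim: n => // n IHn; rewrite leq_eqVlt => /orP[/eqP<- //|]; rewrite ltnS => n4.
have := IHn n4; rewrite [(2 ^ n.+1)%N]expnS -!mulnn; nia.
Qed.

(** With e = d / 2 rounded down, d^2 2^26 <= e^2 2^30 <= e^4 <= 2^(2 e). *)
Lemma sqr_shift_le_exp2 d : (2 ^ 16 <= d)%N -> (d ^ 2 * 2 ^ 26 <= 2 ^ d)%N.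
Proof.
move=> ld; pose e := (d %/ 2)%N; have d2 : (d = 2 * e + d %% 2)%N.
  by rewrite mulnC -divn_eq.
have lt2 : (d %% 2 < 2)%N by rewrite ltn_mod.
have e15 : (2 ^ 15 <= e)%N.
  by rewrite leq_divRL // -expnSr.
have e4 : (4 <= e)%N by apply: leq_trans e15; rewrite -[4%N]/(2 ^ 2)%N leq_exp2l.
apply: (@leq_trans ((e ^ 2) ^ 2)); last first.
  apply: (@leq_trans ((2 ^ e) ^ 2)); first by rewrite leq_exp2r // sqr_le_exp2.
  by rewrite -expnM leq_exp2l // mulnC d2 leq_addr.
apply: (@leq_trans ((e ^ 2 * 2 ^ 4) * 2 ^ 26)).
  rewrite leq_mul2r; apply/orP; right; rewrite -[(2 ^ 4)%N]/(4 ^ 2)%N -expnMn leq_exp2r //.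
  by clear -d2 lt2 e4; lia.
rewrite -mulnA -expnD -[X in (_ <= X)%N]mulnn leq_mul2l; apply/orP; right.
by rewrite -[(4 + 26)%N]/(15 * 2)%N expnM leq_exp2r.
Qed.

(** Here p y = 2^13 and p r is about 2^(4 d). The auxiliary parameters are Delta = 8 p r, n0 tau =
    32 y with tau = 2^d, and half of the threshold for [s1]. *)
Lemma rows_heavy_prob (R : realType) d : (2 ^ 16 <= d)%N ->
  Ex (bern (2 ^- (4 * d + 9) : R))
    (fun w : {ffun 'I_(2 ^ (8 * d)) * 'I_(2 ^ (8 * d)) -> bool} =>
       (rows_heavy (2 ^ (4 * d + 22)) (2 ^ (8 * d + 32)) w)%:R) <= 2 ^- 4.
Proof.
move=> ld; have d16 : (65 <= d)%N.
  by apply: leq_trans ld; rewrite (_ : 65 = 2 ^ 6 + 1)%N // addn1 ltn_exp2l.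
have [r rd] : exists r, r = (2 ^ (8 * d))%N by exists (2 ^ (8 * d))%N.
have [y yd] : exists y, y = (2 ^ (4 * d + 22))%N by exists (2 ^ (4 * d + 22))%N.
have [tau td] : exists tau, tau = (2 ^ d)%N by exists (2 ^ d)%N.
have [n0 n0d] : exists n0, n0 = (2 ^ (3 * d + 27))%N by exists (2 ^ (3 * d + 27))%N.
have [Delta Dd] : exists Delta, Delta = (2 ^ (4 * d - 6))%N by exists (2 ^ (4 * d - 6))%N.
have [s1 s1d] : exists s1, s1 = (2 ^ (8 * d + 31))%N by exists (2 ^ (8 * d + 31))%N.
have [S Sd] : exists S, S = (2 ^ (8 * d + 32))%N by exists (2 ^ (8 * d + 32))%N.
rewrite -rd -yd -Sd.
have rE : r%:R = 2 ^+ (8 * d) :> R by rewrite rd natrX.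
have yE : y%:R = 2 ^+ (4 * d + 22) :> R by rewrite yd natrX.
have tE : tau%:R = 2 ^+ d :> R by rewrite td natrX.
have DE : Delta%:R = 2 ^+ (4 * d - 6) :> R by rewrite Dd natrX.
have s1E : s1%:R = 2 ^+ (8 * d + 31) :> R by rewrite s1d natrX.
have p01 : 0 <= (2 ^- (4 * d + 9) : R) <= 1.
  by rewrite invr_ge0 exprn_ge0 //= invf_le1 ?exprn_gt0 // exprn_ege1 // ler1n.
have py : 2 ^- (4 * d + 9) * y%:R = 2 ^+ 13 :> R.
  by rewrite yE; apply: pow2_cancel; lia.
have p8 : 8 * 2 ^- (4 * d + 9) * r%:R = Delta%:R :> R.
  have -> : (8 : R) = 2 ^+ 3 by rewrite !exprS expr0; ring.
  rewrite rE DE -mulrA mulrCA -exprD; apply: pow2_cancel; lia.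
move: p01 py p8; move: (2 ^- (4 * d + 9)) => p p01 py p8.
have py1 : 1 <= p * y%:R by rewrite py exprn_ege1 // ler1n.
have n0y : (n0 <= y)%N by rewrite n0d yd leq_exp2l //; lia.
have n0r : (n0 <= r)%N by rewrite n0d rd leq_exp2l //; lia.
have yn0 : (32 * y <= n0 * tau)%N.
  by rewrite yd n0d td -[32%N]/(2 ^ 5)%N -!expnD leq_exp2l //; lia.
have sS : (s1 + Delta * (32 * y) <= S)%N.
  apply: (@leq_trans (s1 + s1)); last first.
    by rewrite addnn -mul2n s1d Sd -expnS leq_exp2l //; lia.
  by rewrite leq_add2l s1d Dd yd -[32%N]/(2 ^ 5)%N -!expnD leq_exp2l //; lia.
apply: le_trans (_ : _ <= Ex (bern p) (fun w : {ffun 'I_r * 'I_r -> bool} =>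
     [exists Y : {set 'I_r}, (#|Y| == y) &&
        (s1 + Delta * (32 * y) <= \sum_a row_count w Y a ^ 2)%N]%:R)) _.
  apply: Ex_le => [b|w]; first exact: bern_ge0.
  rewrite ler_nat; case: (boolP (rows_heavy _ _ _)) => // /existsP[Y /andP[cY le]].
  rewrite lt0b; apply/existsP; exists Y; rewrite cY /=; exact: leq_trans sS le.
apply: le_trans (@rows_tail R p r y tau n0 Delta s1 p01 py1 _ n0r yn0) _.
  by rewrite td expn_gt0.
have -> : 2 ^- 4 = 2 ^- 6 + 2 ^- 6 + 2 ^- 5 :> R.
  by rewrite !exprS expr0; field.
apply: lerD; first apply: lerD.
(* Here 8^-Delta exp(Delta) <= 2^-Delta, far below 1/r. *)
- rewrite p8.
  apply: le_trans (_ : 2 ^+ (8 * d) * (8 ^- Delta * 2 ^+ (2 * Delta)) <= _).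
    by rewrite rE !ler_wpM2l ?expR_nat_le ?exprn_ge0 // invr_ge0 exprn_ge0.
  have -> : (8 : R) = 2 ^+ 3 by rewrite !exprS expr0; ring.
  rewrite mulrCA mulrC -exprM -exprD; apply: pow2_ratio.
  have : (8 * d + 6 <= Delta)%N.
    have d4 : (4 <= 4 * d - 6)%N by lia.
    have := sqr_le_exp2 d4; rewrite -Dd -mulnn; clear -d16; nia.
  lia.
(* The factor tau^(-32 y) = 2^(-32 d y) beats both the choices, 2^(16 d y), and the exponential,
   2^(2^19 y); this uses d >= 2^16. *)
- have -> : tau%:R * p * (n0 * y)%:R = (2 ^ 18 * y)%N%:R.
    rewrite [(n0 * y)%:R]natrM mulrA -mulrA -mulrA [n0%:R * _]mulrC [_%:R * n0%:R]mulrC.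
    rewrite [p * _]mulrCA py tE n0d [in RHS]natrM yE !natrX -!exprD.
    by congr (_ ^+ _); lia.
  apply: le_trans (_ : r%:R ^+ y * r%:R ^+ y *
      (tau%:R ^- (32 * y) * 2 ^+ (2 * (2 ^ 18 * y))) <= _).
    apply: ler_pM.
    - by rewrite mulr_ge0 // exprn_ge0.
    - by rewrite mulr_ge0 ?expR_ge0 // invr_ge0 exprn_ge0.
    - by rewrite ler_wpM2l ?exprn_ge0 // ler_weXn2l // ler1n rd expn_gt0.
    - by rewrite ler_wpM2l ?expR_nat_le // invr_ge0 exprn_ge0.
  rewrite rE tE -!exprM mulrCA mulrC -!exprD; apply: pow2_ratio.
  have h19 : (2 * 2 ^ 18 + 1 <= 16 * d)%N.
    rewrite -[16%N]/(2 ^ 4)%N -expnS; apply: leq_trans (_ : 2 ^ 4 * 2 ^ 16 <= _)%N.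
      by rewrite -expnD addn1 ltn_exp2l.
    by rewrite leq_mul2l.
  have y6 : (6 <= y)%N.
    by rewrite yd; apply: (@leq_trans (2 ^ 3)) => //; rewrite leq_exp2l //; lia.
  have : ((2 * 2 ^ 18 + 1) * y <= 16 * d * y)%N by rewrite leq_mul2r h19 orbT.
  move: y6; clear; move: (2 ^ 18)%N y => a y; nia.
(* The exponent is 2^(6 d + 29) - 2^(6 d + 30), while there are at most 2^(8 d y) choices of a
   set. *)
- have -> : 8 * (p * y%:R) ^+ 2 * r%:R / tau%:R ^+ 2 - s1%:R / (2 * tau%:R ^+ 2)
      = - (2 ^ (6 * d + 29))%N%:R :> R.
    have t0 : tau%:R != 0 :> R by rewrite td pnatr_eq0 expn_eq0.
    have E1 : r%:R = 2 ^+ (6 * d) * tau%:R ^+ 2 :> R.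
      by rewrite rE tE -exprM -exprD; congr (_ ^+ _); lia.
    have E2 : s1%:R = 2 * ((2 ^+ 30 * 2 ^+ (6 * d)) * tau%:R ^+ 2) :> R.
      by rewrite s1E tE -exprM -!exprD -exprS; congr (_ ^+ _); lia.
    rewrite E1 E2 py natrX [2 ^+ (6 * d + 29)]exprD.
    have -> : 2 ^+ 30 = 2 * 2 ^+ 29 :> R by rewrite -exprS.
    have -> : 8 * (2 ^+ 13) ^+ 2 = 2 ^+ 29 :> R.
      have -> : (8 : R) = 2 ^+ 3 by rewrite !exprS expr0; ring.
      by rewrite -exprM -exprD.
    by move: (2 ^+ 29) (2 ^+ (6 * d)) => a b; field.
  apply: le_trans (_ : 2 ^+ (8 * d * y) * 2 ^- (2 ^ (6 * d + 29)) <= _).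
    by rewrite rE -exprM ler_wpM2l ?exprn_ge0 // expRN_nat_le.
  apply: pow2_ratio; rewrite yd.
  have h1 : (d <= 2 ^ d)%N by apply: ltnW; exact: ltn_expl.
  apply: (@leq_trans (2 ^ (5 * d + 25) + 2 ^ (5 * d + 25))).
    apply: leq_add.
      apply: (@leq_trans (2 ^ 3 * 2 ^ d * 2 ^ (4 * d + 22))).
        by apply: leq_mul => //; apply: (@leq_mul 8 d (2 ^ 3)).
      by rewrite -!expnD leq_exp2l //; lia.
    apply: (@leq_trans (2 ^ 3)) => //; rewrite leq_exp2l //; lia.
  by rewrite addnn -mul2n -expnS leq_exp2l //; lia.
Qed.

(** Each of the 2^(8 d) first labels is carried by 4 d vertices, and the density is p = 2^-(4 d +
    9). With j the size of the two sets, the number of edges obtained is p u0 j / 1024, where u0 = j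
    / 32. *)
Lemma triangle_free_graph (R : realType) d : (2 ^ 16 <= d)%N ->
  exists E : rel ('I_(2 ^ (8 * d)) * 'I_(4 * d)),
  [/\ symmetric E, (forall u v w, E u v -> E u w -> E v w -> False) &
   forall J J' : {set 'I_(2 ^ (8 * d)) * 'I_(4 * d)},
     #|J| = (d * 2 ^ (4 * d + 27))%N -> #|J'| = (d * 2 ^ (4 * d + 27))%N ->
     (d ^ 2 * 2 ^ (4 * d + 30) <= #|[set q in setX J J' | E q.1 q.2]|)%N].
Proof.
move=> ld; have d16 : (65 <= d)%N.
  by apply: leq_trans ld; rewrite (_ : 65 = 2 ^ 6 + 1)%N // addn1 ltn_exp2l.
have hr := rows_heavy_prob R ld.
have ss := sqr_shift_le_exp2 ld.
have [r rd] : exists r, r = (2 ^ (8 * d))%N by exists (2 ^ (8 * d))%N.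
have [y yd] : exists y, y = (2 ^ (4 * d + 22))%N by exists (2 ^ (4 * d + 22))%N.
have [S Sd] : exists S, S = (2 ^ (8 * d + 32))%N by exists (2 ^ (8 * d + 32))%N.
have [u0 u0d] : exists u, u = (d * 2 ^ (4 * d + 22))%N by exists (d * 2 ^ (4 * d + 22))%N.
have [nm nd] : exists u, u = (d * 2 ^ (4 * d + 24))%N by exists (d * 2 ^ (4 * d + 24))%N.
have [j jd] : exists u, u = (d * 2 ^ (4 * d + 27))%N by exists (d * 2 ^ (4 * d + 27))%N.
have [e ed] : exists u, u = (d ^ 2 * 2 ^ (4 * d + 30))%N by exists (d ^ 2 * 2 ^ (4 * d + 30))%N.
rewrite -rd -jd -ed; rewrite -rd -yd -Sd in hr.
(* Eight times the average number 4 d of vertices with a given second label. *)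
pose B := (32 * d)%N.
have rE : r%:R = 2 ^+ (8 * d) :> R by rewrite rd natrX.
have r0 : (0 < r)%N by rewrite rd expn_gt0.
have e24 : (2 ^ (4 * d + 24) = y * 4)%N by rewrite yd -[4%N in RHS]/(2 ^ 2)%N -expnD -addnA.
have e27 : (2 ^ (4 * d + 27) = y * 32)%N by rewrite yd -[32%N]/(2 ^ 5)%N -expnD -addnA.
have yB : (y * B = j)%N by rewrite jd e27 /B; clear; lia.
have jn : (j = 8 * nm)%N by rewrite jd nd e27 e24; clear; lia.
have ju : (j = 32 * u0)%N by rewrite jd u0d e27 -yd; clear; lia.
have u8 : (8 <= u0)%N.
  rewrite u0d -[8%N]/(1 * 2 ^ 3)%N; apply: leq_mul; first by clear -d16; lia.
  by rewrite leq_exp2l //; lia.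
have yr : (y <= r)%N by rewrite yd rd leq_exp2l //; lia.
have SY : (2 ^ 11 * S <= y ^ 2)%N.
  by rewrite yd Sd -expnM -expnD leq_exp2l //; lia.
have p01 : 0 <= (2 ^- (4 * d + 9) : R) <= 1.
  by rewrite invr_ge0 exprn_ge0 //= invf_le1 ?exprn_gt0 // exprn_ege1 // ler1n.
(* The gain exp(-128 d) pays for the enumeration (r 2^B)^2 = 2^(80 d). *)
have pu : 2 ^- (4 * d + 9) * u0%:R / 64 = (128 * d)%:R :> R.
  rewrite u0d [(d * _)%N]mulnC natrM natrX mulrA (pow2_cancel R (c := 13)); last by lia.
  have -> : 2 ^+ 13 = 64 * 128 :> R by rewrite !exprS expr0; ring.
  by rewrite natrM; field.
have pe : 2 ^- (4 * d + 9) * (u0 * j)%:R = (1024 * e)%:R :> R.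
  have -> : (u0 * j = 2 ^ (8 * d + 49) * d ^ 2)%N.
    by rewrite u0d jd mulnACA -expnD mulnC mulnn; congr (2 ^ _ * _)%N; lia.
  have -> : (1024 * e = 2 ^ (4 * d + 40) * d ^ 2)%N.
    rewrite ed mulnCA mulnC -[1024%N]/(2 ^ 10)%N -expnD; congr (2 ^ _ * _)%N; lia.
  rewrite !natrM !natrX mulrA (pow2_cancel R (c := 4 * d + 40)) //; lia.
move: p01 pu pe hr; move: (2 ^- (4 * d + 9)) => p p01 pu pe hr.
(* The choice beta = 2^(3 d) makes beta^8 = 2^(24 d) exceed r^2 = 2^(16 d), while beta times 4 d nm
   is d^2 2^(7 d + 26) <= r. *)
have b1 : 1 <= (2 ^+ (3 * d) : R) by rewrite exprn_ege1 // ler1n.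
have x8 : (2 ^+ (3 * d)) ^+ 8 = 2 ^+ (24 * d) :> R by rewrite -exprM; congr (_ ^+ _); lia.
have q1 : 2 ^- 1 = 1 / 2 :> R by rewrite expr1 div1r.
have q2 : 2 ^- 2 = 1 / 4 :> R by rewrite !exprS expr0; field.
have q4 : 2 ^- 4 = 1 / 16 :> R by rewrite !exprS expr0; field.
have four : (4 : R) = 2 ^+ 2 by rewrite !exprS expr0; ring.
have [g [gB gS]] : exists g : {ffun 'I_r * 'I_(4 * d) -> 'I_r},
    (forall z, #|[set v | g v == z]| <= B)%N /\
    (forall U : {set 'I_r * 'I_(4 * d)}, U != set0 ->
       (#|fst @: U| + #|g @: U| <= nm ->
        #|U| <= 8 * (#|fst @: U| + #|g @: U|))%N).
  apply: (@good_labelling R r (4 * d) B nm (2 ^+ (3 * d)) r0 b1).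
  - rewrite -natrX -natrM ler_nat nd rd.
    apply: (@leq_trans (2 ^ (7 * d) * (d ^ 2 * 2 ^ 26))).
      have -> : (7 * d = 3 * d + 4 * d)%N by clear; lia.
      rewrite (expnD 2 (3 * d)) (expnD 2 (4 * d) 24) -[26%N]/(24 + 2)%N (expnD 2 24).
      rewrite -!mulnn; move: (2 ^ (3 * d))%N (2 ^ (4 * d))%N (2 ^ 24)%N => a b c.
      by clear; lia.
    apply: (@leq_trans (2 ^ (7 * d) * 2 ^ d)); first by rewrite leq_mul2l ss orbT.
    by rewrite -expnD leq_exp2l //; lia.
  - apply: (@le_lt_trans _ _ (2 ^- 2 : R)); last by rewrite q2; clear; lra.
    apply: le_trans (_ : 2 ^+ (8 * d) * (4 ^- B.+1 * 2 ^+ (2 * (4 * (4 * d)))) <= _).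
      rewrite rE !ler_wpM2l ?exprn_ge0 ?invr_ge0 ?exprn_ge0 //.
      by rewrite -natrM expR_nat_le.
    rewrite four mulrCA mulrC -exprM -exprD; apply: pow2_ratio; rewrite /B; lia.
  - rewrite rE x8 four -exprM mulrA -exprD.
    have h : 2 ^+ (8 * d * 2 + 2) / 2 ^+ (24 * d) <= 2 ^- 1 :> R by apply: pow2_ratio; lia.
    apply: (@le_lt_trans _ _ ((2 ^- 1) ^+ 2 : R)); last by rewrite q1 expr2; clear; lra.
    by rewrite lerXn2r ?nnegrE ?divr_ge0 ?invr_ge0 ?exprn_ge0.
  - rewrite rE x8 four mulrA -exprD.
    apply: (@le_trans _ _ (2 ^- 1 : R)); last by rewrite q1; clear; lra.
    by apply: pow2_ratio; lia.
have fB (z : 'I_r) : (#|[set v : 'I_r * 'I_(4 * d) | v.1 == z]| <= B)%N.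
  have -> : [set v : 'I_r * 'I_(4 * d) | v.1 == z] = setX [set z] [set: 'I_(4 * d)].
    by apply/setP => v; rewrite !inE andbT.
  by rewrite cardsX cards1 mul1n cardsT card_ord leq_mul2r orbT.
have hs (f f' : 'I_r * 'I_(4 * d) -> 'I_r) :
    (forall z, #|[set v | f v == z]| <= B)%N -> (forall z, #|[set v | f' v == z]| <= B)%N ->
    forall HC, Ex (bern p) (fun w => (sparse_exists p u0 f f' HC w)%:R) <= (2 ^- 4 : R).
  move=> hf hf' HC.
  have x1 : (r%:R * 2 ^+ B) ^+ 2 * expR (- (p * u0%:R / 64)) <= 2 ^- (48 * d) :> R.
    apply: le_trans (_ : (r%:R * 2 ^+ B) ^+ 2 * 2 ^- (128 * d) <= _).
      by rewrite ler_wpM2l ?sqr_ge0 // pu expRN_nat_le.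
    by rewrite rE -exprD -exprM; apply: pow2_ratio; rewrite /B; lia.
  apply: le_trans (sparse_exists_prob HC p01 u8 hf hf' _) _.
    by apply: le_trans x1 _; rewrite invf_le1 ?exprn_gt0 // exprn_ege1 // ler1n.
  apply: le_trans (ler_wpM2l _ x1) _ => //.
  by rewrite rE; apply: pow2_ratio; lia.
have [|G [H [[hG hG'] [hH hH'] sG sH]]] := good_matrices p01 hr (hs fst g fB gB) (hs g fst gB fB).
  by rewrite q4; clear; lra.
exists (two_bites fst g G H); split.
- by move=> u v; exact: two_bitesC.
- by move=> u v w; exact: two_bites_triangle_free.
- move=> J J' cJ cJ'.
  have /andP[p0 _] := p01; rewrite -yB in cJ cJ' jn ju pe.
  have := two_bites_edges p0 (leq_trans (isT : 0 < 8)%N u8) yr hG hG' hH hH' sG sH fB gB gS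
    cJ cJ' jn ju SY.
  by rewrite pe ler_nat leq_mul2l.
Qed.

(** * Permutations avoiding forbidden entries *)

Definition avoids m (Red : 'I_m -> 'I_m -> bool) (s : 'S_m) : bool :=
  [forall x, ~~ Red x (s x)].

(* When the rows are exposed in increasing order, the columns still free at row
   x are the [s z] with [x <= z]. *)
Definition later_red m (Red : 'I_m -> 'I_m -> bool) (s : 'S_m) : nat :=
  (\sum_(x < m) \sum_(z < m | (x <= z)%N) Red x (s z))%N.

(** A permutation is given by its value at 0 and a permutation of the remaining points. *)
Lemma big_lift_perm (R : realType) n (F : 'S_n.+1 -> R) :
  \sum_s F s = \sum_y \sum_s F (lift_perm ord0 y s).
Proof.
pose h (q : 'I_n.+1 * 'S_n) := lift_perm ord0 q.1 q.2.
have hI : injective h.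
  move=> [y s] [y' s']; rewrite /h /= => e.
  have yy' : y = y' by rewrite -(lift_perm_id ord0 y s) e lift_perm_id.
  rewrite -yy' in e *; congr pair; apply/permP => k; apply: (@lift_inj _ y).
  by rewrite -!(lift_perm_lift ord0) e.
rewrite pair_big /= (reindex h) //; apply: onW_bij.
by apply: inj_card_bij => //; rewrite card_prod !card_Sn card_ord -factS.
Qed.

(** Row 0 is exposed first: with rho forbidden entries, a fraction 1 - rho/(n + 1) <= exp(-rho/(n +
    1)) of its columns is allowed, which absorbs the weight exp(rho/M). [M] is kept apart from [m]
    so that it stays fixed along the induction. *)
Lemma later_red_weight (R : realType) m (Red : 'I_m -> 'I_m -> bool) (M : R) :
  m%:R <= M -> 0 < M ->
  \sum_(s | avoids Red s) expR ((later_red Red s)%:R / M) <= m`!%:R.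
Proof.
move=> mM M0; elim: m Red mM => [|n IHn] Red nM.
  rewrite fact0 (eq_bigr (fun=> 1)) => [|s _]; last first.
    by rewrite /later_red big_ord0 mul0r expR0.
  rewrite sumr_const ler_nat; apply: leq_trans (max_card _) _.
  by rewrite card_Sn fact0.
pose rho := (\sum_y Red ord0 y)%N.
pose Red' (y : 'I_n.+1) (x z : 'I_n) := Red (lift ord0 x) (lift y z).
rewrite big_mkcond big_lift_perm.
have av y s : avoids Red (lift_perm ord0 y s) = ~~ Red ord0 y && avoids (Red' y) s.
  apply/forallP/andP => [av|[av0 /forallP av] x].
    split; first by rewrite -{1}(lift_perm_id ord0 y s) av.
    by apply/forallP => x; rewrite /Red' -(lift_perm_lift ord0) av.
  case: (unliftP ord0 x) => [x' ->|->]; last by rewrite lift_perm_id.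
  by rewrite lift_perm_lift; exact: av.
have lr y s : later_red Red (lift_perm ord0 y s) = (rho + later_red (Red' y) s)%N.
  rewrite /later_red big_ord_recl; congr (_ + _)%N.
    by rewrite /rho [RHS](reindex_inj (@perm_inj _ (lift_perm ord0 y s))); apply: eq_big.
  apply: eq_bigr => x _; rewrite big_mkcond big_ord_recl /= add0n [RHS]big_mkcond.
  by apply: eq_bigr => z _; rewrite lift_perm_lift /bump /= !add1n ltnS.
apply: le_trans (_ : \sum_y (if ~~ Red ord0 y then expR (rho%:R / M) * n`!%:R else 0) <= _).
  apply: ler_sum => y _; case: ifP => /= ry; last first.
    by rewrite big1 // => s _; rewrite av ry.
  rewrite -big_mkcond (eq_bigl (avoids (Red' y))) => [|s]; last by rewrite av ry.
  rewrite (eq_bigr (fun s => expR (rho%:R / M) * expR ((later_red (Red' y) s)%:R / M))).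
    rewrite -mulr_sumr ler_wpM2l ?expR_ge0 // IHn //.
    by apply: le_trans nM; rewrite ler_nat.
  by move=> s _; rewrite lr natrD mulrDl expRD.
rewrite -big_mkcond sumr_const -[leLHS]mulr_natl.
have rhoE : #|Red ord0| = rho.
  by rewrite -sum1_card big_mkcond /=; apply: eq_bigr => i _; rewrite unfold_in; case: (Red _ _).
have cC := cardC (Red ord0); rewrite rhoE card_ord in cC.
rewrite (_ : #|_|%:R = n.+1%:R - rho%:R); last first.
  by move/(congr1 (fun k : nat => k%:R : R)): cC => <-; rewrite natrD addrAC subrr add0r.
rewrite factS natrM mulrA ler_wpM2r ?ler0n //.
have n0 : 0 < n.+1%:R :> R by rewrite ltr0n.
have -> : n.+1%:R - rho%:R = n.+1%:R * (1 + - (rho%:R / n.+1%:R)) :> R.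
  by rewrite mulrDr mulr1 mulrN mulrCA divff ?mulr1 // gt_eqF.
rewrite -mulrA ler_piMr ?ler0n //.
apply: le_trans (_ : expR (- (rho%:R / n.+1%:R)) * expR (rho%:R / M) <= _).
  by rewrite ler_wpM2r ?expR_ge0 // expR_ge1Dx.
rewrite -expRD -[leRHS]expR0 ler_expR addrC subr_le0 ler_wpM2l ?ler0n //.
by rewrite lef_pV2 ?posrE.
Qed.

(* Every forbidden entry (x, y) is still free at row x for the increasing or for
   the decreasing order of exposure, so one of the two orders sees half of them. *)
Lemma card_avoids (R : realType) m (Red : 'I_m -> 'I_m -> bool) : (0 < m)%N ->
  #|[set s | avoids Red s]|%:R
    <= 2 * m`!%:R * expR (- ((\sum_x \sum_y Red x y)%N%:R / (2 * m%:R))) :> R.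
Proof.
move=> m0; set X := (\sum_x _)%N; have m0R : 0 < m%:R :> R by rewrite ltr0n.
pose rp : 'S_m := perm (@rev_ord_inj m).
pose Redr (x y : 'I_m) := Red (rev_ord x) y.
have avr s : avoids Redr (rp * s)%g = avoids Red s.
  apply/forallP/forallP => av x; last by rewrite permM permE; exact: av.
  by have := av (rev_ord x); rewrite permM permE /Redr rev_ordK.
pose E (Q : 'I_m -> 'I_m -> bool) (s : 'S_m) : R := expR ((later_red Q s)%:R / m%:R).
have leX s : (X <= later_red Red s + later_red Redr (rp * s)%g)%N.
  have -> : later_red Redr (rp * s)%g = (\sum_(x < m) \sum_(z < m | (z <= x)%N) Red x (s z))%N.
    rewrite /later_red (reindex_inj rev_ord_inj); apply: eq_bigr => x _.
    rewrite (reindex_inj rev_ord_inj); apply: eq_big => [z|z _] /=.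
      by have := ltn_ord x; have := ltn_ord z; lia.
    by rewrite /Redr permM permE !rev_ordK.
  rewrite /X /later_red -big_split /=; apply: leq_sum => x _.
  rewrite [X in (X <= _)%N](reindex_inj (@perm_inj _ s)) /=.
  rewrite [X in (_ <= X + _)%N]big_mkcond [X in (_ <= _ + X)%N]big_mkcond -big_split.
  by apply: leq_sum => z _ /=; case: (leqP x z) => [_|/ltnW->] /=; rewrite ?leq_addr ?leq_addl.
(* For each avoiding permutation one of the two weights is at least exp(X / (2 m)), so this total
   bounds their number. *)
have bnd : \sum_(s | avoids Red s) (E Red s + E Redr (rp * s)%g) <= 2 * m`!%:R.
  rewrite big_split /= mulrDl !mul1r; apply: lerD; first exact: later_red_weight.
  rewrite (eq_bigl (fun s => avoids Redr (rp * s)%g)) => [|s]; last by rewrite avr.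
  rewrite -(reindex_inj (mulgI rp)); exact: later_red_weight.
rewrite expRN ler_pdivlMr ?expR_gt0 //; apply: le_trans bnd.
rewrite -sum1_card natr_sum mulr_suml.
rewrite (eq_bigl (avoids Red)) => [|s]; last by rewrite inE.
apply: ler_sum => s _; rewrite mul1r /E.
set a := later_red _ _ in leX *; set c := later_red _ _.
have : (X <= 2 * a)%N || (X <= 2 * c)%N by have := leX s; rewrite -/a -/c; lia.
case/orP => h.
  apply: (@le_trans _ _ (expR (a%:R / m%:R))); last by rewrite lerDl expR_ge0.
  rewrite ler_expR ler_pdivrMr ?mulr_gt0 // mulrCA -mulrA mulVf ?gt_eqF // mulr1.
  by rewrite -natrM ler_nat.
apply: (@le_trans _ _ (expR (c%:R / m%:R))); last by rewrite lerDr expR_ge0.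
rewrite ler_expR ler_pdivrMr ?mulr_gt0 // mulrCA -mulrA mulVf ?gt_eqF // mulr1.
by rewrite -natrM ler_nat.
Qed.

(** * Block maps *)

Definition nondecr n k (t : {ffun 'I_n -> 'I_k}) : bool :=
  [forall x : 'I_n, forall z : 'I_n, (x <= z)%N ==> (t x <= t z)%N].

Definition fibers_le n k s (t : {ffun 'I_n -> 'I_k}) : bool :=
  [forall i, #|[set x | t x == i]| <= s]%N.

Lemma bin_le_2exp n m : ('C(n, m) <= 2 ^ n)%N.
Proof.
have <- : #|[set A : {set 'I_n} | #|A| == m]| = 'C(n, m) by rewrite card_draws card_ord.
apply: leq_trans (max_card _) _.
by rewrite -cardsT -powersetT card_powerset cardsT card_ord.
Qed.

Lemma card_nondecr n k : (#|[set t : {ffun 'I_n -> 'I_k} | nondecr t]| <= 2 ^ (n + k))%N.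
Proof.
case: k => [|k].
  case: n => [|n].
    by apply: leq_trans (max_card _) _; rewrite card_ffun !card_ord.
  by rewrite (_ : #|_| = 0)%N // eq_card0 // => t; case: (t ord0).
apply: (@leq_trans #|[set t : n.-tuple 'I_k.+1 | sorted leq (map val t)]|).
  pose h (t : {ffun 'I_n -> 'I_k.+1}) := [tuple t i | i < n].
  have hI : injective h.
    by move=> t t' e; apply/ffunP => i; rewrite -[LHS](tnth_mktuple t) -[RHS](tnth_mktuple t') -/(h t) e.
  rewrite -(card_imset _ hI); apply: subset_leq_card; apply/subsetP => _ /imsetP[t + ->].
  rewrite !inE => /forallP nd; rewrite /h /= -map_comp.
  have srt : sorted (fun i z : 'I_n => i <= z)%N (enum 'I_n).
    by have := iota_sorted 0 n; rewrite -val_enum_ord sorted_map.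
  rewrite sorted_map; apply: sub_sorted srt => x z /= xz.
  by have /forallP/(_ z)/implyP := nd x; apply.
rewrite card_sorted_tuples; apply: leq_trans (bin_le_2exp _ _) _.
by rewrite leq_exp2l // leq_add2l.
Qed.

(* The sampled map takes the same value at the next sample, hence the original
   monotone map is constant in between. *)
Definition pure n k (t : {ffun 'I_n -> 'I_k}) (q : 'I_n) : bool :=
  [exists q' : 'I_n, (val q' == q.+1) && (t q' == t q)].

(** A sample that is not pure is the last one with its value, so there are at most [k] of them. *)
Lemma card_pure n k (t : {ffun 'I_n -> 'I_k}) :
  nondecr t -> (n <= #|[set q | pure t q]| + k)%N.
Proof.
move=> /forallP nd.
rewrite -[leqLHS](card_ord n) -(cardsC [set q | pure t q]) leq_add2l.
rewrite -[leqRHS](card_ord k) -(card_in_imset (f := t)) ?max_card //.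
have main (q q' : 'I_n) : (q < q')%N -> q \in ~: [set q | pure t q] -> t q != t q'.
  move=> lt; rewrite !inE negb_exists => /forallP np; apply/negP => /eqP e.
  have ltn : (q.+1 < n)%N by apply: leq_ltn_trans lt _.
  have := np (Ordinal ltn); rewrite eqxx /= => /negP; apply.
  rewrite -val_eqE eqn_leq [X in _ && X](implyP (forallP (nd q) (Ordinal ltn))) ?andbT //=.
  by rewrite e (implyP (forallP (nd (Ordinal ltn)) q')).
move=> q q' qP q'P e; apply: ord_inj; case: (ltngtP q q') => // lt.
  by have := main _ _ lt qP; rewrite e eqxx.
by have := main _ _ lt q'P; rewrite e eqxx.
Qed.

(** The bathtub principle in each argument reduces arbitrary weights to two sets of size [j]. *)
Lemma box_bilinear (I : finType) (E : rel I) (a c : I -> nat) j s e :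
  (j <= #|I|)%N ->
  (forall J J' : {set I}, #|J| = j -> #|J'| = j ->
     e <= #|[set q in setX J J' | E q.1 q.2]|)%N ->
  (forall x, a x <= s)%N -> (forall x, c x <= s)%N ->
  (j * s <= \sum_x a x)%N -> (j * s <= \sum_x c x)%N ->
  (s ^ 2 * e <= \sum_x \sum_z a x * c z * E x z)%N.
Proof.
move=> ji he as_ cs suma sumc.
have -> : (\sum_x \sum_z a x * c z * E x z = \sum_x a x * \sum_z c z * E x z)%N.
  by apply: eq_bigr => x _; rewrite big_distrr /=; apply: eq_bigr => z _; rewrite mulnA.
have [J [cJ]] := box_min (fun x => \sum_z c z * E x z)%N ji as_ suma.
apply: leq_trans; rewrite exchange_big /=.
under eq_bigr do rewrite -big_distrr /=.
have [J' [cJ' h]] := box_min (fun z => \sum_(x in J) E x z)%N ji cs sumc.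
rewrite -mulnn -mulnA leq_mul2l; apply/orP; right; apply: leq_trans h.
rewrite leq_mul2l; apply/orP; right; apply: leq_trans (he J J' cJ cJ') _.
rewrite (card_pairs_in (fun q => E q.1 q.2)) exchange_big /=.
by apply: leq_sum => x _; rewrite card_set_in.
Qed.

Lemma card_set_sum (T : finType) (P : pred T) : #|[set x | P x]| = (\sum_x P x)%N.
Proof.
rewrite -sum1_card big_mkcond /=; apply: eq_bigr => x _.
by rewrite inE; case: (P x).
Qed.

Definition cell m (delta q : nat) (x : 'I_m) : bool := (x %/ delta == q)%N.

(** The forbidden entries that the samples alone certify: on a pure cell the block is known
    throughout. *)
Definition cell_red m n k delta (E : rel 'I_k) (t t' : {ffun 'I_n -> 'I_k})
    (x z : 'I_m) : bool :=
  [exists q : 'I_n, exists q' : 'I_n,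
    [&& cell delta q x, cell delta q' z, pure t q, pure t' q' & E (t q) (t' q')]].

Definition load n k (t : {ffun 'I_n -> 'I_k}) i := #|[set q in [set q | pure t q] | t q == i]|.

Lemma card_cells m n delta (Q : {set 'I_n}) (X : {set 'I_m}) : (n * delta <= m)%N ->
  (forall q x, q \in Q -> cell delta q x -> x \in X) ->
  (#|Q| * delta <= #|X|)%N.
Proof.
move=> le QX; case: delta le QX => [|delta] le QX; first by rewrite muln0.
have lt (q : 'I_n) (i : 'I_delta.+1) : (q * delta.+1 + i < m)%N.
  apply: leq_trans le; apply: (@leq_trans (q.+1 * delta.+1)); last by rewrite leq_mul2r ltn_ord orbT.
  by rewrite mulSn addnC ltn_add2r.
pose h (p : 'I_n * 'I_delta.+1) : 'I_m := Ordinal (lt p.1 p.2).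
have hI : injective h.
  move=> [q i] [q' i'] /(congr1 val) /= e; congr pair; apply: ord_inj.
    by move: (congr1 (divn^~ delta.+1) e); rewrite !divnMDl // !divn_small // !addn0.
  by move: (congr1 (modn^~ delta.+1) e); rewrite !modnMDl !modn_small.
have -> : (#|Q| * delta.+1 = #|setX Q [set: 'I_delta.+1]|)%N by rewrite cardsX cardsT card_ord.
rewrite -(card_imset _ hI); apply: subset_leq_card; apply/subsetP => _ /imsetP[[q i] + ->].
rewrite !inE /= andbT => qQ; apply: QX qQ _.
by rewrite /cell /= divnMDl // divn_small // addn0.
Qed.

(** Every pair of pure samples in adjacent blocks forbids a full square of delta^2 entries, and
    distinct squares are disjoint; columns and rows are counted in turn. *)
Lemma card_cell_red m n k delta (E : rel 'I_k) (t t' : {ffun 'I_n -> 'I_k}) :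
  (n * delta <= m)%N ->
  ((\sum_i \sum_i' load t i * load t' i' * E i i') * delta ^ 2
    <= \sum_(x < m) \sum_(z < m) cell_red delta E t t' x z)%N.
Proof.
move=> le.
pose r q q' := [&& pure t q, pure t' q' & E (t q) (t' q')].
have -> : (\sum_i \sum_i' load t i * load t' i' * E i i' = \sum_q \sum_q' r q q')%N.
  pose A q i := pure t q && (t q == i); pose A' q i := pure t' q && (t' q == i).
  have lA i : load t i = (\sum_q A q i)%N.
    by rewrite /load card_set_in big_mkcond; apply: eq_bigr => q _; rewrite inE /A; case: (pure t q).
  have lA' i : load t' i = (\sum_q A' q i)%N.
    by rewrite /load card_set_in big_mkcond; apply: eq_bigr => q _; rewrite inE /A'; case: (pure t' q).
  transitivity (\sum_i \sum_i' \sum_q \sum_q' (A q i * A' q' i' * E i i'))%N.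
    apply: eq_bigr => i _; apply: eq_bigr => i' _; rewrite lA lA' big_distrlr big_distrl.
    by apply: eq_bigr => q _; rewrite big_distrl.
  under eq_bigr => i _ do rewrite exchange_big /=.
  rewrite exchange_big /=; apply: eq_bigr => q _.
  under eq_bigr => i _ do rewrite exchange_big /=.
  rewrite exchange_big /=; apply: eq_bigr => q' _.
  rewrite (bigD1 (t q)) //= (bigD1 (t' q')) //= big1 ?addn0; last first.
    by move=> i' ni; rewrite /A' eq_sym (negPf ni) andbF muln0.
  rewrite big1 ?addn0; last first.
    by move=> i ni; rewrite big1 // => i' _; rewrite /A eq_sym (negPf ni) andbF.
  by rewrite /A /A' !eqxx /r; case: (pure t q); case: (pure t' q'); case: (E _ _).
pose X q' (x : 'I_m) := [exists q : 'I_n, cell delta q x && r q q'].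
rewrite -mulnn mulnA exchange_big /= big_distrl /= big_distrl /=.
apply: (@leq_trans (\sum_q' (\sum_(x < m) X q' x) * delta)).
  apply: leq_sum => q' _; rewrite leq_mul2r; apply/orP; right.
  have := @card_cells m n delta [set q | r q q'] [set x | X q' x] le _.
  rewrite !card_set_sum.
  by apply => q x; rewrite !inE => rq cq; apply/existsP; exists q; rewrite cq.
under eq_bigr do rewrite big_distrl /=.
rewrite exchange_big /=; apply: leq_sum => x _; rewrite -big_distrl /=.
have := @card_cells m n delta [set q' | X q' x] [set z | cell_red delta E t t' x z] le _.
rewrite !card_set_sum.
apply=> q' z; rewrite !inE => /existsP[q /andP[cq /and3P[pt pt' e]]] cq'.
by apply/existsP; exists q; apply/existsP; exists q'; rewrite cq cq' pt pt' e.
Qed.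

(** All that is kept of a copy in colour 2: the blocks of the images of the two halves, with [s] the
    block size. *)
Definition blue_embeds m k s (E : rel 'I_k) (p : 'S_m) : bool :=
  [exists b : {ffun 'I_m -> 'I_k}, exists b' : {ffun 'I_m -> 'I_k},
    [&& nondecr b, nondecr b', fibers_le s b, fibers_le s b' &
        [forall x, ~~ E (b x) (b' (p x))]]].

(** Sampling takes place at the multiples of [delta]. Each pure sample puts a whole cell of [delta]
    points into its block, so a block of size s delta has load at most [s]. *)
Lemma sample_exists m n k delta s (b : {ffun 'I_m -> 'I_k}) :
  (0 < delta)%N -> (n * delta <= m)%N -> nondecr b -> fibers_le (s * delta) b ->
  exists t : {ffun 'I_n -> 'I_k},
   [/\ nondecr t, forall i, (load t i <= s)%N &
       forall q x, pure t q -> cell delta q x -> b x = t q].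
Proof.
move=> d0 le /forallP nd /forallP fb.
have lt (q : 'I_n) : (q * delta < m)%N.
  by apply: leq_trans le; rewrite ltn_mul2r d0 ltn_ord.
pose t := [ffun q : 'I_n => b (Ordinal (lt q))].
have tP q x : pure t q -> cell delta q x -> b x = t q.
  case/existsP => q' /andP[/eqP q'q /eqP tq] /eqP cx.
  apply: ord_inj; apply/eqP; rewrite eqn_leq; apply/andP; split.
    rewrite -tq ffunE; apply: (implyP (forallP (nd x) _)) => /=.
    by rewrite q'q -cx ltnW // ltn_ceil.
  by rewrite ffunE; apply: (implyP (forallP (nd _) x)) => /=; rewrite -cx leq_divM.
exists t; split=> // [|i].
  apply/forallP => q; apply/forallP => q'; apply/implyP => qq.
  rewrite !ffunE; apply: (implyP (forallP (nd _) _)) => /=.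
  by rewrite leq_mul2r qq orbT.
rewrite -(leq_pmul2r d0); apply: leq_trans (fb i).
apply: card_cells le _ => q x; rewrite !inE => /andP[pq /eqP tq] cq.
by rewrite (tP q x pq cq) tq.
Qed.

(** Union bound over the pairs of sampled maps, at most 2^(3 k) for each half. The bilinear bound on
    loads gives s^2 e delta^2 forbidden entries for every pair, and few permutations avoid so
    many. *)
Lemma card_blue_embeds (R : realType) k m j e s delta (E : rel 'I_k) :
  (0 < k)%N -> (0 < delta)%N -> (2 * k * delta <= m)%N -> (j <= k)%N -> (j * s <= k)%N ->
  (forall J J' : {set 'I_k}, #|J| = j -> #|J'| = j ->
     e <= #|[set q in setX J J' | E q.1 q.2]|)%N ->
  #|[set p : 'S_m | blue_embeds (s * delta) E p]|%:R <=
    2 ^+ (6 * k) * (2 * m`!%:R * expR (- ((s ^ 2 * e * delta ^ 2)%N%:R / (2 * m%:R)))) :> R.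
Proof.
move=> k0 d0 le jk js he.
have m0 : (0 < m)%N by apply: leq_trans le; rewrite !muln_gt0 k0.
(* With 2 k samples at least [k] are pure, which is enough load as j s <= k. *)
set n := (2 * k)%N in le; set c := 2 * _ * _.
pose Ty := [set t : {ffun 'I_n -> 'I_k} | nondecr t && [forall i, load t i <= s]%N].
pose Av (q : {ffun 'I_n -> 'I_k} * {ffun 'I_n -> 'I_k}) :=
  [set p : 'S_m | avoids (cell_red delta E q.1 q.2) p].
apply: le_trans (_ : (\sum_(q in setX Ty Ty) #|Av q|)%N%:R <= _).
  rewrite ler_nat; apply: leq_trans (card_bigcup_le _ _); apply: subset_leq_card.
  apply/subsetP => p; rewrite inE => /existsP[b /existsP[b' /and5P[nb nb' fb fb' /forallP nE]]].
  have [t [nt lt tP]] := sample_exists d0 le nb fb.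
  have [t' [nt' lt' t'P]] := sample_exists d0 le nb' fb'.
  apply/bigcupP; exists (t, t').
    by rewrite !inE nt nt' /=; apply/andP; split; apply/forallP.
  rewrite inE; apply/forallP => x; apply/negP => /existsP[q /existsP[q' /and5P[cq cq' pq pq' Eq]]].
  by have := nE x; rewrite (tP _ _ pq cq) (t'P _ _ pq' cq') Eq.
rewrite natr_sum; apply: le_trans (_ : \sum_(q in setX Ty Ty) c <= _).
  apply: ler_sum => -[t t']; rewrite !inE /= => /andP[/andP[nt /forallP lt] /andP[nt' /forallP lt']].
  apply: le_trans (card_avoids R _ m0) _; rewrite /c ler_wpM2l ?mulr_ge0 //.
  rewrite ler_expR lerN2 ler_wpM2r ?invr_ge0 ?mulr_ge0 // ler_nat.
  apply: leq_trans (card_cell_red E t t' le); rewrite leq_mul2r; apply/orP; right.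
  have sl (u : {ffun 'I_n -> 'I_k}) : nondecr u -> (j * s <= \sum_i load u i)%N.
    move=> nu; have h := card_pure nu; have nE : n = (k + k)%N by rewrite /n mul2n addnn.
    have -> : (\sum_i load u i = #|[set q | pure u q]|)%N.
      rewrite -[RHS]sum1_card (sum_by_label u _ (fun=> 1%N)).
      by apply: eq_bigr => i _; rewrite muln1.
    by apply: leq_trans js _; move: h nE; move: #|_| => P; clear; move: n; lia.
  by apply: (box_bilinear (j := j)) => //; rewrite ?card_ord //; exact: sl.
have c0 : 0 <= c by rewrite /c !mulr_ge0 ?expR_ge0.
rewrite sumr_const -[leLHS]mulr_natl; apply: ler_wpM2r => //.
rewrite cardsX -natrX ler_nat (_ : 6 * k = 3 * k + 3 * k)%N; last by clear; lia.
rewrite expnD.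
have : (#|Ty| <= 2 ^ (3 * k))%N.
  apply: leq_trans (_ : 2 ^ (n + k) <= _)%N; last by rewrite /n leq_exp2l //; clear; lia.
  apply: leq_trans (card_nondecr n k); apply: subset_leq_card; apply/subsetP => t.
  by rewrite !inE => /andP[].
by move=> h; apply: leq_mul.
Qed.

(** * Matchings of interval chromatic number two *)

Lemma lo_subproof m (x : 'I_m) : (x < m.*2)%N.
Proof. by rewrite -addnn ltn_addr. Qed.

Lemma hi_subproof m (x : 'I_m) : (m + x < m.*2)%N.
Proof. by rewrite -addnn ltn_add2l. Qed.

Definition lo m (x : 'I_m) : 'I_(m.*2) := Ordinal (lo_subproof x).
Definition hi m (x : 'I_m) : 'I_(m.*2) := Ordinal (hi_subproof x).

Lemma lo_inj m : injective (@lo m).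
Proof. by move=> x y /(congr1 val) /= /ord_inj. Qed.

Lemma hi_inj m : injective (@hi m).
Proof. by move=> x y /(congr1 val) /= /addnI /ord_inj. Qed.

Lemma lo_neq_hi m (x y : 'I_m) : (lo x == hi y) = false.
Proof. by apply/negP => /eqP/(congr1 val) /= e; have := ltn_ord x; rewrite e; lia. Qed.

Lemma lo_or_hi m (v : 'I_(m.*2)) : (exists x, v = lo x) \/ (exists x, v = hi x).
Proof.
have [lt|le] := ltnP v m; first by left; exists (Ordinal lt); apply: ord_inj.
have lt : (v - m < m)%N by rewrite ltn_subLR // addnn.
by right; exists (Ordinal lt); apply: ord_inj; rewrite /= subnKC.
Qed.

Definition perm_edges m (p : 'S_m) : {set {set 'I_(m.*2)}} :=
  [set [set lo x; hi (p x)] | x : 'I_m].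

Lemma perm_edges_subproof m (p : 'S_m) : is_edge_set (perm_edges p).
Proof. by apply/forall_inP => _ /imsetP[x _ ->]; rewrite cards2 lo_neq_hi. Qed.

Definition perm_matching m (p : 'S_m) : ograph m.*2 := OGraph (perm_edges_subproof p).

Lemma perm_edges_eq m (p q : 'S_m) x y v :
  v \in [set lo x; hi (p x)] -> v \in [set lo y; hi (q y)] ->
  v = lo x /\ x = y \/ v = hi (p x) /\ p x = q y.
Proof.
rewrite !inE => /orP[/eqP->|/eqP->].
  by rewrite lo_neq_hi orbF => /eqP/lo_inj; left.
by rewrite eq_sym lo_neq_hi /= => /eqP/hi_inj; right.
Qed.

Lemma perm_matching_inj m : injective (@perm_matching m).
Proof.
move=> p q /(congr1 (@edges _)) /= e; apply/permP => x.
have : [set lo x; hi (p x)] \in perm_edges q.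
  by rewrite -e; apply/imsetP; exists x.
case/imsetP => y _ ee.
have h1 : lo x \in [set lo y; hi (q y)] by rewrite -ee !inE eqxx.
have h2 : hi (p x) \in [set lo y; hi (q y)] by rewrite -ee !inE eqxx orbT.
move: h1 h2; rewrite !inE lo_neq_hi orbF => /eqP/lo_inj <-.
by rewrite eq_sym lo_neq_hi /= => /eqP/hi_inj.
Qed.

Lemma perm_matching_chi2 m (p : 'S_m) : (0 < m)%N ->
  perm_matching p \in matchings_chi2 m.*2.
Proof.
move=> m0; rewrite inE; apply/and3P; split.
- apply/trivIsetP => _ _ /imsetP[x _ ->] /imsetP[y _ ->] ne.
  rewrite -setI_eq0; apply/eqP/setP => v; rewrite in_setI in_set0; apply/negP.
  case/andP => h1 h2; case/negP: ne; apply/eqP.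
  by case: (perm_edges_eq h1 h2) => [[_ ->]|[_ /perm_inj->]].
- rewrite /no_isolated_vertex; apply/eqP/setP => v; rewrite inE; apply/bigcupP.
  case: (lo_or_hi v) => -[x ->].
    by exists [set lo x; hi (p x)]; rewrite ?inE ?eqxx //; apply/imsetP; exists x.
  exists [set lo (p^-1%g x); hi (p (p^-1%g x))]; first by apply/imsetP; exists (p^-1%g x).
  by rewrite permKV !inE eqxx orbT.
rewrite /interval_chromatic_number; case: ex_minnP => n /existsP[P /andP[/and3P[pP _ eP] /eqP cP]] minn.
have e0 : [set lo (Ordinal m0); hi (p (Ordinal m0))] \in edges (perm_matching p).
  by apply/imsetP; exists (Ordinal m0).
rewrite eqn_leq; apply/andP; split; last first.
  rewrite ltnNge; apply/negP => n1.
  have [A AP loA] : exists2 A, A \in P & lo (Ordinal m0) \in A.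
    by apply/bigcupP; rewrite -/(cover P) (cover_partition pP) inE.
  have [A' A'P hiA'] : exists2 A, A \in P & hi (p (Ordinal m0)) \in A.
    by apply/bigcupP; rewrite -/(cover P) (cover_partition pP) inE.
  have AA' : A' = A.
    by move: n1; rewrite -cP => /card_le1P/(_ A AP) H; move: A'P; rewrite H => /eqP.
  have := forall_inP (forall_inP eP A AP) _ e0; case/negP.
  by rewrite subUset !sub1set loA -AA' hiA'.
pose A := [set v : 'I_(m.*2) | (v < m)%N].
have loA x : lo x \in A by rewrite inE /=.
have hiA x : hi x \notin A by rewrite inE /= -leqNgt leq_addr.
have ne : A != ~: A.
  by apply/eqP => /setP/(_ (lo (Ordinal m0))); rewrite in_setC loA.
apply: minn; apply/existsP; exists [set A; ~: A]; rewrite cards2 ne eqxx andbT.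
apply/and3P; split.
- apply/and3P; split.
  + rewrite /cover bigcup_setU !big_set1 setUCr //.
  + apply/trivIsetP => _ _ /set2P[]-> /set2P[]->; rewrite ?eqxx // => _.
      by rewrite -setI_eq0 setICr.
    by rewrite -setI_eq0 setIC setICr.
  + apply/negP => /set2P[] /setP; first by move/(_ (lo (Ordinal m0))); rewrite loA inE.
    by move/(_ (hi (Ordinal m0))); rewrite in_setC hiA inE.
- apply/forall_inP => _ /set2P[]->; apply/forall_inP => i iA; apply/forall_inP => j jA;
    apply/forallP => k; apply/implyP => /andP[ik kj]; move: iA jA; rewrite !inE.
    by move=> _; apply: leq_ltn_trans.
  by rewrite -!leqNgt => mi _; apply: leq_trans ik.
- apply/forall_inP => _ /set2P[]->; apply/forall_inP => _ /imsetP[x _ ->];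
    rewrite subUset !sub1set ?in_setC ?loA ?(negPf (hiA _)) ?andbF //.
Qed.

(** Every edge has exactly one end in each of the two intervals, so both have as many vertices as
    there are edges. The interval containing 0 is therefore the first half, and the partners of its
    points define the permutation. *)
Lemma matchings_chi2_perm m (M : ograph m.*2) : (0 < m)%N ->
  M \in matchings_chi2 m.*2 -> exists p : 'S_m, M = perm_matching p.
Proof.
move=> m0; rewrite inE => /and3P[tM /eqP cM].
rewrite /interval_chromatic_number.
case: ex_minnP => n /existsP[P /andP[/and3P[pP iP eP] /eqP cP]] _ /eqP n2.
have v0 : (0 < m.*2)%N by rewrite double_gt0.
pose z : 'I_(m.*2) := Ordinal v0.
pose A := pblock P z.
have zP : z \in cover P by rewrite (cover_partition pP) inE.
have AP : A \in P by exact: pblock_mem.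
have zA : z \in A by rewrite mem_pblock.
have down (i j : 'I_(m.*2)) : j \in A -> (i <= j)%N -> i \in A.
  move=> jA ij; have /forall_inP/(_ z zA)/forall_inP/(_ j jA)/forallP/(_ i)/implyP := forall_inP iP A AP.
  by apply.
have [B [BP BA PB]] : exists B, [/\ B \in P, B = ~: A & P = [set A; B]].
  have /cards1P[B PB] : #|P :\ A| == 1%N.
    by have := cardsD1 A P; rewrite AP cP n2 /= add1n => -[<-].
  have BPA : B \in P :\ A by rewrite PB set11.
  have PAB : P = [set A; B] by rewrite -PB setD1K.
  exists B; split=> //; first by move: BPA => /setD1P[].
  have trP : trivIset P by case/and3P: pP.
  have nAB : A != B by move: BPA; rewrite in_setD1 eq_sym => /andP[].
  have dAB : [disjoint A & B].
    by apply: (trivIsetP trP) => //; move: BPA => /setD1P[].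
  have cAB : A :|: B = setT.
    by rewrite -(cover_partition pP) PAB /cover bigcup_setU !big_set1.
  apply/setP => v; rewrite in_setC.
  have : v \in A :|: B by rewrite cAB inE.
  rewrite in_setU; case: (boolP (v \in A)) => //= vA _.
  by rewrite (disjointFr dAB vA).
have card1 C e : C \in P -> e \in edges M -> (#|e :&: C| <= 1)%N.
  move=> CP eM; rewrite leqNgt; apply/negP => lt.
  have := forall_inP (forall_inP eP C CP) e eM; case/negP.
  have e2 := eqP (forall_inP (edgesP M) e eM).
  have /eqP <- : e :&: C == e by rewrite eqEcard subsetIl e2.
  exact: subsetIr.
have eI e : e \in edges M -> #|e :&: A| = 1%N /\ #|e :&: B| = 1%N.
  move=> eM; have e2 := eqP (forall_inP (edgesP M) e eM).
  have := cardsID A e; rewrite setDE -BA e2.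
  move: (card1 A e AP eM) (card1 B e BP eM); clear.
  by move: #|_| #|_| => a c; lia.
have cardC (C : {set 'I_(m.*2)}) : (forall e, e \in edges M -> #|e :&: C| = 1%N) -> #|C| = #|edges M|.
  move=> h; rewrite -sum1_card (eq_bigl (fun v => (v \in cover (edges M)) && (v \in C))).
    rewrite (big_trivIset_cond _ tM) -sum1_card; apply: eq_bigr => e eM.
    by rewrite -[RHS](h e eM) -sum1_card; apply: eq_bigl => v; rewrite inE.
  by move=> v; rewrite cM inE.
have cA : #|A| = m.
  have := cardsC A; rewrite -BA (cardC A) ?(cardC B) => [|e /eI[]//|e /eI[]//].
  by rewrite card_ord addnn => /double_inj ->.
(* [A] is closed downwards and has [m] elements. *)
have AE v : (v \in A) = (v < m)%N.
  have sub : A \subset [set v : 'I_(m.*2) | (v < m)%N].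
    apply/subsetP => i iA; rewrite inE.
    have : (#|[set v : 'I_(m.*2) | (v <= i)%N]| <= #|A|)%N.
      by apply: subset_leq_card; apply/subsetP => j; rewrite inE; exact: down.
    rewrite cA; apply: leq_trans.
    pose h (j : 'I_i.+1) : 'I_(m.*2) := widen_ord (ltn_ord i) j.
    have hI : injective h by move=> j j' /(congr1 val) /= /ord_inj.
    rewrite -[leqLHS]card_ord -cardsT -(card_imset _ hI).
    apply: subset_leq_card; apply/subsetP => _ /imsetP[j _ ->].
    by rewrite inE /= -ltnS.
  have /eqP -> : A == [set v : 'I_(m.*2) | (v < m)%N].
    rewrite eqEcard sub cA /=.
    have -> : [set v : 'I_(m.*2) | (v < m)%N] = (@lo m) @: setT.
      apply/setP => u; rewrite inE; apply/idP/imsetP => [lt|[x _ ->]]; last exact: (ltn_ord x).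
      by exists (Ordinal lt) => //; apply: ord_inj.
    by apply: leq_trans (leq_imset_card _ _) _; rewrite cardsT card_ord.
  by rewrite inE.
have partner (x : 'I_m) : exists y : 'I_m, [set lo x; hi y] \in edges M.
  have : lo x \in cover (edges M) by rewrite cM inE.
  case/bigcupP => e eM xe.
  have /eqP/cards1P[v ev] := (eI e eM).2.
  have : v \in e :&: B by rewrite ev set11.
  rewrite in_setI BA in_setC AE -leqNgt => /andP[ve mv].
  case: (lo_or_hi v) => -[y vy]; first by move: mv; rewrite vy /= leqNgt ltn_ord.
  exists y; rewrite (_ : [set _; _] = e) //; apply/eqP; rewrite eqEcard.
  by rewrite subUset !sub1set xe -vy ve (eqP (forall_inP (edgesP M) e eM)) cards2 vy lo_neq_hi.
have [f fP] := fin_all_exists partner.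
have same e e' v : e \in edges M -> e' \in edges M -> v \in e -> v \in e' -> e = e'.
  move=> eM e'M ve ve'; apply/eqP; apply/negPn/negP => ne.
  have := trivIsetP tM _ _ eM e'M ne; rewrite -setI_eq0 => /eqP/setP/(_ v).
  by rewrite in_setI ve ve' inE.
have fI : injective f.
  move=> x x' e; have ee : [set lo x; hi (f x)] = [set lo x'; hi (f x')].
    by apply: (same _ _ (hi (f x))) => //; rewrite !inE ?e eqxx orbT.
  have : lo x \in [set lo x'; hi (f x')] by rewrite -ee !inE eqxx.
  by rewrite !inE lo_neq_hi orbF => /eqP/lo_inj.
exists (perm fI); apply: val_inj => /=; apply/setP => e; apply/idP/imsetP => [eM|[x _ ->]].
  have /eqP/cards1P[v ev] := (eI e eM).1.
  have : v \in e :&: A by rewrite ev set11.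
  rewrite in_setI AE => /andP[ve vm].
  exists (Ordinal vm) => //; apply: (same _ _ v) => //; first by rewrite permE.
  have vl : v = lo (Ordinal vm) by apply: ord_inj.
  by rewrite in_set2 {1}vl eqxx.
by rewrite permE.
Qed.

(** * The colouring *)

Lemma set2_eq (T : finType) (u v u' v' : T) : u != v ->
  [set u; v] = [set u'; v'] -> u = u' /\ v = v' \/ u = v' /\ v = u'.
Proof.
move=> ne e.
have hu : u \in [set u'; v'] by rewrite -e set21.
have hv : v \in [set u'; v'] by rewrite -e set22.
move: hu hv ne; rewrite !inE => /orP[/eqP->|/eqP->] /orP[/eqP->|/eqP->];
  rewrite ?eqxx // => _; [by left | by right].
Qed.

(** If k s or fewer vertices sufficed, the block colouring would contain a triangle of colour 1,
    projecting to a triangle of [E], or a copy of the matching in colour 2, whose blocks witness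
    [blue_embeds]. *)
Lemma ordered_ramsey_gt k s m (E : rel 'I_k) (p : 'S_m) :
  (0 < s)%N -> symmetric E -> (forall u v w, E u v -> E u w -> E v w -> False) ->
  ~~ blue_embeds s E p ->
  (k * s < ordered_ramsey (complete_graph 3) (perm_matching p))%N.
Proof.
move=> s0 symE triE; apply: contraR; rewrite -leqNgt.
rewrite /ordered_ramsey; case: ex_minnP => N arr _ leN.
have lt (u : 'I_N) : (u %/ s < k)%N.
  by rewrite ltn_divLR // (leq_trans (ltn_ord u)).
pose blk (u : 'I_N) : 'I_k := Ordinal (lt u).
(* Pairs inside a block get colour 2: triangle-freeness is assumed for repeated vertices too, so [E]
   has no loops. *)
pose c : coloring N :=
  [ffun e : {set 'I_N} => [exists u, exists v, (e == [set u; v]) && E (blk u) (blk v)]].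
have cE u v : u != v -> c [set u; v] = E (blk u) (blk v).
  move=> ne; rewrite ffunE; apply/idP/idP => [|Euv].
    case/existsP => u' /existsP[v' /andP[/eqP e E']].
    by case: (set2_eq ne e) => -[-> ->] //; rewrite symE.
  by apply/existsP; exists u; apply/existsP; exists v; rewrite eqxx.
have /forallP/(_ c)/orP[] := arr.
  case/existsP => phi /andP[/forallP mono /forallP em].
  have red (i j : 'I_3) : (i < j)%N -> E (blk (phi i)) (blk (phi j)).
    move=> ij; have /forallP/(_ j)/implyP/(_ ij) lt_phi := mono i.
    have ne : phi i != phi j by apply: contraTneq lt_phi => ->; rewrite ltnn.
    have : [set i; j] \in edges (complete_graph 3).
      have nij : i != j by apply: contraTneq ij => ->; rewrite ltnn.
      by rewrite inE cards2 nij.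
    move/(implyP (forallP (em i) j)); rewrite !inE => /andP[_ /eqP].
    by rewrite cE.
  pose a := @Ordinal 3 0 isT; pose b := @Ordinal 3 1 isT; pose d := @Ordinal 3 2 isT.
  by case: (triE (blk (phi a)) (blk (phi b)) (blk (phi d))); exact: red.
case/existsP => phi /andP[/forallP mono /forallP em].
have incr (u v : 'I_(m.*2)) : (u <= v)%N -> (phi u <= phi v)%N.
  rewrite leq_eqVlt => /orP[/eqP/ord_inj->//|uv].
  by have /forallP/(_ v)/implyP/(_ uv)/ltnW := mono u.
have phiI : injective phi.
  move=> u v e; apply: ord_inj; case: (ltngtP u v) => // uv.
    by have /forallP/(_ v)/implyP/(_ uv) := mono u; rewrite e ltnn.
  by have /forallP/(_ u)/implyP/(_ uv) := mono v; rewrite e ltnn.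
have fib (i : 'I_k) : (#|[set u : 'I_N | blk u == i]| <= s)%N.
  pose h (u : 'I_N) : 'I_s := Ordinal (ltn_pmod u s0).
  rewrite -[leqRHS](card_ord s) -(card_in_imset (f := h)) ?max_card //.
  move=> u v; rewrite !inE => /eqP bu /eqP bv /(congr1 val) /= e; apply: ord_inj.
  rewrite (divn_eq u s) (divn_eq v s) e; congr (_ * s + _)%N.
  by have := congr1 val bu; have := congr1 val bv => /= -> ->.
have part (h : 'I_m -> 'I_(m.*2)) : injective h ->
    (forall x z : 'I_m, (x <= z)%N -> (h x <= h z)%N) ->
    nondecr [ffun x => blk (phi (h x))] && fibers_le s [ffun x => blk (phi (h x))].
  move=> hI hm; apply/andP; split.
    apply/forallP => x; apply/forallP => z; apply/implyP => xz; rewrite !ffunE /=.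
    by rewrite leq_div2r // incr // hm.
  apply/forallP => i; apply: leq_trans (fib i).
  rewrite -(card_imset _ (inj_comp phiI hI)); apply: subset_leq_card.
  by apply/subsetP => _ /imsetP[x + ->]; rewrite !inE ffunE.
apply/existsP; exists [ffun x => blk (phi (lo x))].
apply/existsP; exists [ffun x => blk (phi (hi x))].
have /andP[-> ->] := part _ (@lo_inj m) (fun x z xz => xz).
have /andP[-> ->] /= : nondecr [ffun x => blk (phi (@hi m x))] &&
      fibers_le s [ffun x => blk (phi (@hi m x))].
  by apply: part (@hi_inj m) _ => x z xz; rewrite /= leq_add2l.
apply/forallP => x; rewrite !ffunE.
have : [set lo x; hi (p x)] \in edges (perm_matching p) by apply/imsetP; exists x.
move/(implyP (forallP (em _) _)); rewrite !inE => /andP[_ /eqP].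
by rewrite cE ?(inj_eq phiI) ?lo_neq_hi // => ->.
Qed.

Lemma transport_graph (V : finType) k (E : rel V) (j e : nat) : #|V| = k ->
  symmetric E -> (forall u v w, E u v -> E u w -> E v w -> False) ->
  (forall J J' : {set V}, #|J| = j -> #|J'| = j ->
     e <= #|[set q in setX J J' | E q.1 q.2]|)%N ->
  exists E' : rel 'I_k, [/\ symmetric E',
    (forall u v w, E' u v -> E' u w -> E' v w -> False) &
    (forall J J' : {set 'I_k}, #|J| = j -> #|J'| = j ->
     e <= #|[set q in setX J J' | E' q.1 q.2]|)%N].
Proof.
move=> <- symE triE eE; exists (fun u v => E (enum_val u) (enum_val v)); split.
- by move=> u v; exact: symE.
- by move=> u v w; exact: triE.
move=> J J' cJ cJ'; pose h (u : 'I_#|V|) := enum_val u.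
have hI : injective h by exact: enum_val_inj.
have := eE (h @: J) (h @: J'); rewrite !card_imset // => /(_ cJ cJ') le.
apply: leq_trans le _.
have hhI : injective (fun q : 'I_#|V| * 'I_#|V| => (h q.1, h q.2)).
  by move=> [a b] [a' b'] [] /= /hI -> /hI ->.
rewrite -[leqRHS](card_imset _ hhI); apply: subset_leq_card; apply/subsetP => -[u v].
rewrite !inE /= => /andP[/andP[/imsetP[a aJ ->] /imsetP[b bJ ->]] Eab].
by apply/imsetP; exists (a, b) => //; rewrite !inE /= aJ bJ.
Qed.

(** * Asymptotics *)

(** The matchings correspond to permutations, and a small Ramsey number forces [blue_embeds] for the
    fixed graph. The lower bound on [m] is exactly what makes the exponent beat the number of
    types. *)
Lemma few_small_ramsey (R : realType) d m :
  (2 ^ 16 <= d)%N -> (2 ^ (12 * d + 34) * d <= m)%N ->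
  #|[set M in matchings_chi2 m.*2 |
      (2 ^ 27 * ordered_ramsey (complete_graph 3) M <= 2 ^ (4 * d) * m)%N]|%:R
    <= 2 ^- d * #|matchings_chi2 m.*2|%:R :> R.
Proof.
move=> ld lm; have d16 : (65 <= d)%N.
  by apply: leq_trans ld; rewrite (_ : 65 = 2 ^ 6 + 1)%N // addn1 ltn_exp2l.
have [E0 [symE0 triE0 eE0]] := triangle_free_graph R ld.
have [k kd] : exists k, k = (2 ^ (8 * d) * (4 * d))%N by exists (2 ^ (8 * d) * (4 * d))%N.
have [j jd] : exists j, j = (d * 2 ^ (4 * d + 27))%N by exists (d * 2 ^ (4 * d + 27))%N.
have [e ed] : exists e, e = (d ^ 2 * 2 ^ (4 * d + 30))%N by exists (d ^ 2 * 2 ^ (4 * d + 30))%N.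
(* The load bound is chosen so that j s = k, the number of pure samples guaranteed. *)
have [s sd] : exists s, s = (2 ^ (4 * d - 25))%N by exists (2 ^ (4 * d - 25))%N.
rewrite -jd -ed in eE0.
have cV : #|{: 'I_(2 ^ (8 * d)) * 'I_(4 * d)}| = k by rewrite card_prod !card_ord kd.
have [E [symE triE eE]] := transport_graph cV symE0 triE0 eE0.
have d0 : (0 < d)%N by clear -d16; lia.
have s0 : (0 < s)%N by rewrite sd expn_gt0.
have k0 : (0 < k)%N by rewrite kd !muln_gt0 expn_gt0 d0.
have jsk : (j * s = k)%N.
  rewrite jd sd kd -mulnA -expnD (_ : 4 * d + 27 + (4 * d - 25) = 8 * d + 2)%N; last by clear -d16; lia.
  by rewrite expnD -[(2 ^ 2)%N]/4%N; clear; lia.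
have jk : (j <= k)%N by rewrite -jsk leq_pmulr.
have kE : k = (2 ^ (8 * d + 2) * d)%N by rewrite kd expnD -[(2 ^ 2)%N]/4%N mulnA.
have le2k : (2 * k <= m)%N.
  apply: leq_trans lm; rewrite kE mulnA -expnS leq_mul2r leq_exp2l //.
  by apply/orP; right; clear; lia.
pose delta := (m %/ (2 * k))%N.
have k20 : (0 < 2 * k)%N by rewrite muln_gt0.
have delta0 : (0 < delta)%N by rewrite divn_gt0.
have kdm : (2 * k * delta <= m)%N by rewrite mulnC leq_divM.
have m0 : (0 < m)%N by apply: leq_trans le2k.
have mkd : (m <= 4 * k * delta)%N.
  have := ltn_ceil m k20; rewrite -/delta => /ltnW /leq_trans; apply.
  by rewrite mulSn; move: delta0; clear; nia.
have s_e : (s ^ 2 * e = d ^ 2 * 2 ^ (12 * d - 20))%N.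
  rewrite sd ed -expnM mulnCA -expnD; congr (_ * 2 ^ _)%N; clear -d16; lia.
(* This yields a failure factor 2^(-8 k) against 2^(6 k + 1). It follows from m <= 4 k delta and 256
   k^3 <= m s^2 e. *)
have exponent : (16 * k * m <= s ^ 2 * e * delta ^ 2)%N.
  have h1 : (m ^ 2 <= 16 * k ^ 2 * delta ^ 2)%N.
    by rewrite -[16%N]/(4 ^ 2)%N -!expnMn leq_exp2r.
  have h2 : (256 * k ^ 3 <= m * (s ^ 2 * e))%N.
    apply: (@leq_trans (2 ^ (12 * d + 34) * d * (d ^ 2 * 2 ^ (12 * d - 20)))); last first.
      by rewrite s_e leq_mul2r lm orbT.
    rewrite kE expnMn -expnM [(d ^ 2 * _)%N]mulnC mulnACA -expnS -expnD.
    rewrite (_ : 12 * d + 34 + (12 * d - 20) = 8 + (8 * d + 2) * 3)%N; last by clear -d16; lia.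
    by rewrite expnD -mulnA; apply: leq_mul.
  rewrite -(@leq_pmul2r (16 * k ^ 2)) ?muln_gt0 ?expn_gt0 ?k0 //.
  apply: (@leq_trans (s ^ 2 * e * m ^ 2)); last first.
    rewrite -[leqRHS]mulnA leq_mul2l; apply/orP; right.
    by apply: leq_trans h1 _; rewrite mulnC.
  have -> : (16 * k * m * (16 * k ^ 2) = (256 * k ^ 3) * m)%N.
    by rewrite !expnS expn0; clear; lia.
  apply: (@leq_trans (m * (s ^ 2 * e) * m)); first by rewrite leq_mul2r h2 orbT.
  by rewrite -!mulnn; clear; move: (s * s * e)%N => a; lia.
have cnt := card_blue_embeds R k0 delta0 kdm jk (eq_leq jsk) eE.
have fact_le : (m`! <= #|matchings_chi2 m.*2|)%N.
  rewrite -card_Sn -cardsT -(card_imset _ (@perm_matching_inj m)).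
  apply: subset_leq_card; apply/subsetP => _ /imsetP[p _ ->].
  exact: perm_matching_chi2.
apply: (@le_trans _ _ #|[set p : 'S_m | blue_embeds (s * delta) E p]|%:R).
  rewrite ler_nat; apply: leq_trans (leq_imset_card (@perm_matching m) _).
  apply: subset_leq_card; apply/subsetP => M; rewrite inE => /andP[MP leM].
  have [p Mp] := matchings_chi2_perm m0 MP.
  apply/imsetP; exists p => //; rewrite in_set; apply: contraT => nb; exfalso.
  have sd0 : (0 < s * delta)%N by rewrite muln_gt0 s0 delta0.
  have := ordered_ramsey_gt sd0 symE triE nb; rewrite -Mp ltnNge => /negP; apply.
  rewrite -(@leq_pmul2l (2 ^ 27)) ?expn_gt0 //; apply: leq_trans leM _.
  (* As m <= 4 k delta, the coloured vertex set has k s delta >= s m / 4 = 2^(4 d - 27) m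
     elements. *)
  have -> : (4 * d = 27 + (4 * d - 25) - 2)%N by clear -d16; lia.
  have -> : (27 + (4 * d - 25) - 2 = 25 + (4 * d - 25))%N by clear -d16; lia.
  rewrite expnD -sd -[27%N]/(25 + 2)%N expnD -[(2 ^ 2)%N]/4%N.
  move: (2 ^ 25)%N => c25; have := leq_mul (leqnn (c25 * s)) mkd.
  by clear; move: (delta) => D; lia.
apply: le_trans cnt _.
have fl : m`!%:R <= #|matchings_chi2 m.*2|%:R :> R by rewrite ler_nat.
apply: le_trans (_ : 2 ^- d * m`!%:R <= _); last by rewrite ler_wpM2l // invr_ge0 exprn_ge0.
have ex : expR (- ((s ^ 2 * e * delta ^ 2)%N%:R / (2 * m%:R))) <= 2 ^- (8 * k) :> R.
  apply: le_trans (expRN_nat_le R (8 * k)); rewrite ler_expR lerN2.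
  have m2 : 0 < 2 * m%:R :> R by rewrite mulr_gt0 ?ltr0n.
  rewrite ler_pdivlMr // -!natrM ler_nat.
  by apply: leq_trans exponent; clear; lia.
apply: (@le_trans _ _ (2 ^+ (6 * k) * (2 * m`!%:R * 2 ^- (8 * k)))).
  by rewrite ler_wpM2l ?exprn_ge0 // ler_wpM2l // mulr_ge0.
apply: (@le_trans _ _ ((2 ^+ (6 * k).+1 / 2 ^+ (8 * k)) * m`!%:R)).
  by rewrite le_eqVlt; apply/orP; left; apply/eqP; rewrite exprS; ring.
rewrite ler_wpM2r //; apply: pow2_ratio.
have : (d <= k)%N by rewrite kE leq_pmull // expn_gt0.
by move: k0; clear; lia.
Qed.

(** After cubing, 2^(12 d) m^3 <= 2^81 a^3 and m <= 2^47 2^(12 d) d give m^4 / d <= 2^128 a^3. The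
    factor 2^4 from n = 2 m leads to 132 = 3 * 44, and d <= log n. *)
Lemma small_ratio_bound (R : realType) d m (a : nat) :
  (0 < d)%N -> (2 ^ (12 * d + 34) * d <= m)%N ->
  (m < 2 ^ (12 * d.+1 + 34) * d.+1)%N -> (2 ^ (4 * d) * m <= 2 ^ 27 * a)%N ->
  2 ^- 44 * (m.*2%:R `^ (4 / 3) / log2 (m.*2%:R : R) `^ (1 / 3)) <= a%:R :> R.
Proof.
move=> d0 lm mlt le_a.
have two0 : 0 < 2 :> R by [].
have m0 : (0 < m)%N by apply: leq_trans lm; rewrite muln_gt0 expn_gt0.
pose n : R := m.*2%:R; pose L : R := log2 n.
have n0 : 0 < n by rewrite ltr0n double_gt0.
have ln2 : 0 < ln 2 :> R by rewrite ln_gt0 // ltr1n.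
have dL : d%:R <= L.
  rewrite /L /log2 ler_pdivlMr // mulr_natl -lnXn // ler_ln ?posrE ?exprn_gt0 //.
  rewrite -natrX ler_nat; apply: (@leq_trans m); last by rewrite -addnn leq_addr.
  apply: leq_trans lm; apply: leq_trans (leq_pmulr _ d0); rewrite leq_exp2l //.
  by clear; lia.
have L0 : 0 < L by apply: lt_le_trans dL; rewrite ltr0n.
set x := 2 ^- 44 * _.
have x0 : 0 <= x by rewrite !mulr_ge0 ?invr_ge0 ?exprn_ge0 ?powR_ge0.
rewrite -(@ler_pXn2r _ 3) ?nnegrE //.
have cube (y : R) q : (y `^ (q / 3)) ^+ 3 = y `^ q.
  rewrite -powR_mulrn ?powR_ge0 // -powRrM; congr (_ `^ _).
  by rewrite -mulrA mulVf ?mulr1 // pnatr_eq0.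
have -> : x ^+ 3 = 2 ^- 132 * (n ^+ 4 / L).
  rewrite /x !exprMn !exprVn !cube powRr1 ?(ltW L0) // -exprM.
  by rewrite -[4 : R]/(4%:R) powR_mulrn // ltW.
rewrite ler_pdivrMl ?exprn_gt0 // ler_pdivrMr //.
(* The upper bound has exponent 12 (d + 1) + 34 = 12 d + 46, and d + 1 <= 2 d costs one more factor
   2. *)
have mle : (m%:R : R) <= 2 ^+ 47 * 2 ^+ (12 * d) * d%:R.
  rewrite -exprD -natrX -natrM ler_nat; apply: leq_trans (ltnW mlt) _.
  have -> : (47 + 12 * d = (12 * d.+1 + 34).+1)%N by clear; lia.
  rewrite expnS [X in (_ <= X * _)%N]mulnC -mulnA leq_mul2l.
  by apply/orP; right; rewrite mul2n -addnn -add1n leq_add2r.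
have ale : 2 ^+ (12 * d) * m%:R ^+ 3 <= 2 ^+ 81 * a%:R ^+ 3 :> R.
  have : (2 ^+ (4 * d) * m%:R) ^+ 3 <= (2 ^+ 27 * a%:R) ^+ 3 :> R.
    rewrite lerXn2r ?nnegrE ?mulr_ge0 ?exprn_ge0 //.
    by rewrite -!natrX -!natrM ler_nat.
  rewrite [(_ * m%:R) ^+ 3]exprMn [(_ * a%:R) ^+ 3]exprMn -!exprM.
  by rewrite (_ : 4 * d * 3 = 12 * d)%N //; clear; lia.
have -> : n ^+ 4 = 2 ^+ 4 * (m%:R * m%:R ^+ 3).
  by rewrite -exprS -exprMn -natrM mul2n.
apply: (@le_trans _ _ (2 ^+ 4 * (2 ^+ 47 * 2 ^+ (12 * d) * d%:R * m%:R ^+ 3))).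
  by rewrite ler_wpM2l ?exprn_ge0 // ler_wpM2r ?exprn_ge0.
apply: (@le_trans _ _ (2 ^+ 4 * 2 ^+ 47 * d%:R * (2 ^+ 81 * a%:R ^+ 3))).
  apply: le_trans (ler_wpM2l _ ale); last by rewrite !mulr_ge0 ?exprn_ge0.
  by rewrite le_eqVlt; apply/orP; left; apply/eqP; move: (2 ^+ 4) (2 ^+ 47) => u v; ring.
have -> : 2 ^+ 132 = 2 ^+ 4 * 2 ^+ 47 * 2 ^+ 81 :> R by rewrite -!exprD.
have c0 : 0 <= 2 ^+ 4 * 2 ^+ 47 * 2 ^+ 81 * a%:R ^+ 3 :> R by rewrite !mulr_ge0 ?exprn_ge0.
apply: le_trans (ler_wpM2l c0 dL).
by rewrite le_eqVlt; apply/orP; left; apply/eqP;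
  move: (2 ^+ 4) (2 ^+ 47) (2 ^+ 81) => u v w; ring.
Qed.

(** The scale attached to [m] is the largest admissible [d], so that [m] is pinned up to a constant
    factor. *)
Lemma scale_exists D m : (0 < D)%N -> (2 ^ (12 * D + 34) * D <= m)%N ->
  exists d, [/\ (D <= d)%N, (2 ^ (12 * d + 34) * d <= m)%N &
     (m < 2 ^ (12 * d.+1 + 34) * d.+1)%N].
Proof.
move=> D0 le; pose P d := (2 ^ (12 * d + 34) * d <= m)%N.
have exP : exists d, P d by exists D.
have bP d : P d -> (d <= m)%N.
  by apply: leq_trans; rewrite leq_pmull // expn_gt0.
case: (ex_maxnP exP bP) => d Pd maxd; exists d; split=> //; first exact: maxd.
by rewrite ltnNge; apply/negP => /(maxd d.+1); rewrite ltnn.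
Qed.

Lemma random_matching_ramsey (R : realType) D m :
  (2 ^ 16 <= D)%N -> (2 ^ (12 * D + 34) * D <= m)%N ->
  1 - 2 ^- D <= finite_uniform_pr R (matchings_chi2 m.*2)
    (fun M => 2 ^- 44 * (m.*2%:R `^ (4 / 3) / log2 (m.*2%:R : R) `^ (1 / 3))
              <= (ordered_ramsey (complete_graph 3) M)%:R) <= 1.
Proof.
move=> lD lm; have D0 : (0 < D)%N by apply: leq_trans lD; rewrite expn_gt0.
have [d [Dd dm md]] := scale_exists D0 lm.
have m0 : (0 < m)%N by apply: leq_trans lm; rewrite muln_gt0 expn_gt0.
rewrite /finite_uniform_pr; set A := matchings_chi2 _; set G := [set x in A | _].
have A0 : 0 < #|A|%:R :> R.
  rewrite ltr0n; apply/card_gt0P; exists (perm_matching 1%g); exact: perm_matching_chi2.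
have sub : (#|G| <= #|A|)%N.
  by apply: subset_leq_card; apply/subsetP => M; rewrite inE => /andP[].
apply/andP; split; last by rewrite ler_pdivrMr // mul1r ler_nat.
rewrite ler_pdivlMr // mulrBl mul1r lerBlDr.
have few := few_small_ramsey R (leq_trans lD Dd) dm.
apply: le_trans (_ : #|G|%:R + 2 ^- d * #|A|%:R <= _); last first.
  rewrite lerD2l ler_wpM2r // lef_pV2 ?posrE ?exprn_gt0 //.
  by rewrite ler_weXn2l // ler1n.
apply: le_trans (lerD (lexx _) few); rewrite -natrD ler_nat.
apply: leq_trans (leq_card_setU _ _); apply: subset_leq_card; apply/subsetP => M MA.
apply/setUP.
have /orP[le|le] :=
    leq_total (2 ^ 27 * ordered_ramsey (complete_graph 3) M) (2 ^ (4 * d) * m).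
  by right; apply/setIdP; split; [exact: MA | exact: le].
left; apply/setIdP; split; first exact: MA.
exact: small_ratio_bound (leq_trans D0 Dd) dm md le.
Qed.

Local Open Scope classical_set_scope.
Local Open Scope ring_scope.

Theorem theorem1p4 (R : realType) :
  exists2 c : R, 0 < c &
    (fun m : nat =>
       let n := m.*2 in
       finite_uniform_pr R (matchings_chi2 n)
         (fun M : ograph n =>
            c * (n%:R `^ (4 / 3) / log2 (n%:R : R) `^ (1 / 3))
              <= (ordered_ramsey (complete_graph 3) M)%:R))
      @ \oo --> (1 : R).
Proof.
exists (2 ^- 44); first by rewrite invr_gt0 exprn_gt0.
apply/cvgrPdist_le => /= eps eps0.
(* The second term makes 2^-D at most eps; the first is the threshold of the construction. *)
pose D := maxn (2 ^ 16) (Num.bound eps^-1).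
exists (2 ^ (12 * D + 34) * D)%N => // m /= lm.
have /andP[lo1 up1] := random_matching_ramsey R (leq_maxl _ _ : 2 ^ 16 <= D)%N lm.
rewrite ger0_norm ?subr_ge0 // lerBlDr -lerBlDl; apply: le_trans lo1.
rewrite lerD2l lerN2 -[leRHS]invrK lef_pV2 ?posrE ?exprn_gt0 ?invr_gt0 //.
apply: ltW; apply: lt_le_trans (archi_boundP _) _; first by rewrite invr_ge0 ltW.
rewrite -natrX ler_nat; apply: leq_trans (leq_maxr (2 ^ 16) _) _.
by apply: ltnW; exact: ltn_expl.
Qed.
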